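(* Let $A\in\mathrm{GL}(\mathbb R^d)$ be such that its spectrum $\sigma(A)$ satisfies: whenever $\lambda\in\sigma(A)$ and $\lambda\notin\mathbb R$, then $\lambda$ is simple and $|\eta|\ne|\lambda|$ for all $\eta\in\sigma(A)\setminus\{\lambda,\bar\lambda\}$. Then all eight first angular values $\check\theta_{[1]}(A),\check\theta_1(A),\hat\theta_1(A),\hat\theta_{[1]}(A),\underline\theta_{[1]}(A),\underline\theta_1(A),\bar\theta_1(A),\bar\theta_{[1]}(A)$ coincide; denote the common value by $\theta_1(A)$. Let $\mathbb R^d=\bigoplus_{i=1}^k\mathcal R(Q_i)$, with $Q_i\in\mathbb R^{d,d_i}$, $Q_i^\top Q_i=I_{d_i}$, be a decomposition of $\mathbb R^d$ into invariant subspaces of $A$ corresponding to eigenvalues of equal modulus, i.e. $AQ_i=Q_iA_i$ with $A_i\in\mathbb R^{d_i,d_i}$, where for each $i$ all eigenvalues of $A_i$ have the same modulus $|\sigma(A_i)|$ and $|\sigma(A_1)|,\dots,|\sigma(A_k)|$ are pairwise different. Then $$\theta_1(A)=\max_{i=1,\dots,k}\theta_1(A_i).$$ If there exist two real eigenvalues of opposite sign in $\sigma(A)$, then $\theta_1(A)=\frac\pi2$. Otherwise, the estimate $$\theta_1(A)\le\max_{\lambda\in\sigma(A)}\min(|\arg(\lambda)|,\pi-|\arg(\lambda)|)$$ holds. Equality holds if the maximum on the right-hand side of this estimate is zero, or if it is achieved for an eigenvalue $\lambda_{i_0}\in\sigma(A_{i_0})$, $i_0\in\{1,\dots,k\}$,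 with $\mathrm{Im}(\lambda_{i_0})\ne0$ and $\mathrm{skew}(A_{i_0})\le1$; i.e. $$\theta_1(A)=\min(|\arg(\lambda_{i_0})|,\pi-|\arg(\lambda_{i_0})|).$$
   Context: $\mathcal R(Q)$ is the range of $Q$; $I_{m}$ is the $m\times m$ identity matrix; $\arg(\lambda)\in(-\pi,\pi]$; $\|\cdot\|$ is the Euclidean (resp. spectral) norm. $\mathcal G(1,d)$ is the set of one-dimensional subspaces of $\mathbb R^d$, and for $V=\mathrm{span}(v)$, $W=\mathrm{span}(w)$, $\measuredangle(V,W)=\arccos\frac{|v^\top w|}{\|v\|\|w\|}\in[0,\frac\pi2]$. For an invertible matrix $A\in\mathbb R^{d,d}$ and $V\in\mathcal G(1,d)$, $n\in\mathbb N$, $k\in\mathbb N_0$ let $a_{k+1,k+n}(V)=\sum_{j=k+1}^{k+n}\measuredangle(A^{j-1}V,A^jV)$. With suprema over $V\in\mathcal G(1,d)$, the first angular values of $A$ are: inner: $\bar\theta_1=\limsup_{n\to\infty}\frac1n\sup_Va_{1,n}(V)$, $\underline\theta_1=\liminf_{n\to\infty}\frac1n\sup_Va_{1,n}(V)$; outer: $\hat\theta_1=\sup_V\limsup_{n\to\infty}\frac1na_{1,n}(V)$, $\check\theta_1=\sup_V\liminf_{n\to\infty}\frac1na_{1,n}(V)$; uniform inner: $\bar\theta_{[1]}=\limsup_{n\to\infty}\frac1n\sup_V\sup_{k\in\mathbb N_0}a_{k+1,k+n}(V)$, $\underline\theta_{[1]}=\liminf_{n\to\infty}\frac1n\sup_V\inf_{k\in\mathbb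 N_0}a_{k+1,k+n}(V)$; uniform outer: $\hat\theta_{[1]}=\sup_V\lim_{n\to\infty}\frac1n\sup_{k\in\mathbb N_0}a_{k+1,k+n}(V)$, $\check\theta_{[1]}=\sup_V\lim_{n\to\infty}\frac1n\inf_{k\in\mathbb N_0}a_{k+1,k+n}(V)$ (the limits exist by Fekete's lemma). The angular values of $A_i$ are defined in the same way with $A_i$, $d_i$ in place of $A$, $d$. The skewness of an invertible matrix $B$ is $\mathrm{skew}(B)=\frac{1}{2r(B)}\|B-B^\top\|$, where $r(B)=\max\{|\lambda|:\lambda\in\sigma(B)\}$.
   Formalization: ''Two real eigenvalues of opposite sign'' is read as of opposite sign and equal modulus, i.e. λ and −λ both in σ(A), and ''Otherwise'' as its negation; as written the claim fails for A = diag(2, −1), where θ₁(A) = 0 by the maximum formula. *)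

(* Defs.v *)
From HB Require Import structures.
From mathcomp Require Import all_boot all_order all_algebra.
From mathcomp Require Import all_classical all_reals all_analysis.
From mathcomp Require Import complex.

Set Implicit Arguments.
Unset Strict Implicit.
Unset Printing Implicit Defensive.

Import Order.TTheory GRing.Theory Num.Theory.
Import numFieldNormedType.Exports.

Local Open Scope classical_set_scope.
Local Open Scope ring_scope.

Section EuclideanGeometry.
Context {R : realType}.

Definition inner m (v w : 'cV[R]_m) : R := (v^T *m w) 0 0.

(* The library norm on matrices is the sup norm, hence a separate definition. *)
Definition enorm m (v : 'cV[R]_m) : R := Num.sqrt (inner v v).

Definition spectral_norm m n (B : 'M[R]_(m, n)) : R :=
  sup [set enorm (B *m x) | x in [set x : 'cV[R]_n | enorm x <= 1]].

Definition mxfun m n (B : 'M[R]_(m, n)) : 'Hom('cV[R]_n, 'cV[R]_m) :=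
  linfun (mulmx B).

Definition mxrange m n (B : 'M[R]_(m, n)) : {vspace 'cV[R]_m} := limg (mxfun B).

Definition G1 m : set {vspace 'cV[R]_m} := [set V | \dim V = 1%N].

(* [vpick V] spans the line [V]; by [angle_line] below any other spanning
   vector gives the same angle. *)
Definition angle m (V W : {vspace 'cV[R]_m}) : R :=
  acos (`|inner (vpick V) (vpick W)| / (enorm (vpick V) * enorm (vpick W))).

Lemma innerZl m a (v w : 'cV[R]_m) : inner (a *: v) w = a * inner v w.
Proof. by rewrite /inner linearZ /= -scalemxAl mxE. Qed.

Lemma innerZr m a (v w : 'cV[R]_m) : inner v (a *: w) = a * inner v w.
Proof. by rewrite /inner -scalemxAr mxE. Qed.

Lemma enormZ m a (v : 'cV[R]_m) : enorm (a *: v) = `|a| * enorm v.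
Proof.
by rewrite /enorm innerZl innerZr mulrA -expr2 sqrtrM ?sqr_ge0// sqrtr_sqr.
Qed.

Lemma vpick_line m (v : 'cV[R]_m) : v != 0 ->
  exists2 a : R, a != 0 & vpick <[v]>%VS = a *: v.
Proof.
move=> v0; have /vlineP[a va] := memv_pick <[v]>%VS.
exists a => //; apply: contraNneq v0 => a0.
have /eqP := va; rewrite a0 scale0r vpick0 => /eqP l0.
by rewrite -memv0 -l0 memv_line.
Qed.

Lemma angle_line m (v w : 'cV[R]_m) : v != 0 -> w != 0 ->
  angle <[v]> <[w]> = acos (`|inner v w| / (enorm v * enorm w)).
Proof.
move=> v0 w0; rewrite /angle.
have [a a0 ->] := vpick_line v0; have [b b0 ->] := vpick_line w0.
rewrite innerZl innerZr !enormZ mulrA normrM mulrACA normrM.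
by rewrite -mulf_div divff ?mul1r// mulf_neq0 ?normr_eq0.
Qed.

Lemma mxfun_line m n (B : 'M[R]_(m, n)) (v : 'cV[R]_n) :
  (mxfun B @: <[v]> = <[B *m v]>)%VS.
Proof. by rewrite limg_line lfunE. Qed.

End EuclideanGeometry.

Section Spectrum.
Context {R : realType}.

Definition toC n (A : 'M[R]_n) : 'M[R[i]]_n := map_mx (real_complex R) A.

Definition spectrum n (A : 'M[R]_n) : set R[i] :=
  [set l | eigenvalue (toC A) l].

Definition simple_eigenvalue n (A : 'M[R]_n) (l : R[i]) : Prop :=
  mup l (char_poly (toC A)) = 1%N.

Definition cmod (z : R[i]) : R := ComplexField.Normc.normc z.

(* Principal argument in ]-pi, pi] of a nonzero complex number. *)
Definition carg (z : R[i]) : R :=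
  let t := acos (complex.Re z / cmod z) in
  if 0 <= complex.Im z then t else - t.

(* The spectrum is finite, so for n > 0 the two suprema below are maxima. *)
Definition spectral_radius n (A : 'M[R]_n) : R :=
  sup [set cmod l | l in spectrum A].

Definition skewness n (B : 'M[R]_n) : R :=
  (2 * spectral_radius B)^-1 * spectral_norm (B - B^T).

Definition line_arg (l : R[i]) : R := Num.min `|carg l| (pi - `|carg l|).

Definition max_line_arg n (A : 'M[R]_n) : R :=
  sup [set line_arg l | l in spectrum A].

Definition nonreal_simple_isolated n (A : 'M[R]_n) : Prop :=
  forall l, spectrum A l -> complex.Im l != 0 ->
    simple_eigenvalue A l /\
    forall e, spectrum A e -> e <> l -> e <> conjc l -> cmod e <> cmod l.

(* Equality of the moduli is essential: diag(2, -1) has the eigenvalues 2 and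
   -1, but its angular value is 0, the maximum over its two 1 x 1 blocks. *)
Definition opposite_real_eigenvalues n (A : 'M[R]_n) : Prop :=
  exists x y : R, [/\ x < 0 < y, `|x| = `|y|,
    spectrum A (real_complex R x) & spectrum A (real_complex R y)].

End Spectrum.

Section AngularValues.
Context {R : realType}.

Section FixedMatrix.
Variables (m : nat) (A : 'M[R]_m).

(* [asum k n V] is the sum of the angles with indices k+1, ..., k+n. *)
Definition asum (k n : nat) (V : {vspace 'cV[R]_m}) : R :=
  \sum_(k.+1 <= j < (k + n).+1)
     angle (mxfun (A ^+ j.-1) @: V)%VS (mxfun (A ^+ j) @: V)%VS.

Definition supV (f : {vspace 'cV[R]_m} -> R) : R := sup [set f V | V in @G1 R m].

Definition supk (n : nat) (V : {vspace 'cV[R]_m}) : R :=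
  sup [set asum k n V | k in [set: nat]].

Definition infk (n : nat) (V : {vspace 'cV[R]_m}) : R :=
  inf [set asum k n V | k in [set: nat]].

Definition inner_sup : R := limn_sup (fun n => n%:R^-1 * supV (asum 0 n)).
Definition inner_inf : R := limn_inf (fun n => n%:R^-1 * supV (asum 0 n)).

Definition outer_sup : R :=
  supV (fun V => limn_sup (fun n => n%:R^-1 * asum 0 n V)).
Definition outer_inf : R :=
  supV (fun V => limn_inf (fun n => n%:R^-1 * asum 0 n V)).

Definition uinner_sup : R := limn_sup (fun n => n%:R^-1 * supV (supk n)).
Definition uinner_inf : R := limn_inf (fun n => n%:R^-1 * supV (infk n)).

Definition uouter_sup : R :=
  supV (fun V => limn (fun n => n%:R^-1 * supk n V)).
Definition uouter_inf : R :=
  supV (fun V => limn (fun n => n%:R^-1 * infk n V)).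

End FixedMatrix.

(* All eight first angular values of [A] coincide, with common value [t]. *)
Definition is_first_angular_value m (A : 'M[R]_m) (t : R) : Prop :=
  [/\ uouter_inf A = t, outer_inf A = t, outer_sup A = t & uouter_sup A = t] /\
  [/\ uinner_inf A = t, inner_inf A = t, inner_sup A = t & uinner_sup A = t].

Definition modulus_decomposition m (A : 'M[R]_m) k (dim : 'I_k -> nat)
    (Q : forall i, 'M[R]_(m, dim i)) (B : forall i, 'M[R]_(dim i)) : Prop :=
  [/\ forall i, (0 < dim i)%N /\ (Q i)^T *m Q i = 1%:M,
      directv (\sum_i mxrange (Q i)),
      (\sum_i mxrange (Q i))%VS = fullv,
      forall i, A *m Q i = Q i *m B i &
      exists2 r : 'I_k -> R, injective r &
        forall i l, spectrum (B i) l -> cmod l = r i].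

End AngularValues.

(* Main.v *)
Require Import Defs.
From HB Require Import structures.
From mathcomp Require Import all_boot all_order all_algebra.
From mathcomp Require Import all_classical all_reals all_analysis.
From mathcomp Require Import complex.
From mathcomp Require Import ring lra.

Set Implicit Arguments.
Unset Strict Implicit.
Unset Printing Implicit Defensive.

Import Order.TTheory GRing.Theory Num.Theory.
Import numFieldNormedType.Exports.
Local Open Scope classical_set_scope.
Local Open Scope ring_scope.

(** The proof determines one number, the largest asymptotic slope of the angle
    sums [orbit_sum], and shows that all eight angular values are equal to it.

    Suppose that every angle sum over [n] steps is at most [n (t + e) + K], and
    that some vector [w] has all its angle sums, from any starting index, at least
    [n (t - e) - K], for every [e > 0] and a constant [K] depending on [e]. Then
    all eight angular values are [t], whatever the order of suprema and limits
    ([angval_first]; the uniform outer limits exist by Fekete's lemma). Let [t] be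
    the infimum of the slopes valid in the upper bound. The vector [w] is found
    among those killed by [prod (A - z)] over the eigenvalues [z] of one modulus
    ([slope_lower]), for any invertible [A], in two steps.

    First, apart from a number of iterates bounded independently of [v], the
    orbit of [v] is close to the sum of the eigenspaces of one modulus
    ([rare_far]). On a generalized eigenspace, [A^j v] is [l^j] times a
    polynomial in [j], and a polynomial of bounded degree varies fast only near its
    roots, so the component is almost an eigenvector except for boundedly many
    [j]; components of different moduli then have a ratio that grows
    geometrically, and are comparable for boundedly many [j] only. Were all angle
    sums of some length [N] on these sums of eigenspaces below [N (t - e)], then by
    uniform continuity all orbits would have a slope below [t]
    ([slope_attained]). Second, on the sum of the eigenspaces of modulus [r] the
    powers of [A / r] return close to the identity after bounded gaps
    ([almost_periods]), so that one large angle sum recurs along the whole orbit.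

    A vector of one modulus lies in a single block of a modulus decomposition
    ([decomposition_block]), and the [Q i] preserve angles; hence the value of [A]
    is the maximum of those of the blocks. Eigenvectors of equal norm for [x] and
    [- x] have a sum which [A] turns by a right angle at each step. Without
    opposite real eigenvalues, the vectors of one modulus are real eigenvectors,
    with angle [0], or belong to the plane of a conjugate pair. There the iterates
    of a vector turn by [phi] plus the increment of a bounded function
    ([plane_step]), so the oriented angles average to [phi], and the angles of
    lines to at most [min phi (pi - phi)]. Skewness at most one means that the
    oriented angle stays on the same side of a right angle as [phi], and then
    equality holds ([skew_orbit_sum]). *)

(** * Averages of real sequences *)

Section Sequences.
Context {R : realType}.
Implicit Types (u v : nat -> R) (c p t : R).

Lemma bounded_fun_le u p : (forall n, `|u n| <= p) -> bounded_fun u.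
Proof.
move=> up; exists p; split; first exact: num_real.
by move=> x px n _; exact: le_trans (up n) (ltW px).
Qed.

Lemma limn_sup_le u p c : (forall n, `|u n| <= p) ->
  (forall e, 0 < e -> exists N, forall n, (N <= n)%N -> u n <= c + e) ->
  limn_sup u <= c.
Proof.
move=> up h; have bu := bounded_fun_le up.
rewrite (limn_supE bu); apply/ler_addgt0Pr => e e0.
have [N hN] := h e e0.
apply: (@le_trans _ _ (sups u N)); last first.
  by apply: ge_sup; [exists (u N); exists N => /= | move=> _ [n /= Nn <-]; exact: hN].
apply: ge_inf; first exact: bounded_fun_has_lbound_sups.
by exists N.
Qed.

Lemma limn_inf_ge u p c : (forall n, `|u n| <= p) ->
  (forall e, 0 < e -> exists N, forall n, (N <= n)%N -> c - e <= u n) ->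
  c <= limn_inf u.
Proof.
move=> up h; have bu := bounded_fun_le up.
rewrite (limn_infE bu); apply/ler_addgt0Pr => e e0.
have [N hN] := h e e0; rewrite -lerBlDr.
apply: (@le_trans _ _ (infs u N)).
  by apply: lb_le_inf; [exists (u N); exists N => /= | move=> _ [n /= Nn <-]; exact: hN].
apply: ub_le_sup; first exact: bounded_fun_has_ubound_infs.
by exists N.
Qed.

Lemma limn_inf_le_sup u p : (forall n, `|u n| <= p) -> limn_inf u <= limn_sup u.
Proof.
move=> up; have bu := bounded_fun_le up.
rewrite (limn_infE bu) (limn_supE bu).
have ubu := bounded_fun_has_ubound bu; have lbu := bounded_fun_has_lbound bu.
apply: ge_sup; first by exists (infs u 0); exists 0.
move=> _ [n _ <-]; apply: lb_le_inf; first by exists (sups u 0); exists 0.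
move=> _ [m _ <-]; apply: (@le_trans _ _ (u (maxn m n))).
  by apply: ge_inf; [exact: has_lbound_sdrop|exists (maxn m n); rewrite /= ?leq_maxr].
by apply: ub_le_sup; [exact: has_ubound_sdrop|exists (maxn m n); rewrite /= ?leq_maxl].
Qed.

Lemma natmul_large (C e : R) : 0 < e ->
  exists N, forall n, (N <= n)%N -> C <= n%:R * e.
Proof.
move=> e0; exists (Num.bound `|C / e|) => n hn.
rewrite -ler_pdivrMr //.
apply: le_trans (ler_norm _) _; apply: ltW.
apply: lt_le_trans (archi_boundP _) _ => //.
by rewrite ler_nat.
Qed.

(** A linear bound [u n <= n c + C] bounds the averages asymptotically. *)
Lemma mean_le u c :
  (forall e, 0 < e -> exists C, forall n, u n <= n%:R * (c + e) + C) ->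
  forall e, 0 < e -> exists N, forall n, (N <= n)%N -> n%:R^-1 * u n <= c + e.
Proof.
move=> h e e0; have e20 : 0 < e / 2 by rewrite divr_gt0.
have [C hC] := h _ e20; have [N hN] := natmul_large C e20.
exists (maxn N 1) => n; rewrite geq_max => /andP[Nn n1].
have n0 : 0 < n%:R :> R by rewrite ltr0n.
rewrite mulrC ler_pdivrMr //.
have := hC n; have := hN n Nn; lra.
Qed.

Lemma mean_ge u c :
  (forall e, 0 < e -> exists C, forall n, n%:R * (c - e) - C <= u n) ->
  forall e, 0 < e -> exists N, forall n, (N <= n)%N -> c - e <= n%:R^-1 * u n.
Proof.
move=> h e e0; have e20 : 0 < e / 2 by rewrite divr_gt0.
have [C hC] := h _ e20; have [N hN] := natmul_large C e20.
exists (maxn N 1) => n; rewrite geq_max => /andP[Nn n1].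
have n0 : 0 < n%:R :> R by rewrite ltr0n.
rewrite mulrC ler_pdivlMr //.
have := hC n; have := hN n Nn; lra.
Qed.

(** At [n = 0] the average is [0] because [0^-1 = 0]. *)
Lemma mean_bound u p n : 0 <= p -> 0 <= u n <= n%:R * p ->
  `|n%:R^-1 * u n| <= p.
Proof.
move=> p0 /andP[u0 up]; rewrite ger0_norm; last by rewrite mulr_ge0 ?invr_ge0.
case: n u0 up => [|n] u0 up; first by rewrite invr0 mul0r.
by rewrite mulrC ler_pdivrMr ?ltr0n // mulrC.
Qed.

Lemma cvg_eventually u c :
  (forall e, 0 < e -> exists N, forall n, (N <= n)%N -> u n <= c + e) ->
  (forall e, 0 < e -> exists N, forall n, (N <= n)%N -> c - e <= u n) ->
  u @ \oo --> c.
Proof.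
move=> h1 h2; apply/cvgrPdist_le => e e0.
have [N1 hN1] := h1 e e0; have [N2 hN2] := h2 e e0.
exists (maxn N1 N2) => // n /=; rewrite geq_max => /andP[/hN1 a /hN2 b].
by rewrite ler_distlC; apply/andP.
Qed.

(** Fekete's lemma, for a subadditive sequence with at most linear growth. *)
Lemma fekete_sub u p : 0 <= p ->
  (forall n, 0 <= u n <= n%:R * p) ->
  (forall m n, u (m + n)%N <= u m + u n) ->
  cvgn (fun n => n%:R^-1 * u n).
Proof.
move=> p0 ub usub.
pose E := [set n%:R^-1 * u n | n in [set n | (0 < n)%N]].
have lbE : has_lbound E.
  exists 0 => _ [n _ <-]; rewrite mulr_ge0 ?invr_ge0 //.
  by case/andP: (ub n).
have neE : E !=set0 by exists (1%:R^-1 * u 1%N); exists 1%N.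
apply/cvg_ex; exists (inf E); apply: cvg_eventually.
  apply: mean_le => e e0.
  have [_ [m /= m0 <-] hm] := inf_adherent e0 (conj neE lbE).
  (* divide [n] by [m]: the remainder costs at most [m p] *)
  exists (m%:R * p) => n.
  have key q r : u (q * m + r)%N <= q%:R * u m + u r.
    elim: q => [|q IH]; first by rewrite mul0n add0n mul0r add0r.
    rewrite mulSn -addnA -natr1; apply: le_trans (usub _ _) _.
    rewrite mulrDl mul1r; lra.
  have mr0 : 0 < m%:R :> R by rewrite ltr0n.
  have hm' : u m <= m%:R * (inf E + e).
    by move: hm => /ltW; rewrite mulrC ler_pdivrMr // mulrC.
  rewrite {1}(divn_eq n m); apply: le_trans (key _ _) _.
  have rm : u (n %% m)%N <= m%:R * p.
    have /andP[_ hu] := ub (n %% m)%N; apply: le_trans hu _.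
    by rewrite ler_wpM2r // ler_nat ltnW // ltn_pmod.
  have iE0 : 0 <= inf E.
    apply: lb_le_inf => // _ [k _ <-]; rewrite mulr_ge0 ?invr_ge0 //.
    by case/andP: (ub k).
  apply: lerD => //.
  apply: le_trans (ler_wpM2l (ler0n _ _) hm') _.
  rewrite mulrA -natrM; apply: ler_wpM2r; first by rewrite addr_ge0 // ltW.
  by rewrite ler_nat leq_divM.
move=> e e0; exists 1%N => n n1.
have : inf E <= n%:R^-1 * u n by apply: ge_inf => //; exists n.
lra.
Qed.

(** The superadditive case follows by passing to [n p - u n]. *)
Lemma fekete_super u p : 0 <= p ->
  (forall n, 0 <= u n <= n%:R * p) ->
  (forall m n, u m + u n <= u (m + n)%N) ->
  cvgn (fun n => n%:R^-1 * u n).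
Proof.
move=> p0 ub usup; pose v n := n%:R * p - u n.
have /cvg_ex[l hl] : cvgn (fun n => n%:R^-1 * v n).
  apply: (@fekete_sub v p) => //.
    by move=> n; have := ub n; rewrite /v => /andP[? ?]; apply/andP; split; lra.
  move=> m n; rewrite /v natrD; have := usup m n; lra.
apply/cvg_ex; exists (p - l).
have -> : (fun n => n%:R^-1 * u n) = (fun n => n%:R^-1 * n%:R * p - n%:R^-1 * v n).
  by apply/funext => n; rewrite /v; ring.
apply: cvgB hl; apply: cvg_near_cst; exists 1%N => // n /= n1.
by rewrite mulVf ?mul1r // pnatr_eq0 -lt0n.
Qed.

End Sequences.

(** * Euclidean geometry and angle sums *)

Section Euclid.
Context {R : realType}.
Implicit Types (m : nat).

Lemma innerE m (v w : 'cV[R]_m) : inner v w = \sum_i v i 0 * w i 0.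
Proof. by rewrite /inner mxE; apply: eq_bigr => i _; rewrite mxE. Qed.

Lemma innerC m (v w : 'cV[R]_m) : inner v w = inner w v.
Proof. by rewrite !innerE; apply: eq_bigr => i _; rewrite mulrC. Qed.

Lemma innerDl m (u v w : 'cV[R]_m) : inner (u + v) w = inner u w + inner v w.
Proof. by rewrite /inner linearD /= mulmxDl mxE. Qed.

Lemma innerDr m (u v w : 'cV[R]_m) : inner w (u + v) = inner w u + inner w v.
Proof. by rewrite innerC innerDl !(innerC w). Qed.

Lemma innerNl m (v w : 'cV[R]_m) : inner (- v) w = - inner v w.
Proof. by rewrite -scaleN1r innerZl mulN1r. Qed.

Lemma innerNr m (v w : 'cV[R]_m) : inner v (- w) = - inner v w.
Proof. by rewrite -scaleN1r innerZr mulN1r. Qed.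

Lemma innerBl m (u v w : 'cV[R]_m) : inner (u - v) w = inner u w - inner v w.
Proof. by rewrite innerDl innerNl. Qed.

Lemma innerBr m (u v w : 'cV[R]_m) : inner w (u - v) = inner w u - inner w v.
Proof. by rewrite innerDr innerNr. Qed.

Lemma inner_ge0 m (v : 'cV[R]_m) : 0 <= inner v v.
Proof. by rewrite innerE sumr_ge0 // => i _; rewrite -expr2 sqr_ge0. Qed.

Lemma inner_eq0 m (v : 'cV[R]_m) : (inner v v == 0) = (v == 0).
Proof.
apply/eqP/eqP => [|->]; last by rewrite innerE big1 // => i _; rewrite mxE mul0r.
rewrite innerE => /psumr_eq0P h; apply/matrixP => i j; rewrite ord1 mxE.
have : v i 0 * v i 0 = 0 by apply: h => // k _; rewrite -expr2 sqr_ge0.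
by move/eqP; rewrite mulf_eq0 orbb => /eqP.
Qed.

Lemma inner_gt0 m (v : 'cV[R]_m) : (0 < inner v v) = (v != 0).
Proof. by rewrite lt_neqAle inner_ge0 andbT eq_sym inner_eq0. Qed.

Lemma enorm_ge0 m (v : 'cV[R]_m) : 0 <= enorm v.
Proof. exact: sqrtr_ge0. Qed.

Lemma enorm_gt0 m (v : 'cV[R]_m) : (0 < enorm v) = (v != 0).
Proof. by rewrite sqrtr_gt0 inner_gt0. Qed.

Lemma enorm_sqr m (v : 'cV[R]_m) : enorm v ^+ 2 = inner v v.
Proof. by rewrite sqr_sqrtr // inner_ge0. Qed.

Lemma cauchy_schwarz_sqr m (v w : 'cV[R]_m) :
  inner v w ^+ 2 <= inner v v * inner w w.
Proof.
have [->|w0] := eqVneq w 0.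
  by rewrite -(scale0r w) !innerZr !mul0r mulr0 expr0n.
have w1 : 0 < inner w w by rewrite inner_gt0.
have := inner_ge0 (inner w w *: v - inner v w *: w).
rewrite innerBl !innerBr !innerZl !innerZr (innerC w v).
set a := inner v v; set b := inner v w; set c := inner w w => h.
have : 0 <= c * (a * c - b ^+ 2).
  by apply: le_trans h _; rewrite le_eqVlt; apply/orP; left; apply/eqP; ring.
by rewrite pmulr_rge0 // subr_ge0.
Qed.

Lemma cauchy_schwarz m (v w : 'cV[R]_m) : `|inner v w| <= enorm v * enorm w.
Proof.
rewrite -(@ler_pXn2r _ 2) ?nnegrE ?mulr_ge0 ?enorm_ge0 //.
by rewrite real_normK ?num_real // exprMn !enorm_sqr cauchy_schwarz_sqr.
Qed.

Lemma enormD m (v w : 'cV[R]_m) : enorm (v + w) <= enorm v + enorm w.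
Proof.
rewrite -(@ler_pXn2r _ 2) ?nnegrE ?addr_ge0 ?enorm_ge0 //.
rewrite enorm_sqr innerDl !innerDr sqrrD !enorm_sqr (innerC w v).
have := ler_norm (inner v w); have := cauchy_schwarz v w; lra.
Qed.

Lemma enormN m (v : 'cV[R]_m) : enorm (- v) = enorm v.
Proof. by rewrite -scaleN1r enormZ normrN1 mul1r. Qed.

(** The angle between the lines spanned by two nonzero vectors; for a zero
    vector the quotient is [0] and the value [pi / 2]. *)
Definition vangle m (v w : 'cV[R]_m) : R :=
  acos (`|inner v w| / (enorm v * enorm w)).

Lemma cos_line_itv m (v w : 'cV[R]_m) :
  0 <= `|inner v w| / (enorm v * enorm w) <= 1.
Proof.
rewrite divr_ge0 ?mulr_ge0 ?enorm_ge0 //=.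
have := mulr_ge0 (enorm_ge0 v) (enorm_ge0 w); rewrite le_eqVlt => /orP[/eqP<-|h].
  by rewrite invr0 mulr0.
by rewrite ler_pdivrMr // mul1r cauchy_schwarz.
Qed.

Lemma acos_itv (x : R) : 0 <= x <= 1 -> 0 <= acos x <= pi / 2.
Proof.
move=> /andP[x0 x1]; have hx : -1 <= x <= 1 by apply/andP; split; lra.
rewrite acos_ge0 //= leNgt; apply/negP => h.
have : cos (acos x) < cos (pi / 2).
  by rewrite ltr_cos ?in_itv /= ?acos_ge0 ?acos_lepi //; have := pi_gt0 R; lra.
by rewrite cos_pihalf acosK ?in_itv //= ltNge x0.
Qed.

Lemma vangle_itv m (v w : 'cV[R]_m) : 0 <= vangle v w <= pi / 2.
Proof. exact/acos_itv/cos_line_itv. Qed.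

Lemma vangleZ m a b (v w : 'cV[R]_m) : a != 0 -> b != 0 ->
  vangle (a *: v) (b *: w) = vangle v w.
Proof.
move=> a0 b0; rewrite /vangle innerZl innerZr !enormZ mulrA normrM mulrACA normrM.
by rewrite -mulf_div divff ?mul1r// mulf_neq0 ?normr_eq0.
Qed.

Lemma angle_itv m (V W : {vspace 'cV[R]_m}) : 0 <= angle V W <= pi / 2.
Proof. exact: vangle_itv. Qed.

Lemma G1_line m (V : {vspace 'cV[R]_m}) : G1 V ->
  exists2 v, v != 0 & V = <[v]>%VS.
Proof.
move=> dV; have V0 : V != 0%VS by rewrite -dimv_eq0 dV.
exists (vpick V); first by rewrite vpick0.
apply/esym/eqP; rewrite eqEdim -memvE memv_pick dim_vline vpick0 V0 /=.
by move: dV; rewrite /G1 /= => ->.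
Qed.

Lemma line_G1 m (v : 'cV[R]_m) : v != 0 -> G1 <[v]>%VS.
Proof. by move=> v0; rewrite /G1 /= dim_vline v0. Qed.

Lemma unit_mulmx_neq0 (K : comUnitRingType) m (A : 'M[K]_m) (v : 'cV[K]_m) : A \in unitmx ->
  v != 0 -> A *m v != 0.
Proof.
move=> Au; apply: contraNneq => h.
by rewrite -(mul1mx v) -(mulVmx Au) -mulmxA h mulmx0.
Qed.

Lemma unitmx_exp (K : comUnitRingType) m (A : 'M[K]_m) j : A \in unitmx -> A ^+ j \in unitmx.
Proof.
move=> Au; elim: j => [|j IH]; first by rewrite expr0 unitmx1.
by rewrite exprS unitmx_mul Au.
Qed.

Lemma expmxSl (K : pzRingType) m (A : 'M[K]_m) j (v : 'cV[K]_m) :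
  A ^+ j.+1 *m v = A *m (A ^+ j *m v).
Proof. by rewrite exprS mulmxA. Qed.

Lemma expmxD (K : pzRingType) m (A : 'M[K]_m) i j (v : 'cV[K]_m) :
  A ^+ (i + j) *m v = A ^+ i *m (A ^+ j *m v).
Proof. by rewrite exprD mulmxA. Qed.

(** The sum of the first [n] angles along the orbit of [v]. *)
Definition orbit_sum m (A : 'M[R]_m) n (v : 'cV[R]_m) : R :=
  \sum_(j < n) vangle (A ^+ j *m v) (A ^+ j.+1 *m v).

Lemma orbit_sumD m (A : 'M[R]_m) i j (v : 'cV[R]_m) :
  orbit_sum A (i + j) v = orbit_sum A i v + orbit_sum A j (A ^+ i *m v).
Proof.
rewrite /orbit_sum big_split_ord /=; congr (_ + _).
by apply: eq_bigr => k _; rewrite -!expmxD addSn [(k + i)%N]addnC.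
Qed.

Lemma orbit_sum_itv m (A : 'M[R]_m) n (v : 'cV[R]_m) :
  0 <= orbit_sum A n v <= n%:R * (pi / 2).
Proof.
apply/andP; split.
  by apply: sumr_ge0 => j _; case/andP: (vangle_itv (A ^+ j *m v) (A ^+ j.+1 *m v)).
rewrite mulr_natl -[X in _ *+ X]card_ord -sumr_const; apply: ler_sum => j _.
by case/andP: (vangle_itv (A ^+ j *m v) (A ^+ j.+1 *m v)).
Qed.

Lemma asum_line m (A : 'M[R]_m) k n (v : 'cV[R]_m) : A \in unitmx -> v != 0 ->
  asum A k n <[v]>%VS = orbit_sum A n (A ^+ k *m v).
Proof.
move=> Au v0; rewrite /asum big_add1 /= -{1}[k]add0n big_addn addKn big_mkord.
rewrite /orbit_sum; apply: eq_bigr => j _.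
rewrite !mxfun_line angle_line ?unit_mulmx_neq0 ?unitmx_exp //.
by rewrite -!expmxD addSn.
Qed.

Lemma asumD m (A : 'M[R]_m) k i j V :
  asum A k (i + j) V = asum A k i V + asum A (k + i) j V.
Proof.
by rewrite /asum (@big_cat_nat _ _ _ (k + i).+1) ?ltnS ?leq_addr ?addnA ?leq_addr //=.
Qed.

Lemma asum_itv m (A : 'M[R]_m) k n V : 0 <= asum A k n V <= n%:R * (pi / 2).
Proof.
rewrite /asum; apply/andP; split.
  by apply: sumr_ge0 => j _; case/andP: (angle_itv (mxfun (A ^+ j.-1) @: V) (mxfun (A ^+ j) @: V)).
apply: (@le_trans _ _ (\sum_(k.+1 <= j < (k + n).+1) pi / 2)).
  by apply: ler_sum => j _; case/andP: (angle_itv (mxfun (A ^+ j.-1) @: V) (mxfun (A ^+ j) @: V)).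
by rewrite big_const_nat iter_addr_0 mulr_natl subSS addKn.
Qed.

End Euclid.

(** * The eight angular values *)

Section EightValues.
Context {R : realType}.
Variables (m : nat) (A : 'M[R]_m).
Implicit Types (V : {vspace 'cV[R]_m}) (t e : R) (k n : nat).

(** [t] is the asymptotic slope of the angle sums: up to [e] per step and a
    constant, no segment of an orbit exceeds it, and some orbit attains it on all
    of its segments, uniformly in the starting index. *)
Definition angval t : Prop :=
  (forall e, 0 < e -> exists C, forall V, G1 V -> forall k n,
     asum A k n V <= n%:R * (t + e) + C) /\
  (forall e, 0 < e -> exists C V, G1 V /\ forall k n,
     n%:R * (t - e) - C <= asum A k n V).

Let p : R := pi / 2.
Let p_ge0 : 0 <= p. Proof. by rewrite divr_ge0 // pi_ge0. Qed.

Lemma asum_has_ubound n V : has_ubound [set asum A k n V | k in [set: nat]].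
Proof. by exists (n%:R * p) => _ [k _ <-]; case/andP: (asum_itv A k n V). Qed.

Lemma asum_has_lbound n V : has_lbound [set asum A k n V | k in [set: nat]].
Proof. by exists 0 => _ [k _ <-]; case/andP: (asum_itv A k n V). Qed.

Lemma asum_le_supk k n V : asum A k n V <= supk A n V.
Proof. by apply: ub_le_sup; [exact: asum_has_ubound | exists k]. Qed.

Lemma infk_le_asum k n V : infk A n V <= asum A k n V.
Proof. by apply: ge_inf; [exact: asum_has_lbound | exists k]. Qed.

Lemma supk_le n V c : (forall k, asum A k n V <= c) -> supk A n V <= c.
Proof.
by move=> h; apply: ge_sup => [|_ [k _ <-] //]; exists (asum A 0 n V); exists 0%N.
Qed.

Lemma le_infk n V c : (forall k, c <= asum A k n V) -> c <= infk A n V.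
Proof.
by move=> h; apply: lb_le_inf => [|_ [k _ <-] //]; exists (asum A 0 n V); exists 0%N.
Qed.

Lemma supk_itv n V : 0 <= supk A n V <= n%:R * p.
Proof.
rewrite supk_le ?andbT => [|k]; last by case/andP: (asum_itv A k n V).
by apply: le_trans (asum_le_supk 0 n V); case/andP: (asum_itv A 0 n V).
Qed.

Lemma infk_itv n V : 0 <= infk A n V <= n%:R * p.
Proof.
rewrite le_infk => [|k]; last by case/andP: (asum_itv A k n V).
by apply: le_trans (infk_le_asum 0 n V) _; case/andP: (asum_itv A 0 n V).
Qed.

Lemma is_cvg_supk V : cvgn (fun n => n%:R^-1 * supk A n V).
Proof.
apply: (@fekete_sub _ _ p) => // [n|i j]; first exact: supk_itv.
by apply: supk_le => k; rewrite asumD lerD ?asum_le_supk.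
Qed.

Lemma is_cvg_infk V : cvgn (fun n => n%:R^-1 * infk A n V).
Proof.
apply: (@fekete_super _ _ p) => // [n|i j]; first exact: infk_itv.
by apply: le_infk => k; rewrite asumD lerD ?infk_le_asum.
Qed.

Lemma supV_eq f t : (forall V, G1 V -> f V <= t) ->
  (forall e, 0 < e -> exists2 V, G1 V & t - e <= f V) -> supV f = t.
Proof.
move=> h1 h2; have [V0 gV0 _] := h2 1 ltr01.
have hub : has_ubound [set f V | V in @G1 R m].
  by exists t => _ [V gV <-]; exact: h1.
apply/eqP; rewrite eq_le; apply/andP; split.
  by apply: ge_sup => [|_ [V gV <-]]; [exists (f V0); exists V0 | exact: h1].
apply/ler_addgt0Pr => e e0; have [V gV hV] := h2 e e0.
rewrite -lerBlDr; apply: le_trans hV _.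
by apply: ub_le_sup => //; exists V.
Qed.

(** The two bounds of [angval], for a family [g] that may stand for the angle
    sums or for their supremum or infimum over the starting index. *)
Section Pointwise.
Variables (g : nat -> {vspace 'cV[R]_m} -> R) (t : R).
Hypothesis g_itv : forall n V, 0 <= g n V <= n%:R * p.
Hypothesis g_le : forall e, 0 < e -> exists C, forall V, G1 V -> forall n,
  g n V <= n%:R * (t + e) + C.
Hypothesis g_ge : forall e, 0 < e -> exists C V, G1 V /\ forall n,
  n%:R * (t - e) - C <= g n V.

Let gb V n : `|n%:R^-1 * g n V| <= p.
Proof. exact: (@mean_bound _ (g^~ V) p n). Qed.

Let gsup V : G1 V -> limn_sup (fun n => n%:R^-1 * g n V) <= t.
Proof.
move=> gV; apply: (limn_sup_le (gb V)); apply: mean_le => e e0.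
by have [C hC] := g_le e0; exists C => n; exact: hC.
Qed.

Let ginf e : 0 < e ->
  exists2 V, G1 V & t - e <= limn_inf (fun n => n%:R^-1 * g n V).
Proof.
move=> e0; have [C [V [gV hV]]] := g_ge e0; exists V => //.
apply: (limn_inf_ge (gb V)); apply: mean_ge => e' e'0; exists C => n.
apply: le_trans (hV n); rewrite lerD2r ler_wpM2l //; lra.
Qed.

Lemma outer_limits :
  supV (fun V => limn_sup (fun n => n%:R^-1 * g n V)) = t /\
  supV (fun V => limn_inf (fun n => n%:R^-1 * g n V)) = t.
Proof.
split; apply: supV_eq.
- exact: gsup.
- move=> e e0; have [V gV h] := ginf e0; exists V => //.
  exact: le_trans h (limn_inf_le_sup (gb V)).
- by move=> V gV; exact: le_trans (limn_inf_le_sup (gb V)) (gsup gV).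
- exact: ginf.
Qed.

Lemma inner_limits :
  limn_inf (fun n => n%:R^-1 * supV (g n)) = t /\
  limn_sup (fun n => n%:R^-1 * supV (g n)) = t.
Proof.
have [C0 [V0 [gV0 _]]] := g_ge ltr01.
have hub n : has_ubound [set g n V | V in @G1 R m].
  by exists (n%:R * p) => _ [V _ <-]; case/andP: (g_itv n V).
suff /cvg_limn_inf_sup[-> ->] :
  (fun n => n%:R^-1 * supV (g n)) @ \oo --> t by [].
apply: cvg_eventually.
  apply: mean_le => e e0; have [C hC] := g_le e0; exists C => n.
  by apply: ge_sup => [|_ [V gV <-]]; [exists (g n V0); exists V0 | exact: hC].
apply: mean_ge => e e0; have [C [V [gV hV]]] := g_ge e0; exists C => n.
by apply: le_trans (hV n) _; apply: ub_le_sup => //; exists V.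
Qed.

End Pointwise.

(** The eight angular values only differ in the order of suprema and limits,
    which the uniform bounds of [angval] make irrelevant. *)
Lemma angval_first t : angval t -> is_first_angular_value A t.
Proof.
move=> [h1 h2].
have [os oi] : outer_sup A = t /\ outer_inf A = t.
  apply: outer_limits => [n V|e /h1[C hC]|e /h2[C [V [gV hV]]]].
  - exact: asum_itv.
  - by exists C => V gV n; exact: hC.
  - by exists C, V; split=> // n; exact: hV.
have [ii is_] : inner_inf A = t /\ inner_sup A = t.
  apply: inner_limits => [n V|e /h1[C hC]|e /h2[C [V [gV hV]]]].
  - exact: asum_itv.
  - by exists C => V gV n; exact: hC.
  - by exists C, V; split=> // n; exact: hV.
have supk_up e : 0 < e -> exists C, forall V, G1 V -> forall n,
    supk A n V <= n%:R * (t + e) + C.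
  by move=> /h1[C hC]; exists C => V gV n; apply: supk_le => k; exact: hC.
have supk_low e : 0 < e -> exists C V, G1 V /\ forall n,
    n%:R * (t - e) - C <= supk A n V.
  move=> /h2[C [V [gV hV]]]; exists C, V; split=> // n.
  exact: le_trans (hV 0%N n) (asum_le_supk 0 n V).
have infk_up e : 0 < e -> exists C, forall V, G1 V -> forall n,
    infk A n V <= n%:R * (t + e) + C.
  move=> /h1[C hC]; exists C => V gV n.
  exact: le_trans (infk_le_asum 0 n V) (hC V gV 0%N n).
have infk_low e : 0 < e -> exists C V, G1 V /\ forall n,
    n%:R * (t - e) - C <= infk A n V.
  by move=> /h2[C [V [gV hV]]]; exists C, V; split=> // n; apply: le_infk => k; exact: hV.
have [_ uis] := inner_limits supk_itv supk_up supk_low.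
have [uii _] := inner_limits infk_itv infk_up infk_low.
have [uos _] := outer_limits supk_itv supk_up supk_low.
have [_ uoi] := outer_limits infk_itv infk_up infk_low.
have uosE : uouter_sup A = t.
  rewrite -uos /uouter_sup; congr supV; apply/funext => V.
  by rewrite (cvg_limn_supE (@is_cvg_supk V)).
have uoiE : uouter_inf A = t.
  rewrite -uoi /uouter_inf; congr supV; apply/funext => V.
  by rewrite (cvg_limn_infE (@is_cvg_infk V)).
by split; split.
Qed.

End EightValues.

(** * Complex norms and the spectral resolution *)

Section ComplexNorm.
Context {R : realType}.
Local Notation C := R[i].
Implicit Types (z w : C).

Lemma cmodD z w : cmod (z + w) <= cmod z + cmod w.
Proof. exact: le_normcD. Qed.

Lemma cmodM z w : cmod (z * w) = cmod z * cmod w.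
Proof. exact: ComplexField.Normc.normcM. Qed.

Lemma cmodN z : cmod (- z) = cmod z.
Proof. exact: normcN. Qed.

Lemma cmod_ge0 z : 0 <= cmod z.
Proof. by case: z => a b; exact: sqrtr_ge0. Qed.

Lemma cmod0 : cmod (0 : C) = 0.
Proof. exact: ComplexField.Normc.normc0. Qed.

Lemma cmod1 : cmod (1 : C) = 1.
Proof. exact: ComplexField.Normc.normc1. Qed.

Lemma cmod_eq0 z : (cmod z == 0) = (z == 0).
Proof.
by apply/eqP/eqP => [/ComplexField.Normc.eq0_normc //|->]; exact: cmod0.
Qed.

Lemma cmod_gt0 z : (0 < cmod z) = (z != 0).
Proof. by rewrite lt_neqAle cmod_ge0 andbT eq_sym cmod_eq0. Qed.

Lemma cmodV z : cmod z^-1 = (cmod z)^-1.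
Proof. exact: ComplexField.Normc.normcV. Qed.

Lemma cmodX z n : cmod (z ^+ n) = cmod z ^+ n.
Proof. by elim: n => [|n IH]; rewrite ?cmod1 // !exprS cmodM IH. Qed.

Lemma cmod_real (x : R) : cmod (real_complex R x) = `|x|.
Proof. by rewrite /cmod /= expr0n /= addr0 sqrtr_sqr. Qed.

Lemma cmod_nat n : cmod (n%:R : C) = n%:R.
Proof. by rewrite -(rmorph_nat (real_complex R)) cmod_real normr_nat. Qed.

Lemma cmod_sqr z : cmod z ^+ 2 = complex.Re z ^+ 2 + complex.Im z ^+ 2.
Proof. by case: z => a b; rewrite sqr_sqrtr // addr_ge0 // sqr_ge0. Qed.

Lemma cmod_Re z : `|complex.Re z| <= cmod z.
Proof.
rewrite -(@ler_pXn2r _ 2) ?nnegrE ?cmod_ge0 // real_normK ?num_real //.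
by rewrite cmod_sqr lerDl sqr_ge0.
Qed.

Lemma cmod_Im z : `|complex.Im z| <= cmod z.
Proof.
rewrite -(@ler_pXn2r _ 2) ?nnegrE ?cmod_ge0 // real_normK ?num_real //.
by rewrite cmod_sqr lerDr sqr_ge0.
Qed.

Lemma cmod_le_ReIm z : cmod z <= `|complex.Re z| + `|complex.Im z|.
Proof.
rewrite -(@ler_pXn2r _ 2) ?nnegrE ?addr_ge0 ?cmod_ge0 //.
rewrite cmod_sqr sqrrD !real_normK ?num_real // -addrA [X in _ <= _ + X]addrC addrA.
by rewrite lerDl mulrn_wge0 // mulr_ge0.
Qed.

Lemma cmod_sum (I : Type) (r : seq I) (F : I -> C) :
  cmod (\sum_(i <- r) F i) <= \sum_(i <- r) cmod (F i).
Proof.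
elim: r => [|i r IH]; first by rewrite !big_nil cmod0.
by rewrite !big_cons; apply: le_trans (cmodD _ _) _; rewrite lerD2l.
Qed.

(** The [l1] norm on complex column vectors. *)
Definition cnorm m (v : 'cV[C]_m) : R := \sum_i cmod (v i 0).

Lemma cnorm_ge0 m (v : 'cV[C]_m) : 0 <= cnorm v.
Proof. by apply: sumr_ge0 => i _; exact: cmod_ge0. Qed.

Lemma cnorm0 m : cnorm (0 : 'cV[C]_m) = 0.
Proof. by rewrite /cnorm big1 // => i _; rewrite mxE cmod0. Qed.

Lemma cnorm_eq0 m (v : 'cV[C]_m) : (cnorm v == 0) = (v == 0).
Proof.
apply/eqP/eqP => [|->]; last exact: cnorm0.
move=> /psumr_eq0P h; apply/matrixP => i j; rewrite ord1 mxE.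
by apply/eqP; rewrite -cmod_eq0 h // => k _; exact: cmod_ge0.
Qed.

Lemma cnorm_gt0 m (v : 'cV[C]_m) : (0 < cnorm v) = (v != 0).
Proof. by rewrite lt_neqAle cnorm_ge0 andbT eq_sym cnorm_eq0. Qed.

Lemma cnormD m (v w : 'cV[C]_m) : cnorm (v + w) <= cnorm v + cnorm w.
Proof.
by rewrite /cnorm -big_split; apply: ler_sum => i _; rewrite mxE; exact: cmodD.
Qed.

Lemma cnormZ m a (v : 'cV[C]_m) : cnorm (a *: v) = cmod a * cnorm v.
Proof. by rewrite /cnorm mulr_sumr; apply: eq_bigr => i _; rewrite mxE cmodM. Qed.

Lemma cnormN m (v : 'cV[C]_m) : cnorm (- v) = cnorm v.
Proof. by apply: eq_bigr => i _; rewrite mxE cmodN. Qed.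

Lemma cnormB m (v w : 'cV[C]_m) : cnorm (v - w) <= cnorm v + cnorm w.
Proof. by rewrite -(cnormN w) cnormD. Qed.

Lemma cnorm_sum m (I : Type) (r : seq I) (F : I -> 'cV[C]_m) :
  cnorm (\sum_(i <- r) F i) <= \sum_(i <- r) cnorm (F i).
Proof.
elim: r => [|i r IH]; first by rewrite !big_nil cnorm0.
by rewrite !big_cons; apply: le_trans (cnormD _ _) _; rewrite lerD2l.
Qed.

Lemma cnorm_mulmx m n (M : 'M[C]_(m, n)) :
  exists2 K, 0 < K & forall v, cnorm (M *m v) <= K * cnorm v.
Proof.
pose K0 := \sum_i \sum_j cmod (M i j).
have K00 : 0 <= K0 by apply: sumr_ge0 => i _; apply: sumr_ge0 => j _; exact: cmod_ge0.
exists (K0 + 1) => [|v]; first by rewrite ltr_wpDl.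
apply: (@le_trans _ _ (K0 * cnorm v)); last by rewrite ler_wpM2r ?cnorm_ge0 // lerDl.
rewrite /K0 mulr_suml; apply: ler_sum => i _; rewrite mxE mulr_suml.
apply: le_trans (cmod_sum _ _) _; apply: ler_sum => j _.
rewrite cmodM ler_wpM2l ?cmod_ge0 // /cnorm (bigD1 j) //= lerDl.
by apply: sumr_ge0 => k _; exact: cmod_ge0.
Qed.

(** A bound that serves a finite family of matrices at once. *)
Lemma cnorm_mulmx_seq (I : eqType) (s : seq I) m n (M : I -> 'M[C]_(m, n)) :
  exists2 K, 0 < K & forall i, i \in s -> forall v, cnorm (M i *m v) <= K * cnorm v.
Proof.
elim: s => [|i s [K K0 hK]]; first by exists 1.
have [K' K'0 hK'] := cnorm_mulmx (M i).
exists (K + K') => [|j]; first exact: addr_gt0.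
rewrite inE => /orP[/eqP-> v|js v].
  by apply: le_trans (hK' v) _; rewrite ler_wpM2r ?cnorm_ge0 // lerDr ltW.
by apply: le_trans (hK j js v) _; rewrite ler_wpM2r ?cnorm_ge0 // lerDl ltW.
Qed.

End ComplexNorm.

Section SpectralResolution.

(** Partial fractions without division: the products over all roots but one,
    together with the full product, generate the unit ideal. The term in [q]
    allows the list [s] to be empty. *)
Lemma bezout_powers (F : fieldType) (m : nat) (s : seq F) : uniq s ->
  exists (u : F -> {poly F}) (q : {poly F}),
    \sum_(l <- s) u l * \prod_(z <- s | z != l) ('X - z%:P) ^+ m
      + q * \prod_(z <- s) ('X - z%:P) ^+ m = 1.
Proof.
elim: s => [|z0 s IH] /=; first by move=> _; exists (fun=> 0), 1; rewrite !big_nil add0r mulr1.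
case/andP => z0s us; have [u [q huq]] := IH us.
set Q := \prod_(z <- s) ('X - z%:P) ^+ m in huq.
have cop : coprimep (('X - z0%:P) ^+ m) Q.
  rewrite /Q; elim: (s) z0s => [|z s' IH'] ; first by rewrite big_nil coprimep1.
  rewrite inE negb_or big_cons => /andP[zz0 z0s'].
  rewrite coprimepMr IH' // andbT coprimep_expl // coprimep_expr //.
  by rewrite coprimep_XsubC root_XsubC eq_sym.
have [[a b] /= hab] := Bezout_eq1_coprimepP _ _ cop.
exists (fun l => if l == z0 then b else a * u l), (a * q).
rewrite !big_cons eqxx /= -/Q.
have -> : \prod_(j <- s | j != z0) ('X - j%:P) ^+ m = Q.
  rewrite /Q big_seq_cond [RHS]big_seq; apply: eq_bigl => j.
  by case: eqVneq => [->|]; rewrite ?andbT // (negbTE z0s).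
have -> : \sum_(j <- s) (if j == z0 then b else a * u j) *
     \prod_(z <- z0 :: s | z != j) ('X - z%:P) ^+ m =
   a * ('X - z0%:P) ^+ m * \sum_(l <- s) u l * \prod_(z <- s | z != l) ('X - z%:P) ^+ m.
  rewrite mulr_sumr; apply: eq_big_seq => j js.
  have jz0 : j != z0 by apply: contraNneq z0s => <-.
  rewrite (negbTE jz0) big_cons eq_sym jz0; ring.
have -> : \sum_(l <- s) u l * \prod_(z <- s | z != l) ('X - z%:P) ^+ m = 1 - q * Q.
  by apply/eqP; rewrite -subr_eq0 opprB addrA huq subrr.
rewrite -[RHS]hab; ring.
Qed.

Variables (F : fieldType) (n : nat) (A : 'M[F]_n.+1).

Lemma horner_mx_XsubC (z : F) : horner_mx A ('X - z%:P) = A - z%:M.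
Proof. by rewrite rmorphB /= horner_mx_X horner_mx_C. Qed.

(** Polynomials in [A] project the kernel of [prod (A - z)^m] onto the generalized
    eigenspaces. *)
Lemma spectral_resolution (m : nat) (s : seq F) : uniq s ->
  exists E : F -> 'M[F]_n.+1,
    (forall l, E l *m A = A *m E l) /\
    forall v : 'cV_n.+1,
      horner_mx A (\prod_(z <- s) ('X - z%:P) ^+ m) *m v = 0 ->
      \sum_(l <- s) E l *m v = v /\
      forall l, l \in s -> (A - l%:M) ^+ m *m (E l *m v) = 0.
Proof.
move=> us; have [u [q huq]] := bezout_powers m us.
pose P l := \prod_(z <- s | z != l) ('X - z%:P) ^+ m.
exists (fun l => horner_mx A (u l * P l)); split=> [l|v hv].
  exact: comm_horner_mx.
split.
  have /(congr1 (fun p => horner_mx A p *m v)) := huq.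
  rewrite rmorph1 mul1mx rmorphD /= mulmxDl rmorphM /= -[X in _ + X]mulmxA hv mulmx0 addr0.
  by rewrite rmorph_sum /= mulmx_suml.
move=> l ls; rewrite -horner_mx_XsubC -rmorphXn /= mulmxA -[_ *m horner_mx _ _]/(_ * _).
rewrite -rmorphM /=.
have -> : ('X - l%:P) ^+ m * (u l * P l) = u l * \prod_(z <- s) ('X - z%:P) ^+ m.
  rewrite (bigD1_seq l) //= -/(P l); ring.
by rewrite rmorphM /= -mulmxA hv mulmx0.
Qed.

End SpectralResolution.

(** * Counting exceptional times *)

Section Rare.

(** [rare b M]: the predicate [b] holds for at most [M] natural numbers. *)
Definition rare (b : pred nat) (M : nat) := forall n, (count b (iota 0 n) <= M)%N.

Lemma rare_sub (b b' : pred nat) M : (forall j, b j -> b' j) -> rare b' M -> rare b M.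
Proof. by move=> bb' h n; apply: leq_trans (h n); exact: sub_count. Qed.

Lemma rareU (b b' : pred nat) M M' : rare b M -> rare b' M' ->
  rare (fun j => b j || b' j) (M + M').
Proof.
move=> h h' n; apply: leq_trans (leq_add (h n) (h' n)).
by rewrite -count_predUI leq_addr.
Qed.

Lemma rare_has (I : eqType) (s : seq I) (b : I -> pred nat) M :
  (forall i, i \in s -> rare (b i) M) ->
  rare (fun j => has (b^~ j) s) (size s * M).
Proof.
elim: s => [|i s IH] h /=; first by move=> n; rewrite (eq_count (a2 := pred0)) ?count_pred0.
rewrite mulSn; apply: rareU; first by apply: h; rewrite mem_head.
by apply: IH => k ks; apply: h; rewrite inE ks orbT.
Qed.

(** Occurrences that all lie within a window of length [L] are at most [L]. *)
Lemma rare_window (b : pred nat) L :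
  (forall i j, (i <= j)%N -> b i -> b j -> (j < i + L)%N) -> rare b L.
Proof.
move=> h n; rewrite -size_filter.
have [i0 bi0 | b0] := pickP (fun i : 'I_n => b i).
  pose i1 := ex_minn (ex_intro b _ bi0).
  have /= [bi1 mi1] : b i1 /\ forall j, b j -> (i1 <= j)%N.
    by rewrite /i1; case: ex_minnP.
  rewrite -[X in (_ <= X)%N](size_iota i1).
  apply: uniq_leq_size; first by rewrite filter_uniq // iota_uniq.
  move=> j; rewrite mem_filter !mem_iota => /andP[bj _].
  by rewrite mi1 //= h ?mi1.
rewrite (eq_in_filter (a2 := pred0)) ?filter_pred0 // => j.
by rewrite mem_iota add0n => /andP[_ jn]; exact: (b0 (Ordinal jn)).
Qed.

Lemma count_iotaS (b : pred nat) n : count b (iota 0 n.+1) = (count b (iota 0 n) + b n)%N.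
Proof. by rewrite -addn1 iotaD count_cat /= addn0 add0n. Qed.

End Rare.

Section Band.
Context {R : realType}.

(** A positive sequence that grows by a factor [kappa > 1] at all but a few
    steps spends few steps in a given band: the truncation of the sequence at
    [kappa b] is a potential which increases by [(kappa - 1) a] at each
    unexceptional step in the band and loses at most [kappa b] otherwise. *)
Lemma rare_band (kappa a b : R) (N : nat) : 1 < kappa -> 0 < a ->
  exists M, forall (rho : nat -> R) (e : pred nat), rare e N ->
    (forall j, 0 < rho j) ->
    (forall j, ~~ e j -> kappa * rho j <= rho j.+1) ->
    rare (fun j => a < rho j < b) M.
Proof.
move=> k1 a0; pose c := (kappa - 1) * a.
have c0 : 0 < c by rewrite mulr_gt0 // subr_gt0.
exists (Num.bound `|kappa * b * (1 + N%:R) / c| + N)%N => rho e rN rho0 step n.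
have [b0|b0] := leP b 0.
  rewrite (eq_count (a2 := pred0)) ?count_pred0 // => j /=.
  by apply/negP => /andP[_]; rewrite ltNge (le_trans b0) // ltW.
have k0 : 0 < kappa by apply: lt_trans k1.
have kb0 : 0 < kappa * b by rewrite mulr_gt0.
(* the potential *)
pose tau j := Num.min (rho j) (kappa * b).
pose good j := (a < rho j < b) && ~~ e j.
have tau0 j : 0 <= tau j by rewrite le_min !ltW.
have key k : c * (count good (iota 0 k))%:R
               <= tau k + kappa * b * (count e (iota 0 k))%:R.
  elim: k => [|k IH]; first by rewrite /= !mulr0 addr0.
  rewrite !count_iotaS !natrD !mulrDr.
  suff : c * (good k)%:R + tau k <= tau k.+1 + kappa * b * (e k)%:R by lra.
  rewrite {1}/good; case ek : (e k); rewrite /= ?andbF ?andbT ?mulr0 ?mulr1.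
    have : tau k <= kappa * b by rewrite ge_min lexx orbT.
    have := tau0 k.+1; lra.
  have st := step k (negbT ek); have rk := rho0 k.
  case: andP => [[ark rkb]|_]; rewrite ?mulr1 ?mulr0 addr0 ?add0r.
    have -> : tau k.+1 = Num.min (rho k.+1) (kappa * b) by [].
    rewrite le_min; have tk : tau k <= rho k by rewrite ge_min lexx.
    have : (kappa - 1) * a <= (kappa - 1) * rho k by rewrite ler_wpM2l // ltW // subr_gt0.
    have : kappa * rho k < kappa * b by rewrite ltr_pM2l.
    by move=> h1 h2; apply/andP; rewrite /c; split; lra.
  rewrite le_min !ge_min lexx orbT andbT; apply/orP; left.
  by apply: le_trans st; rewrite ler_pMl // ltW.
have cnt : (count (fun j => (a < rho j < b)%R) (iota 0 n)
            <= count good (iota 0 n) + count e (iota 0 n))%N.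
  rewrite -count_predUI; apply: leq_trans (leq_addr _ _); apply: sub_count => j /= h.
  by rewrite /good h /=; case: (e j).
apply: leq_trans cnt (leq_add _ (rN n)); apply: ltnW.
rewrite -(ltr_nat R); apply: le_lt_trans (archi_boundP (normr_ge0 _)).
apply: le_trans (ler_norm _); rewrite ler_pdivlMr // mulrC.
apply: le_trans (key n) _; rewrite mulrDr mulr1 lerD ?ge_min ?lexx ?orbT //.
by rewrite ler_wpM2l ?ler_nat // ltW.
Qed.

End Band.

Section PolynomialCount.
Context {R : realType}.
Local Notation C := R[i].

Lemma pow1D_le (x : R) m : 0 <= x <= 1 -> (1 + x) ^+ m <= 1 + (2 ^+ m - 1) * x.
Proof.
move=> /andP[x0 x1]; elim: m => [|m IH]; first by rewrite !expr0 subrr mul0r addr0.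
have q1 : 1 <= 2 ^+ m :> R by rewrite exprn_ege1 // ler1n.
have h : (1 + x) ^+ m * (1 + x) <= (1 + (2 ^+ m - 1) * x) * (1 + x).
  by rewrite ler_wpM2r // addr_ge0.
rewrite exprSr; apply: le_trans h _; rewrite exprS.
set q := 2 ^+ m in q1 *.
have : 0 <= (q - 1) * x * (1 - x) by rewrite !mulr_ge0 // subr_ge0.
lra.
Qed.

(** Far from its roots, a polynomial changes little, relatively, over a unit
    step. *)
Lemma prod_shift (K : R) (x : C) (rs : seq C) : 0 < K ->
  (forall z, z \in rs -> K <= cmod (x - z)) ->
  cmod (\prod_(z <- rs) (x + 1 - z) - \prod_(z <- rs) (x - z))
    <= ((1 + K^-1) ^+ size rs - 1) * cmod (\prod_(z <- rs) (x - z)).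
Proof.
move=> K0; elim: rs => [|z rs IH] h.
  by rewrite !big_nil subrr expr0 subrr mul0r cmod0.
have {IH} := IH _; rewrite !big_cons /= exprS.
set p' := \prod_(_ <- _) _; set p := \prod_(_ <- _) _; set c := _ ^+ _.
move=> IH; have {IH} IH : cmod (p' - p) <= (c - 1) * cmod p.
  by apply: IH => w ws; apply: h; rewrite inE ws orbT.
have hz : K <= cmod (x - z) by apply: h; rewrite mem_head.
have -> : (x + 1 - z) * p' - (x - z) * p = (x - z) * (p' - p) + p' by ring.
apply: le_trans (cmodD _ _) _; rewrite !cmodM.
have hp' : cmod p' <= c * cmod p.
  have : cmod p' <= cmod (p' - p) + cmod p by rewrite -{1}(subrK p p') cmodD.
  lra.
have c0 : 0 <= c by rewrite exprn_ge0 // addr_ge0 // invr_ge0 ltW.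
have h1 : cmod (x - z) * cmod (p' - p) <= cmod (x - z) * ((c - 1) * cmod p).
  by rewrite ler_wpM2l // cmod_ge0.
have h2 : c * cmod p <= K^-1 * cmod (x - z) * (c * cmod p).
  rewrite ler_peMl ?mulr_ge0 ?cmod_ge0 //.
  by rewrite mulrC ler_pdivlMr // mul1r.
lra.
Qed.

(** Hence a polynomial of bounded degree jumps relatively by more than [eta]
    only at the integers close to one of its roots; their number is bounded in
    terms of the degree and [eta] alone. *)
Lemma rare_poly_jump (eta : R) (m : nat) : 0 < eta ->
  exists M, forall P : {poly C}, (size P <= m)%N ->
    rare (fun j => eta * cmod P.[j%:R] < cmod (P.[j.+1%:R] - P.[j%:R])) M.
Proof.
move=> eta0.
have [K [K1 hK]] : exists K : nat, (0 < K)%N /\ (1 + K%:R^-1) ^+ m - 1 <= eta.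
  have q0 : 0 < 2 ^+ m :> R by rewrite exprn_gt0.
  have [N hN] := natmul_large (2 ^+ m) eta0.
  exists (maxn N 1); rewrite leq_max orbT; split=> //.
  have hK := hN _ (leq_maxl N 1).
  set K := maxn N 1 in hK *; have K0 : 0 < K%:R :> R by rewrite ltr0n leq_max orbT.
  have x1 : 0 <= (K%:R^-1 : R) <= 1.
    rewrite invr_ge0 ler0n /= invf_le1 // (_ : 1 = 1%:R) // ler_nat.
    by rewrite leq_max orbT.
  have := pow1D_le m x1; case/andP: x1 => x0 _.
  have : 2 ^+ m * K%:R^-1 <= eta by rewrite ler_pdivrMr // mulrC.
  lra.
exists (m * (2 * K))%N => P sP.
have [->|P0] := eqVneq P 0.
  move=> n; rewrite (eq_count (a2 := pred0)) ?count_pred0 // => j /=.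
  by rewrite !horner0 subrr cmod0 mulr0 ltxx.
have [rs hrs] := closed_field_poly_normal P.
have srs : (size rs <= m)%N.
  apply: leq_trans _ sP; rewrite hrs size_scale ?lead_coef_eq0 // size_prod_XsubC.
  exact: leqnSn.
have K0 : 0 < K%:R :> R by rewrite ltr0n.
have rarez (z : C) : rare (fun j => cmod (j%:R - z) < K%:R) (2 * K).
  apply: rare_window => i j ij hi hj.
  rewrite -(ltr_nat R) natrD natrM -ltrBlDl -natrB //.
  rewrite -cmod_nat natrB //.
  have -> : j%:R - i%:R = (j%:R - z) - (i%:R - z) :> C by ring.
  apply: le_lt_trans (cmodD _ _) _; rewrite cmodN; lra.
move=> n; apply: (@leq_trans (size rs * (2 * K))); last by rewrite leq_mul2r srs orbT.
apply: (rare_sub _ (rare_has (s := rs) (fun z _ => rarez z))) => j hj.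
apply/negPn/negP => /hasPn hn; move: hj; apply/negP; rewrite -leNgt.
have hK' z : z \in rs -> K%:R <= cmod (j%:R - z).
  by move=> /hn; rewrite -leNgt.
have hor x : P.[x] = lead_coef P * \prod_(z <- rs) (x - z).
  rewrite hrs lead_coefZ (monicP (monic_prod_XsubC _ _ _)) mulr1 hornerZ horner_prod.
  by congr (_ * _); apply: eq_bigr => z _; rewrite hornerXsubC.
rewrite !hor -mulrBr !cmodM mulrCA ler_wpM2l ?cmod_ge0 // -natr1.
apply: le_trans (prod_shift K0 hK') _; rewrite ler_wpM2r ?cmod_ge0 //.
apply: le_trans hK; rewrite lerD2r ler_weXn2l // lerDl invr_ge0.
exact: ler0n.
Qed.

(** Newton's form: a combination of binomial coefficients is a polynomial. *)
Lemma bin_sum_poly (a : nat -> C) (m : nat) :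
  exists2 P : {poly C}, (size P <= m)%N &
    forall j, P.[j%:R] = \sum_(k < m) 'C(j, k)%:R * a k.
Proof.
pose B k : {poly C} := (k`!%:R^-1) *: \prod_(i < k) ('X - (i%:R)%:P).
have Bj k j : (B k).[j%:R] = 'C(j, k)%:R.
  rewrite /B hornerZ horner_prod; under eq_bigr do rewrite hornerXsubC.
  have -> : \prod_(i < k) (j%:R - i%:R) = (j ^_ k)%:R :> C.
    elim: k => [|k IH]; first by rewrite big_ord0 ffactn0.
    rewrite big_ord_recr /= IH ffactnSr natrM.
    have [kj|jk] := leqP k j; first by rewrite natrB.
    by rewrite ffact_small // !mul0r.
  by rewrite -bin_ffact natrM mulrCA mulVf ?mulr1 // pnatr_eq0 -lt0n fact_gt0.
exists (\sum_(k < m) a k *: B k) => [|j].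
  apply: (leq_trans (size_sum _ _ _)); apply/bigmax_leqP => k _.
  apply: leq_trans (size_scale_leq _ _) _; apply: leq_trans (size_scale_leq _ _) _.
  by rewrite size_prod_XsubC /index_enum -enumT size_enum_ord.
rewrite horner_sum; apply: eq_bigr => k _.
by rewrite hornerZ Bj mulrC.
Qed.

End PolynomialCount.

(** * Domination between spectral components *)

Section Domination.
Context {R : realType}.
Local Notation C := R[i].
Variable n : nat.
Implicit Types (A : 'M[C]_n.+1) (v x : 'cV[C]_n.+1) (l z : C).

Lemma exp_comm_mulmx A B j : B *m A = A *m B -> B *m A ^+ j = A ^+ j *m B.
Proof.
move=> h; elim: j => [|j IH]; first by rewrite expr0 mulmx1 mul1mx.
by rewrite exprS [A * _]/(A *m _) mulmxA h -mulmxA IH mulmxA.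
Qed.

(** The binomial formula on a generalized eigenspace, with the number of terms
    independent of [j]. *)
Lemma expmx_binomial A l m x j : (A - l%:M) ^+ m *m x = 0 -> l != 0 ->
  A ^+ j *m x =
  l ^+ j *: \sum_(k < m) ('C(j, k)%:R * l ^- k) *: ((A - l%:M) ^+ k *m x).
Proof.
move=> hx l0; set B := A - l%:M in hx *.
have B0 k : (m <= k)%N -> B ^+ k *m x = 0.
  by move=> mk; rewrite -(subnK mk) exprD -[_ * _]/(_ *m _) -mulmxA hx mulmx0.
have -> : A = l%:M + B by rewrite /B addrCA subrr addr0.
have cB : GRing.comm (l%:M : 'M[C]_n.+1) B by apply/esym; exact: scalar_mxC.
rewrite exprDn_comm // mulmx_suml scaler_sumr.
pose F k := (l ^+ j * ('C(j, k)%:R * l ^- k)) *: (B ^+ k *m x).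
have FT N : (j < N)%N -> \sum_(k < N) F k = \sum_(k < j.+1) F k.
  move=> jN; rewrite -(subnKC jN) big_split_ord /= [X in _ + X]big1 ?addr0 //.
  by move=> k _; rewrite /F bin_small ?mul0r ?mulr0 ?scale0r // addSn ltnS leq_addr.
have FT' N : (m <= N)%N -> \sum_(k < N) F k = \sum_(k < m) F k.
  move=> mN; rewrite -(subnKC mN) big_split_ord /= [X in _ + X]big1 ?addr0 //.
  by move=> k _; rewrite /F B0 ?scaler0 // leq_addr.
transitivity (\sum_(k < j.+1) F k).
  apply: eq_bigr => k _; have kj : (k <= j)%N by rewrite -ltnS.
  rewrite /F -rmorphXn /= -[X in _ = (l ^+ X * _) *: _](subnK kj) exprD.
  rewrite mulrCA !mulrA mulfK ?expf_neq0 // -[_ * _ in LHS]/(_ *m _).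
  by rewrite mul_scalar_mx -scaler_nat -!scalemxAl scalerA.
rewrite -(FT (maxn j.+1 m)) ?leq_maxl // FT' ?leq_maxr //.
by apply: eq_bigr => k _; rewrite /F scalerA.
Qed.

(** On a generalized eigenspace, [A] acts almost like the scalar [l], except
    for boundedly many iterates: up to the factor [l ^+ j] each coordinate of
    the orbit is a polynomial in [j]. *)
Lemma rare_not_eigen A l m (eta : R) : l != 0 -> 0 < eta ->
  exists M, forall x, (A - l%:M) ^+ m *m x = 0 ->
    rare (fun j => eta * cnorm (A ^+ j *m x) < cnorm ((A - l%:M) *m (A ^+ j *m x))) M.
Proof.
move=> l0 eta0; have cl0 : 0 < cmod l by rewrite cmod_gt0.
have [M hM] := rare_poly_jump m (divr_gt0 eta0 cl0).
exists (size (enum 'I_n.+1) * M)%N => x hx.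
pose a (c : 'I_n.+1) k := l ^- k * ((A - l%:M) ^+ k *m x) c 0.
have /choice[P hP] c : exists P : {poly C}, (size P <= m)%N /\
    forall j, (A ^+ j *m x) c 0 = l ^+ j * P.[j%:R].
  have [P sP hP] := bin_sum_poly (a c) m; exists P; split=> // j.
  rewrite hP (expmx_binomial j hx l0) mxE summxE; congr (_ * _).
  by apply: eq_bigr => k _; rewrite mxE mulrA.
apply: (rare_sub _ (rare_has (fun c _ => hM (P c) (hP c).1))) => j hj.
apply/negPn/negP => /hasPn hn; move: hj; apply/negP; rewrite -leNgt.
rewrite /cnorm mulr_sumr; apply: ler_sum => c _.
have := hn c; rewrite mem_enum => /(_ isT); rewrite -leNgt => hc.
have -> : ((A - l%:M) *m (A ^+ j *m x)) c 0
    = l ^+ j.+1 * ((P c).[j.+1%:R] - (P c).[j%:R]).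
  rewrite mulmxBl mul_scalar_mx -expmxSl.
  have := (hP c).2 j; have := (hP c).2 j.+1.
  move: (A ^+ j *m x) (A ^+ j.+1 *m x) => w y hy hw.
  rewrite !mxE hy hw exprS; ring.
rewrite (hP c).2 exprS !cmodM.
have h : cmod l * cmod (l ^+ j) * cmod ((P c).[j.+1%:R] - (P c).[j%:R])
   <= cmod l * cmod (l ^+ j) * (eta / cmod l * cmod (P c).[j%:R]).
  by rewrite ler_wpM2l // mulr_ge0 ?cmod_ge0.
apply: le_trans h _; rewrite le_eqVlt; apply/orP; left; apply/eqP.
by field; rewrite gt_eqF.
Qed.

(** Components for eigenvalues of different moduli are comparable in size for
    boundedly many iterates only. *)
Lemma rare_comparable A l l' m (d : R) : A \in unitmx ->
  l != 0 -> cmod l < cmod l' -> 0 < d ->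
  exists M, forall x x', (A - l%:M) ^+ m *m x = 0 -> (A - l'%:M) ^+ m *m x' = 0 ->
    rare (fun j => (d * cnorm (A ^+ j *m x) < cnorm (A ^+ j *m x')) &&
                   (d * cnorm (A ^+ j *m x') < cnorm (A ^+ j *m x))) M.
Proof.
move=> Au l0 ll' d0; have cl0 : 0 < cmod l by rewrite cmod_gt0.
have l'0 : l' != 0 by rewrite -cmod_gt0 (lt_trans cl0).
(* with this tolerance the ratio of the components still grows by [kappa > 1] *)
pose eta := (cmod l' - cmod l) / 4.
have eta0 : 0 < eta by rewrite divr_gt0 // subr_gt0.
have [M1 h1] := rare_not_eigen A m l0 eta0.
have [M2 h2] := rare_not_eigen A m l'0 eta0.
pose kappa := (cmod l' - eta) / (cmod l + eta).
have le0 : 0 < cmod l + eta by rewrite addr_gt0.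
have k1 : 1 < kappa.
  rewrite ltr_pdivlMr // mul1r /eta; lra.
have [M hM] := @rare_band R kappa d d^-1 (M1 + M2) k1 d0.
exists M => x x' hx hx'.
have [->|x0] := eqVneq x 0.
  move=> k; rewrite (eq_count (a2 := pred0)) ?count_pred0 // => j /=.
  by rewrite mulmx0 cnorm0 andbC ltNge mulr_ge0 ?cnorm_ge0 ?ltW.
have [->|x'0] := eqVneq x' 0.
  move=> k; rewrite (eq_count (a2 := pred0)) ?count_pred0 // => j /=.
  by rewrite mulmx0 cnorm0 ltNge mulr_ge0 ?cnorm_ge0 ?ltW.
have nx j : A ^+ j *m x != 0 by rewrite unit_mulmx_neq0 ?unitmx_exp.
have nx' j : A ^+ j *m x' != 0 by rewrite unit_mulmx_neq0 ?unitmx_exp.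
pose rho j := cnorm (A ^+ j *m x') / cnorm (A ^+ j *m x).
have rho0 j : 0 < rho j by rewrite divr_gt0 // cnorm_gt0.
have stepN : forall (z : C) (y : 'cV[C]_n.+1) j,
    A ^+ j.+1 *m y = z *: (A ^+ j *m y) + (A - z%:M) *m (A ^+ j *m y).
  by move=> z y j; rewrite mulmxBl mul_scalar_mx expmxSl addrCA subrr addr0.
have := hM rho _ (rareU (h1 _ hx) (h2 _ hx')) rho0.
move=> /(_ _)/rare_sub; apply => [j|j].
  have c0 : 0 < cnorm (A ^+ j *m x) by rewrite cnorm_gt0.
  move=> /andP[a b]; rewrite /rho ltr_pdivlMr // a /= ltr_pdivrMr //.
  by rewrite mulrC ltr_pdivlMr // mulrC.
rewrite negb_or -!leNgt => /andP[a b].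
have up : cnorm (A ^+ j.+1 *m x) <= (cmod l + eta) * cnorm (A ^+ j *m x).
  rewrite (stepN l x j); apply: le_trans (cnormD _ _) _; rewrite cnormZ; lra.
have low : (cmod l' - eta) * cnorm (A ^+ j *m x') <= cnorm (A ^+ j.+1 *m x').
  have : cnorm (l' *: (A ^+ j *m x')) <=
     cnorm (A ^+ j.+1 *m x') + cnorm ((A - l'%:M) *m (A ^+ j *m x')).
    apply: le_trans (cnormB _ _); rewrite (stepN l' x' j) addrK lexx //.
  rewrite cnormZ; lra.
have c0 : 0 < cnorm (A ^+ j *m x) by rewrite cnorm_gt0.
have c1 : 0 < cnorm (A ^+ j.+1 *m x) by rewrite cnorm_gt0.
rewrite /rho ler_pdivlMr // /kappa.
have : (cmod l' - eta) * cnorm (A ^+ j *m x') * (cnorm (A ^+ j.+1 *m x)) <=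
   cnorm (A ^+ j.+1 *m x') * ((cmod l + eta) * cnorm (A ^+ j *m x)).
  by apply: ler_pM => //; rewrite ?mulr_ge0 ?cnorm_ge0 // /eta; lra.
set p := cnorm _; set q := cnorm _; set r := cnorm _; set t := cnorm _ => h.
have -> : (cmod l' - eta) / (cmod l + eta) * (p / t) * q
  = (cmod l' - eta) * p * q / ((cmod l + eta) * t).
  by field; rewrite !gt_eqF.
by rewrite ler_pdivrMr // mulr_gt0.
Qed.

End Domination.

Section FarFromEigen.
Context {R : realType}.
Local Notation C := R[i].

(** The product of [A - z] over the [z] of modulus [r] listed in [s]. When [s]
    lists the eigenvalues of [A], its kernel is the sum of the eigenspaces of
    modulus [r]. *)
Definition modulus_factor m (A : 'M[C]_m) (s : seq C) (r : R) : 'M[C]_m :=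
  \prod_(z <- s | cmod z == r) (A - z%:M).

Lemma seq_argmax (s : seq C) (f : C -> R) : s != [::] ->
  exists2 l, l \in s & forall z, z \in s -> f z <= f l.
Proof.
elim: s => // l s IH _; have [->|/IH[l' l's hl']] := eqVneq s [::].
  by exists l; rewrite ?mem_head // => z; rewrite inE => /eqP->.
have [h|h] := leP (f l) (f l').
  exists l'; rewrite ?inE ?l's ?orbT // => z; rewrite inE => /orP[/eqP->//|]; exact: hl'.
exists l; rewrite ?mem_head // => z; rewrite inE => /orP[/eqP->//|/hl' h'].
exact: le_trans h' (ltW h).
Qed.

Lemma le_of_not_comparable (d a b : R) : 0 < d < 1 -> 0 <= a -> b <= a ->
  ~~ ((d * b < a) && (d * a < b)) -> b <= d * a.
Proof.
move=> /andP[d0 d1] a0 ba; rewrite negb_and -!leNgt => /orP[h|//].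
have h1 : a <= d * a by apply: le_trans h _; rewrite ler_wpM2l // ltW.
have : (1 - d) * a <= 0 by lra.
rewrite pmulr_rle0 ?subr_gt0 // => h2.
by apply: le_trans ba (le_trans h2 _); rewrite mulr_ge0 // ltW.
Qed.

Variable n : nat.
Implicit Types (A : 'M[C]_n.+1) (v x : 'cV[C]_n.+1) (l z : C).

Lemma modulus_factorE A s r :
  modulus_factor A s r = horner_mx A (\prod_(z <- s | cmod z == r) ('X - z%:P)).
Proof. by rewrite rmorph_prod /=; apply: eq_bigr => z _; rewrite horner_mx_XsubC. Qed.

Lemma modulus_factor_factor A s l : uniq s -> l \in s ->
  exists B, modulus_factor A s (cmod l) = B *m (A - l%:M).
Proof.
move=> us ls; rewrite modulus_factorE -big_filter.
set s' := [seq z <- s | cmod z == cmod l].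
exists (horner_mx A (\prod_(z <- s' | z != l) ('X - z%:P))).
rewrite (bigD1_seq l) ?mem_filter ?eqxx ?filter_uniq //= mulrC rmorphM /=.
by rewrite horner_mx_XsubC.
Qed.

(** Except for boundedly many iterates, an orbit is close to the sum of the
    eigenspaces of a single modulus, namely that of its largest component:
    components of other moduli are then much smaller, and all components are
    almost eigenvectors. *)
Lemma rare_far A (s : seq C) m (d : R) : A \in unitmx -> uniq s -> (forall l, l \in s -> l != 0) ->
  horner_mx A (\prod_(z <- s) ('X - z%:P) ^+ m) = 0 -> 0 < d ->
  exists M, forall v, v != 0 ->
    rare (fun j => ~~ has (fun l => cnorm (modulus_factor A s (cmod l) *m (A ^+ j *m v))
                                    <= d * cnorm (A ^+ j *m v)) s) M.
Proof.
move=> Au us s0 hA d0.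
have [E [cE hE]] := @spectral_resolution _ n A m s us.
have {}hE v : \sum_(l <- s) E l *m v = v /\
      forall l, l \in s -> (A - l%:M) ^+ m *m (E l *m v) = 0.
  by apply: hE; rewrite hA mul0mx.
have /choice[B hB] l : exists B, l \in s -> modulus_factor A s (cmod l) = B *m (A - l%:M).
  have [ls|] := boolP (l \in s); last by exists 0.
  by have [B hB] := modulus_factor_factor A us ls; exists B.
have [K1 K10 hK1] := cnorm_mulmx_seq s (fun l => modulus_factor A s (cmod l)).
have [K2 K20 hK2] := cnorm_mulmx_seq s B.
have [K3 K30 hK3] := cnorm_mulmx_seq s E.
pose K := (K1 + K2) * K3 * (size s)%:R + 1.
have K0 : 0 < K by rewrite ltr_wpDl // !mulr_ge0 ?addr_ge0 // ltW.
pose d1 := Num.min (d / K) (1 / 2).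
have d10 : 0 < d1 by rewrite lt_min !divr_gt0.
have d1lt1 : d1 < 1 by rewrite gt_min; apply/orP; right; lra.
have d1K : d1 * K <= d by rewrite -ler_pdivlMr // ge_min lexx.
have /choice[M1 hM1] l : exists M, l \in s -> forall v, rare (fun j =>
    d1 * cnorm (A ^+ j *m (E l *m v)) < cnorm ((A - l%:M) *m (A ^+ j *m (E l *m v)))) M.
  have [ls|_] := boolP (l \in s); last by exists 0%N.
  have [M hM] := rare_not_eigen A m (s0 _ ls) d10.
  by exists M => _ v; apply: hM; exact: (hE v).2.
pose cmp (l l' : C) v := fun j =>
  (d1 * cnorm (A ^+ j *m (E l *m v)) < cnorm (A ^+ j *m (E l' *m v))) &&
  (d1 * cnorm (A ^+ j *m (E l' *m v)) < cnorm (A ^+ j *m (E l *m v))).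
have /choice[M2 hM2] (ll : C * C) : exists M, ll.1 \in s -> ll.2 \in s ->
    cmod ll.1 < cmod ll.2 -> forall v, rare (cmp ll.1 ll.2 v) M.
  case: ll => l l' /=; have [ls|_] := boolP (l \in s); last by exists 0%N.
  have [l's|_] := boolP (l' \in s); last by exists 0%N.
  have [ll'|_] := ltP (cmod l) (cmod l'); last by exists 0%N.
  have [M hM] := rare_comparable m Au (s0 _ ls) ll' d10.
  by exists M => _ _ _ v; apply: hM; exact: (hE v).2.
(* exceptional iterates: some component is not almost an eigenvector, or two
   components of different moduli are comparable *)
pose N1 := (\max_(l <- s) M1 l)%N.
pose pairs := [seq ll <- [seq (l, l') | l <- s, l' <- s] | cmod ll.1 < cmod ll.2].
pose N2 := (\max_(ll <- pairs) M2 ll)%N.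
exists (size s * N1 + size pairs * N2)%N => v v0.
have r1 := @rare_has _ s (fun l j => d1 * cnorm (A ^+ j *m (E l *m v)) <
   cnorm ((A - l%:M) *m (A ^+ j *m (E l *m v)))) N1.
have r2 := @rare_has _ pairs (fun ll => cmp ll.1 ll.2 v) N2.
apply: rare_sub (rareU (r1 _) (r2 _)); last first.
- move=> [l l']; rewrite mem_filter /= => /andP[/= ll' /allpairsP[[a b] /= [als bls [el el']]]].
  rewrite {l}el {l'}el' in ll' *.
  move=> k; apply: (leq_trans (hM2 (a, b) als bls ll' v k)).
  apply: leq_bigmax_seq => //; rewrite mem_filter /= ll'.
  by apply/allpairsP; exists (a, b).
- move=> l ls k; apply: (leq_trans (hM1 l ls v k)).
  exact: leq_bigmax_seq.
move=> j; apply: contraR; rewrite negb_or => /andP[/hasPn g1 /hasPn g2].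
pose w l := A ^+ j *m (E l *m v).
have Ewj l : w l = E l *m (A ^+ j *m v).
  by rewrite /w !mulmxA exp_comm_mulmx.
have sw : A ^+ j *m v = \sum_(l <- s) w l.
  by rewrite -[in LHS](hE v).1 mulmx_sumr.
have sn0 : s != [::].
  apply: contraNneq v0 => s_nil; have := (hE v).1.
  by rewrite s_nil big_nil => <-.
have [l ls hl] := seq_argmax (fun l => cnorm (w l)) sn0.
apply/hasP; exists l => //=.
rewrite [in X in X <= _]sw mulmx_sumr; apply: le_trans (cnorm_sum _ _) _.
have bound z : z \in s -> cnorm (modulus_factor A s (cmod l) *m w z)
     <= (K1 + K2) * d1 * cnorm (w l).
  move=> zs; have [zl|zl] := eqVneq (cmod z) (cmod l).
    have /= h := g1 z zs; rewrite -leNgt -/(w z) in h.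
    rewrite -zl (hB z zs) -mulmxA; apply: le_trans (hK2 z zs _) _.
    apply: (@le_trans _ _ (K2 * (d1 * cnorm (w l)))).
      apply: (ler_wpM2l (ltW K20)); apply: le_trans h _.
      by apply: (ler_wpM2l (ltW d10)); exact: hl.
    rewrite mulrA; apply: (ler_wpM2r (cnorm_ge0 _)); apply: (ler_wpM2r (ltW d10)).
    by rewrite lerDr ltW.
  apply: le_trans (hK1 l ls _) _.
  apply: (@le_trans _ _ (K1 * (d1 * cnorm (w l)))); last first.
    rewrite mulrA; apply: (ler_wpM2r (cnorm_ge0 _)); apply: (ler_wpM2r (ltW d10)).
    by rewrite lerDl ltW.
  apply: (ler_wpM2l (ltW K10)).
  have hzl : cnorm (w z) <= cnorm (w l) := hl z zs.
  have d1_itv : 0 < d1 < 1 by rewrite d10 d1lt1.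
  apply: (le_of_not_comparable d1_itv (cnorm_ge0 _) hzl).
  have [lt|gt|eq] := ltgtP (cmod z) (cmod l); last by rewrite eq eqxx in zl.
    have /= := g2 (z, l); apply; rewrite mem_filter /= lt.
    by apply/allpairsP; exists (z, l).
  rewrite andbC; have /= := g2 (l, z); apply; rewrite mem_filter /= gt.
  by apply/allpairsP; exists (l, z).
have wl : cnorm (w l) <= K3 * cnorm (A ^+ j *m v) by rewrite Ewj hK3.
apply: (@le_trans _ _ (\sum_(z <- s) (K1 + K2) * d1 * cnorm (w l))).
  by rewrite big_seq [leRHS]big_seq; apply: ler_sum => z; exact: bound.
rewrite big_const_seq count_predT iter_addr_0 -mulr_natr.
apply: (@le_trans _ _ ((K1 + K2) * d1 * (K3 * cnorm (A ^+ j *m v)) * (size s)%:R)).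
  have K12 : 0 <= (K1 + K2) * d1 by rewrite mulr_ge0 ?addr_ge0 // ltW.
  by apply: ler_wpM2r => //; apply: (ler_wpM2l K12).
apply: (@le_trans _ _ (d1 * K * cnorm (A ^+ j *m v))).
  have := mulr_ge0 (ltW d10) (cnorm_ge0 (A ^+ j *m v)).
  by rewrite /K; clear; move: (cnorm _) => c h; lra.
exact: (ler_wpM2r (cnorm_ge0 _)).
Qed.

End FarFromEigen.

(** * Real approximation and continuity of angles *)

Section NearKernel.
Context {R : realType}.
Local Notation C := R[i].

(** A real vector as a complex one. *)
Definition toCv m (v : 'cV[R]_m) : 'cV[C]_m := map_mx (real_complex R) v.

Lemma toCv_mulmx m n (A : 'M[R]_(m, n)) v :
  toCv (A *m v) = map_mx (real_complex R) A *m toCv v.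
Proof. exact: map_mxM. Qed.

Lemma toCv_eq0 m (v : 'cV[R]_m) : (toCv v == 0) = (v == 0).
Proof. exact: map_mx_eq0. Qed.

Lemma cnorm_toCv m (v : 'cV[R]_m) : cnorm (toCv v) = \sum_i `|v i 0|.
Proof. by apply: eq_bigr => i _; rewrite mxE cmod_real. Qed.

Lemma enorm_le_cnorm m (v : 'cV[R]_m) : enorm v <= cnorm (toCv v).
Proof.
rewrite -(@ler_pXn2r _ 2) ?nnegrE ?enorm_ge0 ?cnorm_ge0 // enorm_sqr innerE.
rewrite cnorm_toCv expr2 mulr_suml; apply: ler_sum => i _.
rewrite -expr2 -real_normK ?num_real // expr2 ler_wpM2l //.
by rewrite (bigD1 i) //= lerDl sumr_ge0.
Qed.

Lemma cnorm_le_enorm m (v : 'cV[R]_m) : cnorm (toCv v) <= m%:R * enorm v.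
Proof.
rewrite cnorm_toCv mulr_natl -[X in _ *+ X]card_ord -sumr_const.
apply: ler_sum => i _.
rewrite -(@ler_pXn2r _ 2) ?nnegrE ?enorm_ge0 // enorm_sqr innerE.
rewrite real_normK ?num_real // (bigD1 i) //= -expr2 lerDl.
by apply: sumr_ge0 => j _; rewrite -expr2 sqr_ge0.
Qed.

Lemma enorm_mulmx m n (M : 'M[R]_(m, n)) :
  exists2 K, 0 < K & forall v, enorm (M *m v) <= K * enorm v.
Proof.
have [K K0 hK] := cnorm_mulmx (map_mx (real_complex R) M).
exists (K * n%:R + 1) => [|v]; first by rewrite ltr_wpDl // mulr_ge0 // ltW.
apply: le_trans (enorm_le_cnorm _) _; rewrite toCv_mulmx; apply: le_trans (hK _) _.
apply: (@le_trans _ _ (K * (n%:R * enorm v))).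
  by rewrite ler_wpM2l ?cnorm_le_enorm // ltW.
by rewrite mulrA ler_wpM2r ?enorm_ge0 // lerDl.
Qed.

Lemma Re_sum (I : Type) (r : seq I) (F : I -> C) :
  complex.Re (\sum_(i <- r) F i) = \sum_(i <- r) complex.Re (F i).
Proof.
elim: r => [|i r IH]; first by rewrite !big_nil.
by rewrite !big_cons -IH; case: (F i) (\sum_(j <- r) F j) => a b [].
Qed.

Lemma Im_sum (I : Type) (r : seq I) (F : I -> C) :
  complex.Im (\sum_(i <- r) F i) = \sum_(i <- r) complex.Im (F i).
Proof.
elim: r => [|i r IH]; first by rewrite !big_nil.
by rewrite !big_cons -IH; case: (F i) (\sum_(j <- r) F j) => a b [].
Qed.

Lemma Re_mulmx_toCv m n (M : 'M[C]_(m, n)) v i :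
  complex.Re ((M *m toCv v) i 0) = (map_mx (@complex.Re R) M *m v) i 0.
Proof.
rewrite !mxE Re_sum; apply: eq_bigr => j _; rewrite !mxE.
by case: (M i j) => a b /=; rewrite mulr0 subr0.
Qed.

Lemma Im_mulmx_toCv m n (M : 'M[C]_(m, n)) v i :
  complex.Im ((M *m toCv v) i 0) = (map_mx (@complex.Im R) M *m v) i 0.
Proof.
rewrite !mxE Im_sum; apply: eq_bigr => j _; rewrite !mxE.
by case: (M i j) => a b /=; rewrite mulr0 add0r.
Qed.

(** The distance of a real vector to the real kernel of [M] is controlled
    by the size of its image under [M]. *)
Lemma near_kernel m n (M : 'M[C]_(m, n)) :
  exists2 K, 0 < K & forall v : 'cV[R]_n, exists2 w,
    M *m toCv w = 0 & enorm (v - w) <= K * cnorm (M *m toCv v).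
Proof.
(* the real matrix whose kernel is the set of real vectors killed by [M] *)
pose L := col_mx (map_mx (@complex.Re R) M) (map_mx (@complex.Im R) M).
have [K K0 hK] := cnorm_mulmx (map_mx (real_complex R) (pinvmx L)).
exists (K * 2) => [|v]; first by rewrite mulr_gt0.
(* [L w = 0] since [L (pinvmx L) L = L] *)
exists (v - pinvmx L *m (L *m v)).
  have : L *m (v - pinvmx L *m (L *m v)) = 0.
    have e : L *m pinvmx L *m L = L by rewrite mulmxKpV ?submx_refl.
    by rewrite mulmxBr (mulmxA L (pinvmx L)) (mulmxA _ L v) e subrr.
  move: (v - _) => w; rewrite mul_col_mx -[0]vsubmxK => /eq_col_mx[hr hi].
  apply/matrixP => i j; rewrite ord1; apply/eqP; rewrite eq_complex.
  by rewrite Re_mulmx_toCv Im_mulmx_toCv hr hi !mxE /= !eqxx.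
have -> : v - (v - pinvmx L *m (L *m v)) = pinvmx L *m (L *m v).
  by rewrite opprB addrCA subrr addr0.
apply: le_trans (enorm_le_cnorm _) _; rewrite toCv_mulmx.
apply: le_trans (hK _) _; rewrite -mulrA; apply: (ler_wpM2l (ltW K0)).
rewrite cnorm_toCv mul_col_mx big_split_ord /=.
have -> : 2 * cnorm (M *m toCv v) = cnorm (M *m toCv v) + cnorm (M *m toCv v) by ring.
apply: lerD; apply: ler_sum => i _.
  by rewrite col_mxEu -Re_mulmx_toCv cmod_Re.
by rewrite col_mxEd -Im_mulmx_toCv cmod_Im.
Qed.

End NearKernel.

Section AngleContinuity.
Context {R : realType}.

(** [acos] is uniformly continuous on [0, 1], because
    [|cos s - cos t| >= 1 - cos (s - t)] for [s] and [t] in the first quadrant. *)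
Lemma acos_unif (e : R) : 0 < e -> exists2 d, 0 < d &
  forall a b, 0 <= a <= 1 -> 0 <= b <= 1 -> `|a - b| <= d -> `|acos a - acos b| <= e.
Proof.
move=> e0; pose e1 := Num.min e pi.
have e10 : 0 < e1 by rewrite lt_min e0 pi_gt0.
have e1pi : e1 <= pi by rewrite ge_min lexx orbT.
have ce1 : cos e1 < 1.
  by rewrite -cos0 ltr_cos ?in_itv /= ?lexx ?pi_ge0 ?(ltW e10) ?e1pi.
exists ((1 - cos e1) / 2) => [|a b]; first by rewrite divr_gt0 // subr_gt0.
wlog ab : a b / acos b <= acos a.
  move=> H ha hb hab; have [h|h] := leP (acos b) (acos a); first exact: H.
  by rewrite distrC; apply: H; [exact: ltW|by []|by []|by rewrite distrC].
move=> ha hb; have := acos_itv ha; have := acos_itv hb.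
have : cos (acos a) = a by rewrite acosK ?in_itv //=; apply/andP; split; lra.
have : cos (acos b) = b by rewrite acosK ?in_itv //=; apply/andP; split; lra.
move: (acos a) (acos b) ab => s t ts <- <- /andP[t0 tp] /andP[s0 sp] h.
have pi0 := pi_gt0 R.
rewrite ger0_norm ?subr_ge0 //; apply: (@le_trans _ _ e1); last by rewrite ge_min lexx.
rewrite leNgt; apply/negP => hst.
have c1 : cos (s - t) < cos e1.
  by rewrite ltr_cos ?in_itv /=; lra.
set x := (s + t) / 2; set y := (s - t) / 2.
have E1 : s = x + y by rewrite /x /y; lra.
have E2 : t = x - y by rewrite /x /y; lra.
have E3 : s - t = y + y by rewrite /y; lra.
move: h c1; rewrite E3 E1 E2 cosB !cosD.
have y0 : 0 <= sin y by apply: sin_ge0_pi; rewrite /y; apply/andP; split; lra.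
have xy : sin y <= sin x.
  by rewrite leNgt ltr_sin ?in_itv /= -?leNgt /x /y; [lra | apply/andP; split; lra..].
have cy := cos2Dsin2 y; rewrite ler_norml => /andP[h1 h2] c1.
have : sin y * sin y <= sin x * sin y by rewrite ler_wpM2r.
rewrite !expr2 in cy; lra.
Qed.

Lemma enorm_neq0 m (v : 'cV[R]_m) : v != 0 -> enorm v != 0.
Proof. by rewrite -enorm_gt0 => /lt0r_neq0. Qed.

Lemma enorm_sub_ge m (v w : 'cV[R]_m) : `|enorm v - enorm w| <= enorm (v - w).
Proof.
rewrite ler_norml; apply/andP; split.
  by rewrite lerNl opprB lerBlDr -(enormN (v - w)) opprB -{1}(subrK v w) enormD.
by rewrite lerBlDr -{1}(subrK w v) enormD.
Qed.

Lemma enorm_normalize_sub m (d : R) (v w : 'cV[R]_m) : v != 0 -> w != 0 ->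
  enorm (v - w) <= d * enorm v ->
  enorm ((enorm v)^-1 *: v - (enorm w)^-1 *: w) <= 2 * d.
Proof.
move=> v0 w0 h; have nv : 0 < enorm v by rewrite enorm_gt0.
have nw : 0 < enorm w by rewrite enorm_gt0.
have -> : (enorm v)^-1 *: v - (enorm w)^-1 *: w =
    (enorm v)^-1 *: (v - w) + ((enorm v)^-1 - (enorm w)^-1) *: w.
  by rewrite scalerBr scalerBl addrA subrK.
apply: le_trans (enormD _ _) _; rewrite !enormZ.
have -> : `|(enorm v)^-1 - (enorm w)^-1| = `|enorm v - enorm w| / (enorm v * enorm w).
  rewrite -[X in _ / X]gtr0_norm ?mulr_gt0 // -normf_div distrC; congr `|_|.
  by field; rewrite !gt_eqF.
rewrite gtr0_norm ?invr_gt0 //.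
have h1 : (enorm v)^-1 * enorm (v - w) <= d by rewrite mulrC ler_pdivrMr.
have h2 : `|enorm v - enorm w| / (enorm v * enorm w) * enorm w <= d.
  have -> : `|enorm v - enorm w| / (enorm v * enorm w) * enorm w =
     `|enorm v - enorm w| / enorm v by field; rewrite !gt_eqF.
  by rewrite ler_pdivrMr //; apply: le_trans h; exact: enorm_sub_ge.
lra.
Qed.

Lemma cos_line_normalize m (v w : 'cV[R]_m) : v != 0 -> w != 0 ->
  `|inner v w| / (enorm v * enorm w)
    = `|inner ((enorm v)^-1 *: v) ((enorm w)^-1 *: w)|.
Proof.
move=> v0 w0; rewrite innerZl innerZr !normrM.
have nv : 0 < (enorm v)^-1 by rewrite invr_gt0 enorm_gt0.
have nw : 0 < (enorm w)^-1 by rewrite invr_gt0 enorm_gt0.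
by rewrite (gtr0_norm nv) (gtr0_norm nw) invfM; ring.
Qed.

Lemma enorm_normalize m (v : 'cV[R]_m) : v != 0 -> enorm ((enorm v)^-1 *: v) = 1.
Proof.
move=> v0; rewrite enormZ gtr0_norm ?invr_gt0 ?enorm_gt0 //.
by rewrite mulVf // enorm_neq0.
Qed.

(** Angles of lines are uniformly continuous with respect to relative
    perturbations of the spanning vectors. *)
Lemma vangle_unif m (e : R) : 0 < e -> exists2 d, 0 < d &
  forall v v' w w' : 'cV[R]_m, v != 0 -> v' != 0 -> w != 0 -> w' != 0 ->
    enorm (v - v') <= d * enorm v -> enorm (w - w') <= d * enorm w ->
    `|vangle v w - vangle v' w'| <= e.
Proof.
move=> e0; have [d d0 hd] := acos_unif e0.
exists (d / 4) => [|v v' w w' v0 v'0 w0 w'0 hv hw]; first by rewrite divr_gt0.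
apply: hd; rewrite ?cos_line_itv // !cos_line_normalize //.
have := enorm_normalize_sub v0 v'0 hv; have := enorm_normalize_sub w0 w'0 hw.
have := enorm_normalize v'0; have := enorm_normalize w0.
move: (_ *: v) (_ *: v') (_ *: w) (_ *: w') => x x' y y' ny nx' hy hx.
apply: le_trans (ler_dist_dist _ _) _.
have -> : inner x y - inner x' y' = inner (x - x') y + inner x' (y - y').
  by rewrite innerBl innerBr; ring.
apply: le_trans (ler_normD _ _) _.
have := cauchy_schwarz (x - x') y; have := cauchy_schwarz x' (y - y').
rewrite nx' ny mulr1 mul1r; lra.
Qed.

(** Finite angle sums are uniformly continuous. *)
Lemma orbit_sum_unif m (A : 'M[R]_m) N (e : R) : A \in unitmx -> 0 < e ->
  exists2 d, 0 < d & forall v w, v != 0 -> w != 0 ->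
    enorm (v - w) <= d * enorm v -> `|orbit_sum A N v - orbit_sum A N w| <= e.
Proof.
move=> Au; elim: N e => [|N IH] e e0.
  by exists 1 => // v w _ _ _; rewrite /orbit_sum !big_ord0 subrr normr0 ltW.
have e20 : 0 < e / 2 by rewrite divr_gt0.
have [d1 d10 h1] := IH _ e20; have [d2 d20 h2] := vangle_unif m e20.
have rel j : exists2 K, 0 < K & forall v w, enorm (v - w) <= d2 / K * enorm v ->
    enorm (A ^+ j *m v - A ^+ j *m w) <= d2 * enorm (A ^+ j *m v).
  have [K K0 hK] := enorm_mulmx (A ^+ j).
  have [K' K'0 hK'] := enorm_mulmx (invmx (A ^+ j)).
  exists (K * K') => [|v w h]; first exact: mulr_gt0.
  rewrite -mulmxBr; apply: le_trans (hK _) _.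
  have hv : enorm v <= K' * enorm (A ^+ j *m v).
    by have := hK' (A ^+ j *m v); rewrite mulmxA mulVmx ?unitmx_exp // mul1mx.
  apply: (@le_trans _ _ (K * (d2 / (K * K') * enorm v))).
    exact: (ler_wpM2l (ltW K0)).
  have -> : K * (d2 / (K * K') * enorm v) = d2 / K' * enorm v by field; rewrite !gt_eqF.
  have -> : d2 * enorm (A ^+ j *m v) = d2 / K' * (K' * enorm (A ^+ j *m v)).
    by field; rewrite gt_eqF.
  by apply: ler_wpM2l => //; rewrite divr_ge0 // ltW.
have [K K0 hK] := rel N; have [K' K'0 hK'] := rel N.+1.
exists (Num.min d1 (Num.min (d2 / K) (d2 / K'))).
  by rewrite !lt_min d10 !divr_gt0.
move=> v w v0 w0 h.
have hmin c : Num.min d1 (Num.min (d2 / K) (d2 / K')) <= c -> enorm (v - w) <= c * enorm v.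
  by move=> hc; apply: le_trans h _; apply: (ler_wpM2r (enorm_ge0 _)).
have a1 := h1 v w v0 w0 (hmin _ _).
have a2 := hK v w (hmin _ _); have a3 := hK' v w (hmin _ _).
have {}a1 : `|orbit_sum A N v - orbit_sum A N w| <= e / 2.
  by apply: a1; rewrite ge_min lexx.
have {}a2 : enorm (A ^+ N *m v - A ^+ N *m w) <= d2 * enorm (A ^+ N *m v).
  by apply: a2; rewrite !ge_min lexx orbT.
have {}a3 : enorm (A ^+ N.+1 *m v - A ^+ N.+1 *m w) <= d2 * enorm (A ^+ N.+1 *m v).
  by apply: a3; rewrite !ge_min lexx !orbT.
have := h2 _ _ _ _ _ _ _ _ a2 a3.
rewrite !unit_mulmx_neq0 ?unitmx_exp // => /(_ isT isT isT isT) a4.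
rewrite /orbit_sum !big_ord_recr /= opprD addrACA; apply: le_trans (ler_normD _ _) _.
rewrite -/(orbit_sum A N v) -/(orbit_sum A N w); lra.
Qed.

(** If the angle sum over [N] steps is at most [N c] from every iterate outside
    [bad], then the bad iterates are the only obstruction to the slope [c]: walk
    by [N] steps from a good iterate and by one step from a bad one. *)
Lemma orbit_sum_greedy m (A : 'M[R]_m) N (c : R) (v : 'cV[R]_m) (bad : pred nat) :
  (0 < N)%N -> (forall j, ~~ bad j -> orbit_sum A N (A ^+ j *m v) <= N%:R * c) ->
  forall n j, orbit_sum A n (A ^+ j *m v) <=
    n%:R * c + (count bad (iota j n) + N)%:R * (pi / 2 + `|c|).
Proof.
move=> N0 h n; have [k] := ubnP n; elim: k n => // k IH n nk j.
have p0 : 0 <= pi / 2 :> R by rewrite divr_ge0 // pi_ge0.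
have c1 := ler_norm c; have c2 : - `|c| <= c by rewrite lerNl -normrN ler_norm.
have p1 : 0 <= pi / 2 + `|c| by rewrite addr_ge0.
have [nN|Nn] := ltnP n N.
  have /andP[_ h1] := orbit_sum_itv A n (A ^+ j *m v).
  apply: le_trans h1 _; rewrite natrD.
  have h2 : n%:R * (pi / 2 + `|c|) <= N%:R * (pi / 2 + `|c|).
    by rewrite ler_wpM2r // ler_nat ltnW.
  have h3 : 0 <= (count bad (iota j n))%:R * (pi / 2 + `|c|) by rewrite mulr_ge0.
  have h4 : n%:R * - `|c| <= n%:R * c by rewrite ler_wpM2l.
  lra.
have [bj|gj] := boolP (bad j).
  case: n Nn nk => [|n] Nn nk; first by rewrite leqNgt N0 in Nn.
  rewrite -{1}add1n orbit_sumD -expmxD add1n.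
  have /andP[_ h1] := orbit_sum_itv A 1 (A ^+ j *m v).
  have h2 := IH n nk j.+1.
  have -> : (count bad (iota j n.+1) + N)%:R = 1 + (count bad (iota j.+1 n) + N)%:R :> R.
    by rewrite /= bj -addnA natrD.
  rewrite -natr1; lra.
rewrite -{1}(subnKC Nn) orbit_sumD -expmxD [(N + j)%N]addnC.
have h1 := h j gj.
have h2 : orbit_sum A (n - N) (A ^+ (j + N) *m v) <= (n - N)%:R * c
     + (count bad (iota (j + N) (n - N)) + N)%:R * (pi / 2 + `|c|).
  apply: IH; rewrite -ltnS (leq_trans _ nk) // ltnS.
  by rewrite ltn_subrL N0 (leq_trans N0 Nn).
have h3 : (count bad (iota (j + N) (n - N)) <= count bad (iota j n))%N.
  by rewrite -[X in iota j X](subnKC Nn) iotaD count_cat leq_addl.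
have h4 : (count bad (iota (j + N) (n - N)) + N)%:R * (pi / 2 + `|c|)
   <= (count bad (iota j n) + N)%:R * (pi / 2 + `|c|).
  by rewrite ler_wpM2r // ler_nat leq_add2r.
rewrite natrB // mulrBl in h2; lra.
Qed.

End AngleContinuity.

(** * Almost periodicity on eigenspaces of one modulus *)

Section AlmostPeriods.
Context {R : realType}.
Local Notation C := R[i].

Lemma finite_values (T : finType) (c : nat -> T) :
  exists M, forall k, exists2 j, (j <= M)%N & c j = c k.
Proof.
have /choice[f hf] (t : T) : exists j, forall k, c k = t -> c j = t.
  have [[k hk]|h] := pselect (exists k, c k = t); first by exists k.
  by exists 0%N => k hk; case: h; exists k.
exists (\max_t f t)%N => k; exists (f (c k)); first exact: leq_bigmax.
exact: (hf (c k) k).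
Qed.

Lemma truncn_close (h x y : R) : 0 < h -> 0 <= x -> 0 <= y ->
  Num.truncn (x / h) = Num.truncn (y / h) -> `|x - y| <= h.
Proof.
move=> h0 x0 y0 e.
have := truncn_itv (divr_ge0 x0 (ltW h0)); have := truncn_itv (divr_ge0 y0 (ltW h0)).
rewrite e -natr1 !ler_pdivlMr // !ltr_pdivrMr // => /andP[a b] /andP[a' b'].
rewrite ler_norml; apply/andP; split; lra.
Qed.

(** Common almost periods of finitely many rotations have bounded gaps. The torus
    is divided into finitely many small cells, and [M] bounds the first visits
    of the orbit to the cells it meets; if the iterates [j <= M] and [k + M] share
    a cell, then [k + M - j] is an almost period between [k] and [k + M]. *)
Lemma almost_periods (zs : seq C) (e : R) : 0 < e ->
  (forall z, z \in zs -> cmod z = 1) ->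
  exists L, forall k, exists2 k', (k <= k' <= k + L)%N &
    forall z, z \in zs -> cmod (z ^+ k' - 1) <= e.
Proof.
move=> e0 hz; pose h := e / 2; have h0 : 0 < h by rewrite divr_gt0.
pose B := (Num.truncn (2 / h)).+1.
pose cell (x : R) : 'I_B := inord (Num.truncn ((x + 1) / h)).
have cell_close x y : -1 <= x <= 1 -> -1 <= y <= 1 -> cell x = cell y -> `|x - y| <= h.
  move=> /andP[x0 x1] /andP[y0 y1] /(congr1 val).
  have lt u : -1 <= u -> u <= 1 -> (Num.truncn ((u + 1) / h) < B)%N.
    move=> u0 u1; rewrite ltnS; apply: le_truncn.
    by rewrite ler_pM2r ?invr_gt0 //; lra.
  rewrite /cell /= !inordK ?lt // => E.
  have -> : x - y = (x + 1) - (y + 1) by ring.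
  by apply: truncn_close => //; lra.
pose c k := [ffun i : 'I_(size zs) =>
  (cell (complex.Re (zs`_i ^+ k)), cell (complex.Im (zs`_i ^+ k)))].
have [M hM] := finite_values c.
exists M => k; have [j jM hj] := hM (k + M)%N.
have jk : (j <= k + M)%N by rewrite (leq_trans jM) // leq_addl.
exists (k + M - j)%N.
  by rewrite leq_subr andbT leq_subRL // addnC leq_add2l.
move=> z zz; have iz : (index z zs < size zs)%N by rewrite index_mem.
have := congr1 (fun f : {ffun _ -> _} => f (Ordinal iz)) hj.
rewrite !ffunE /= nth_index // => -[hRe hIm].
have cz l : cmod (z ^+ l) = 1 by rewrite cmodX hz // expr1n.
have itvR l : -1 <= complex.Re (z ^+ l) <= 1.
  by have := cmod_Re (z ^+ l); rewrite cz ler_norml.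
have itvI l : -1 <= complex.Im (z ^+ l) <= 1.
  by have := cmod_Im (z ^+ l); rewrite cz ler_norml.
have d1 := cell_close _ _ (itvR _) (itvR _) hRe.
have d2 := cell_close _ _ (itvI _) (itvI _) hIm.
have : cmod (z ^+ j * (z ^+ (k + M - j) - 1)) <= e.
  rewrite mulrBr mulr1 -exprD subnKC //.
  apply: le_trans (cmod_le_ReIm _) _.
  have -> : complex.Re (z ^+ (k + M) - z ^+ j) =
      - (complex.Re (z ^+ j) - complex.Re (z ^+ (k + M))).
    by case: (z ^+ (k + M)) (z ^+ j) => a b [a' b'] /=; ring.
  have -> : complex.Im (z ^+ (k + M) - z ^+ j) =
      - (complex.Im (z ^+ j) - complex.Im (z ^+ (k + M))).
    by case: (z ^+ (k + M)) (z ^+ j) => a b [a' b'] /=; ring.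
  rewrite !normrN; move: d1 d2; rewrite /h; lra.
by rewrite cmodM cz mul1r.
Qed.

End AlmostPeriods.

Section Slope.
Context {R : realType}.
Local Notation C := R[i].
Variables (n : nat) (A : 'M[R]_n.+1).
Hypothesis Au : A \in unitmx.
Implicit Types (v w : 'cV[R]_n.+1) (s : seq C).

Lemma toC_unit : toC A \in unitmx.
Proof. by rewrite map_unitmx. Qed.

Lemma toCv_exp j v : toCv (A ^+ j *m v) = toC A ^+ j *m toCv v.
Proof. by rewrite toCv_mulmx; congr (_ *m _); rewrite rmorphXn. Qed.

(** The distinct eigenvalues of [A]; that the last power is large enough is the
    Cayley-Hamilton theorem. *)
Lemma eigen_list : exists s, [/\ uniq s, forall z, (z \in s) = eigenvalue (toC A) z,
  forall z, z \in s -> z != 0 &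
  horner_mx (toC A) (\prod_(z <- s) ('X - z%:P) ^+ n.+1) = 0].
Proof.
have [rs hrs] := closed_field_poly_normal (char_poly (toC A)).
have mon : lead_coef (char_poly (toC A)) = 1 by exact/monicP/char_poly_monic.
rewrite mon scale1r in hrs.
have srs : size rs = n.+1.
  by have := size_char_poly (toC A); rewrite hrs size_prod_XsubC => -[].
have ev z : (z \in undup rs) = eigenvalue (toC A) z.
  by rewrite mem_undup eigenvalue_root_char hrs root_prod_XsubC.
exists (undup rs); split; first exact: undup_uniq.
- exact: ev.
- move=> z; rewrite ev => /eigenvalueP[v hv v0]; apply: contraNneq v0 => z0.
  by rewrite -(mulmx1 v) -(mulmxV toC_unit) mulmxA hv z0 scale0r mul0mx.
have -> : \prod_(z <- undup rs) ('X - z%:P) ^+ n.+1 =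
    \prod_(z <- undup rs) ('X - z%:P) ^+ (n.+1 - count_mem z rs) * char_poly (toC A).
  rewrite hrs -(@prodr_undup_exp_count _ _ rs xpredT) /= -big_split /=.
  apply: eq_bigr => z _; rewrite -exprD subnK // -srs; exact: count_size.
by rewrite rmorphM /= Cayley_Hamilton mulr0.
Qed.

Variable s : seq C.
Hypothesis us : uniq s.
Hypothesis s0 : forall z, z \in s -> z != 0.

(** Vectors of the sum of the eigenspaces of modulus [r] return close to their
    own line after bounded gaps, uniformly in the vector: apply common almost
    periods to the quotients of the eigenvalues by [r]. *)
Lemma modulus_space_return r (e : R) : 0 < r -> 0 < e ->
  exists L, forall k, exists2 k', (k <= k' <= k + L)%N & forall w,
    modulus_factor (toC A) s r *m toCv w = 0 ->
    enorm (r ^+ k' *: w - A ^+ k' *m w) <= e * enorm (r ^+ k' *: w).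
Proof.
move=> r0 e0; pose sr := [seq z <- s | cmod z == r].
have [E [cE hE]] := @spectral_resolution _ n (toC A) 1 sr (filter_uniq _ us).
have [K K0 hK] := cnorm_mulmx_seq sr E.
pose K1 := K * (size sr)%:R * n.+1%:R + 1.
have K10 : 0 < K1 by rewrite ltr_wpDl // !mulr_ge0 // ltW.
pose zs := [seq z / real_complex R r | z <- sr].
have rC0 : real_complex R r != 0 by rewrite fmorph_eq0 gt_eqF.
have hz z : z \in zs -> cmod z = 1.
  case/mapP => y; rewrite mem_filter => /andP[/eqP yr _] ->.
  by rewrite cmodM cmodV cmod_real gtr0_norm // yr divff // gt_eqF.
have [L hL] := almost_periods (divr_gt0 e0 K10) hz.
exists L => k; have [k' kk' h] := hL k; exists k' => // w hw.
have [sw ew] : \sum_(l <- sr) E l *m toCv w = toCv w /\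
    forall l, l \in sr -> (toC A - l%:M) ^+ 1 *m (E l *m toCv w) = 0.
  apply: hE; move: hw; rewrite modulus_factorE -big_filter => hw.
  have -> : \prod_(z <- sr) ('X - z%:P) ^+ 1 = \prod_(z <- sr) ('X - z%:P) by [].
  exact: hw.
have Ae l : l \in sr -> toC A ^+ k' *m (E l *m toCv w) = l ^+ k' *: (E l *m toCv w).
  move=> /ew; rewrite expr1 mulmxBl mul_scalar_mx => /eqP; rewrite subr_eq0 => /eqP hl.
  elim: (k') => [|i IH]; first by rewrite !expr0 mul1mx scale1r.
  by rewrite expmxSl IH -scalemxAr hl scalerA exprSr.
apply: le_trans (enorm_le_cnorm _) _.
have -> : toCv (r ^+ k' *: w - A ^+ k' *m w) =
   - \sum_(l <- sr) (l ^+ k' - real_complex R r ^+ k') *: (E l *m toCv w).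
  have -> : toCv (r ^+ k' *: w - A ^+ k' *m w) =
      real_complex R r ^+ k' *: toCv w - toC A ^+ k' *m toCv w.
    by rewrite -toCv_exp /toCv map_mxB map_mxZ rmorphXn.
  rewrite -[in LHS]sw mulmx_sumr scaler_sumr -sumrB -sumrN.
  by apply: eq_big_seq => l ls; rewrite (Ae l ls) -scalerBl -scaleNr opprB.
rewrite cnormN; apply: le_trans (cnorm_sum _ _) _.
have rk0 : 0 < r ^+ k' by rewrite exprn_gt0.
have bound l : l \in sr ->
    cnorm ((l ^+ k' - real_complex R r ^+ k') *: (E l *m toCv w)) <=
    r ^+ k' * (e / K1) * (K * (n.+1%:R * enorm w)).
  move=> ls; rewrite cnormZ.
  have -> : l ^+ k' - real_complex R r ^+ k' =
     real_complex R r ^+ k' * ((l / real_complex R r) ^+ k' - 1).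
    by rewrite mulrBr mulr1 -exprMn mulrC divfK.
  rewrite cmodM cmodX cmod_real (gtr0_norm r0).
  apply: ler_pM; rewrite ?mulr_ge0 ?cmod_ge0 ?cnorm_ge0 ?(ltW rk0) //.
    by apply: (ler_wpM2l (ltW rk0)); apply: h; exact: map_f.
  apply: le_trans (hK l ls _) _; apply: (ler_wpM2l (ltW K0)).
  exact: cnorm_le_enorm.
apply: (@le_trans _ _ (\sum_(l <- sr) r ^+ k' * (e / K1) * (K * (n.+1%:R * enorm w)))).
  by rewrite big_seq [leRHS]big_seq; apply: ler_sum => l; exact: bound.
rewrite big_const_seq count_predT iter_addr_0 -[leLHS]mulr_natr enormZ (gtr0_norm rk0).
have -> : r ^+ k' * (e / K1) * (K * (n.+1%:R * enorm w)) * (size sr)%:R =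
   r ^+ k' * enorm w * e * ((K1 - 1) / K1) by rewrite /K1; ring.
have -> : e * (r ^+ k' * enorm w) = r ^+ k' * enorm w * e * 1 by ring.
apply: ler_wpM2l; first by rewrite !mulr_ge0 ?enorm_ge0 // ltW.
by rewrite ler_pdivrMr // mul1r gerBl.
Qed.

Lemma modulus_factor_orbit r w j : modulus_factor (toC A) s r *m toCv w = 0 ->
  modulus_factor (toC A) s r *m toCv (A ^+ j *m w) = 0.
Proof.
move=> hw; rewrite toCv_exp mulmxA exp_comm_mulmx.
  by rewrite -mulmxA hw mulmx0.
by rewrite modulus_factorE; exact: comm_horner_mx.
Qed.

(** Hence an angle sum of length [N] from any point of the orbit almost reaches
    the one from its start: the loss is at most [N e + L], where [L] depends
    neither on [w] nor on [N]. *)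
Lemma orbit_sum_return r (e : R) : 0 < r -> 0 < e ->
  exists L, forall w, w != 0 -> modulus_factor (toC A) s r *m toCv w = 0 ->
    forall k N, orbit_sum A N w - N%:R * e - L <= orbit_sum A N (A ^+ k *m w).
Proof.
move=> r0 e0; have [d d0 hd] := @vangle_unif R n.+1 _ e0.
have [L hL] := modulus_space_return r0 d0.
exists (L%:R * (pi / 2)) => w w0 hw k N.
have [k' /andP[kk' k'L] hk'] := hL k.
have rk0 : r ^+ k' != 0 by rewrite expf_neq0 // gt_eqF.
have close : orbit_sum A N w - N%:R * e <= orbit_sum A N (A ^+ k' *m w).
  rewrite lerBlDr mulr_natl -[X in _ *+ X]card_ord -sumr_const -big_split /=.
  apply: ler_sum => j _; rewrite -!expmxD addnC [(j.+1 + k')%N]addnC !expmxD.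
  have nz i : A ^+ i *m w != 0 by rewrite unit_mulmx_neq0 ?unitmx_exp.
  have nz' i : A ^+ k' *m (A ^+ i *m w) != 0 by rewrite unit_mulmx_neq0 ?unitmx_exp.
  have nzr i : r ^+ k' *: (A ^+ i *m w) != 0 by rewrite scaler_eq0 negb_or rk0 nz.
  rewrite -(vangleZ _ _ rk0 rk0).
  have := hd _ _ _ _ (nzr j) (nz' j) (nzr j.+1) (nz' j.+1)
    (hk' _ (modulus_factor_orbit j hw)) (hk' _ (modulus_factor_orbit j.+1 hw)).
  by rewrite ler_norml => /andP[_]; rewrite lerBlDl addrC.
have E1 := orbit_sumD A (k' - k) N (A ^+ k *m w).
have E2 := orbit_sumD A N (k' - k) (A ^+ k *m w).
rewrite -!expmxD subnK // in E1; rewrite addnC E1 -!expmxD in E2.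
have /andP[h1 _] := orbit_sum_itv A (k' - k) (A ^+ k *m w).
have /andP[_ h2] := orbit_sum_itv A (k' - k) (A ^+ (N + k) *m w).
have h3 : (k' - k)%:R * (pi / 2) <= L%:R * (pi / 2) :> R.
  by rewrite ler_wpM2r ?divr_ge0 ?pi_ge0 // ler_nat leq_subLR.
lra.
Qed.

End Slope.

(** * Existence of the slope *)

Section SlopeExistence.
Context {R : realType}.
Local Notation C := R[i].
Variables (n : nat) (A : 'M[R]_n.+1).
Hypothesis Au : A \in unitmx.
Variable s : seq C.
Hypothesis us : uniq s.
Hypothesis s0 : forall z, z \in s -> z != 0.
Hypothesis hA : horner_mx (toC A) (\prod_(z <- s) ('X - z%:P) ^+ n.+1) = 0.
Implicit Types (v w : 'cV[R]_n.+1) (c e : R).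

(** The slopes of the linear bounds valid for all angle sums; the largest
    slope of the angle sums is the infimum of this set. *)
Definition slope_bounds : set R :=
  [set c | exists K, forall v, v != 0 -> forall k, orbit_sum A k v <= k%:R * c + K].

Lemma slope_bounds_ge0 c : slope_bounds c -> 0 <= c.
Proof.
move=> [K hK]; rewrite leNgt; apply/negP => c0.
have nc0 : 0 < - c by rewrite oppr_gt0.
have [k /(_ k (leqnn k)) hk] := natmul_large (K + 1) nc0.
have v0 : (const_mx 1 : 'cV[R]_n.+1) != 0.
  by apply/eqP => /matrixP/(_ 0 0)/eqP; rewrite !mxE oner_eq0.
have := hK _ v0 k; have /andP[h _] := orbit_sum_itv A k (const_mx 1 : 'cV[R]_n.+1).
lra.
Qed.

Lemma slope_bounds_has_inf : has_inf slope_bounds.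
Proof.
split; last by exists 0 => c; exact: slope_bounds_ge0.
exists (pi / 2), 0 => v _ k; rewrite addr0.
by case/andP: (orbit_sum_itv A k v).
Qed.

Lemma slope_upper e : 0 < e -> exists K, forall v, v != 0 -> forall k,
  orbit_sum A k v <= k%:R * (inf slope_bounds + e) + K.
Proof.
move=> e0; have [c [K hK] ce] := inf_adherent e0 slope_bounds_has_inf.
exists K => v v0 k; apply: le_trans (hK v v0 k) _.
by rewrite lerD2r ler_wpM2l // ltW.
Qed.

(** Real form of the rarity of excursions from the eigenspaces of one modulus. *)
Lemma modulus_space_near (d : R) : 0 < d -> exists M, forall v, v != 0 ->
  rare (fun j => ~~ `[< exists l w, [/\ l \in s, w != 0,
     modulus_factor (toC A) s (cmod l) *m toCv w = 0 &
     enorm (A ^+ j *m v - w) <= d * enorm (A ^+ j *m v)] >]) M.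
Proof.
move=> d0.
have /choice[K hK] l : exists K, 0 < K /\ forall v, exists2 w,
    modulus_factor (toC A) s (cmod l) *m toCv w = 0 &
    enorm (v - w) <= K * cnorm (modulus_factor (toC A) s (cmod l) *m toCv v).
  by have [K K0 hK] := near_kernel (modulus_factor (toC A) s (cmod l)); exists K.
pose K1 := \sum_(l <- s) K l + 1.
have K1l l : l \in s -> K l <= K1.
  move=> ls; rewrite /K1 (big_rem l) //= -addrA lerDl addr_ge0 // sumr_ge0 // => z _.
  exact: ltW (hK z).1.
have K10 : 0 < K1.
  by rewrite ltr_wpDl // sumr_ge0 // => z _; exact: ltW (hK z).1.
pose d1 := Num.min d (1 / 2); have d10 : 0 < d1 by rewrite lt_min d0 divr_gt0.
have [M hM] := @rare_far R n (toC A) s n.+1 (d1 / (K1 * n.+1%:R))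
   (toC_unit Au) us s0 hA (divr_gt0 d10 (mulr_gt0 K10 (ltr0Sn _ _))).
exists M => v v0; apply: rare_sub (hM (toCv v) _); last by rewrite toCv_eq0.
move=> j; apply: contra => /hasP[l ls hl]; apply/asboolP.
have [w hw hvw] := (hK l).2 (A ^+ j *m v).
have nv : A ^+ j *m v != 0 by rewrite unit_mulmx_neq0 ?unitmx_exp.
have nv0 : 0 < enorm (A ^+ j *m v) by rewrite enorm_gt0.
have close : enorm (A ^+ j *m v - w) <= d1 * enorm (A ^+ j *m v).
  apply: le_trans hvw _; rewrite -toCv_exp in hl.
  apply: (@le_trans _ _ (K1 * (d1 / (K1 * n.+1%:R) * (n.+1%:R * enorm (A ^+ j *m v))))).
    apply: ler_pM; rewrite ?cnorm_ge0 ?K1l //; first exact: ltW (hK l).1.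
    apply: le_trans hl _; apply: ler_wpM2l; last exact: cnorm_le_enorm.
    by rewrite divr_ge0 ?mulr_ge0 // ltW.
  rewrite le_eqVlt; apply/orP; left; apply/eqP.
  have nn0 : (n.+1%:R : R) != 0 by rewrite pnatr_eq0.
  by move: (n.+1%:R : R) nn0 => nn nn0; field; rewrite nn0 gt_eqF.
exists l, w; split=> //; last first.
  by apply: le_trans close _; rewrite ler_wpM2r ?enorm_ge0 // ge_min lexx.
apply: contraTneq close => ->; rewrite subr0 -ltNge gtr_pMl //.
by rewrite gt_min; apply/orP; right; lra.
Qed.

(** Some angle sum of length [N] over the eigenspaces of one modulus reaches the
    slope: were they all smaller, the rare excursions of the other orbits could
    not make up for it. *)
Lemma slope_attained N e : (0 < N)%N -> 0 < e -> exists l w, [/\ l \in s, w != 0,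
  modulus_factor (toC A) s (cmod l) *m toCv w = 0 &
  N%:R * (inf slope_bounds - e) <= orbit_sum A N w].
Proof.
move=> N0 e0; apply: contrapT => H.
pose t := inf slope_bounds.
have N0R : 0 < N%:R :> R by rewrite ltr0n.
have [d d0 hd] := orbit_sum_unif N Au (mulr_gt0 N0R (divr_gt0 e0 (ltr0Sn _ 1))).
have [M hM] := modulus_space_near d0.
suff : slope_bounds (t - e / 2).
  move=> /(ge_inf slope_bounds_has_inf.2); rewrite -/t; lra.
exists ((M + N)%:R * (pi / 2 + `|t - e / 2|)) => v v0 k.
have := @orbit_sum_greedy _ _ A N (t - e / 2) v _ N0 _ k 0%N.
rewrite expr0 mul1mx => h; apply: le_trans (h _ _) _; last first.
  rewrite lerD2l ler_wpM2r ?addr_ge0 ?divr_ge0 ?pi_ge0 // ler_nat leq_add2r.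
  exact: hM v v0 k.
move=> j; rewrite negbK => /asboolP[l [w [ls w0 hw close]]].
have nv : A ^+ j *m v != 0 by rewrite unit_mulmx_neq0 ?unitmx_exp.
have := hd _ _ nv w0 close; rewrite ler_norml => /andP[_ h1].
have h2 : orbit_sum A N w < N%:R * (t - e).
  by rewrite ltNge; apply/negP => h2; apply: H; exists l, w.
lra.
Qed.

(** The slope is attained along a whole orbit: almost periodicity spreads a large
    angle sum over a long block to all blocks of the same length. *)
Lemma slope_lower e : 0 < e -> exists K l w, [/\ l \in s, w != 0,
  modulus_factor (toC A) s (cmod l) *m toCv w = 0 &
  forall k j, j%:R * (inf slope_bounds - e) - K <= orbit_sum A j (A ^+ k *m w)].
Proof.
move=> e0; set t := inf slope_bounds.
have e40 : 0 < e / 4 by rewrite divr_gt0.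
have /choice[L hL] (l : C) : exists L, l \in s -> forall w, w != 0 ->
    modulus_factor (toC A) s (cmod l) *m toCv w = 0 ->
    forall k N, orbit_sum A N w - N%:R * (e / 4) - L <= orbit_sum A N (A ^+ k *m w).
  have [ls|_] := boolP (l \in s); last by exists 0.
  have l0 : 0 < cmod l by rewrite cmod_gt0 s0.
  by have [L hL] := orbit_sum_return Au us l0 e40; exists L.
pose L1 := \sum_(l <- s) `|L l|.
have LL1 l : l \in s -> L l <= L1.
  move=> ls; apply: le_trans (ler_norm _) _; rewrite /L1 (big_rem l) //= lerDl.
  exact: sumr_ge0.
(* the length [N] makes the loss [L1] of the return negligible *)
have [N /(_ N.+1 (leqnSn N)) hN] := natmul_large L1 e40.
have [l [w [ls w0 hw hS]]] := slope_attained (ltn0Sn N) e40.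
pose t' := t - 3 * (e / 4).
have block k : N.+1%:R * t' <= orbit_sum A N.+1 (A ^+ k *m w).
  have := hL l ls w w0 hw k N.+1; have := LL1 l ls; rewrite /t'.
  move: hS; rewrite -/t; lra.
have blocks q : forall k, (q * N.+1)%:R * t' <= orbit_sum A (q * N.+1) (A ^+ k *m w).
  elim: q => [|q IH] k; first by rewrite mul0n mul0r; case/andP: (orbit_sum_itv A 0 (A ^+ k *m w)).
  rewrite mulSn orbit_sumD -expmxD natrD mulrDl.
  by apply: lerD; [exact: block | exact: IH].
exists (N.+1%:R * `|t'|), l, w; split=> // k j.
rewrite {2}(divn_eq j N.+1) orbit_sumD.
have h1 := blocks (j %/ N.+1)%N k.
have /andP[h2 _] := orbit_sum_itv A (j %% N.+1) (A ^+ (j %/ N.+1 * N.+1) *m (A ^+ k *m w)).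
have h3 : (j %% N.+1)%:R * t' <= N.+1%:R * `|t'|.
  apply: (@le_trans _ _ ((j %% N.+1)%:R * `|t'|)).
    by apply: ler_wpM2l => //; exact: ler_norm.
  by apply: ler_wpM2r => //; rewrite ler_nat ltnW // ltn_mod.
have h4 : j%:R * t' = (j %/ N.+1 * N.+1)%:R * t' + (j %% N.+1)%:R * t'.
  by rewrite -mulrDl -natrD -divn_eq.
have h5 : j%:R * (t - e) <= j%:R * t' by rewrite ler_wpM2l // /t'; lra.
lra.
Qed.

End SlopeExistence.

Section FirstAngularValue.
Context {R : realType}.
Local Notation C := R[i].

(** [t] is the largest slope of the angle sums, and it is attained up to [e]
    along the orbit of a vector [w] killed by a product of factors [A - z] over
    distinct eigenvalues [z] of one common modulus [r]. *)
Definition is_slope m (A : 'M[R]_m) (t : R) : Prop :=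
  (forall e, 0 < e -> exists K, forall v, v != 0 -> forall k,
     orbit_sum A k v <= k%:R * (t + e) + K) /\
  (forall e, 0 < e -> exists K (s : seq C) (r : R) (w : 'cV[R]_m),
     [/\ uniq s, forall z, z \in s -> eigenvalue (toC A) z /\ cmod z = r, w != 0,
       (\prod_(z <- s) (toC A - z%:M)) *m toCv w = 0 &
       forall k j, j%:R * (t - e) - K <= orbit_sum A j (A ^+ k *m w)]).

Lemma slope_exists m (A : 'M[R]_m) : (0 < m)%N -> A \in unitmx ->
  exists t, is_slope A t.
Proof.
case: m A => // n A _ Au; have [s [us hs s0 hA]] := eigen_list Au.
exists (inf (slope_bounds A)); split; first exact: slope_upper.
move=> e e0; have [K [l [w [ls w0 hw h]]]] := slope_lower Au us s0 hA e0.
exists K, [seq z <- s | cmod z == cmod l], (cmod l), w; split=> //.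
- exact: filter_uniq.
- by move=> z; rewrite mem_filter hs => /andP[/eqP].
- by rewrite big_filter.
Qed.

Lemma is_slope_angval m (A : 'M[R]_m) t : A \in unitmx -> is_slope A t -> angval A t.
Proof.
move=> Au [h1 h2]; split=> e e0.
  have [K hK] := h1 e e0; exists K => V /G1_line[v v0 ->] k n.
  by rewrite asum_line //; apply: hK; rewrite unit_mulmx_neq0 ?unitmx_exp.
have [K [s [r [w [_ _ w0 _ h]]]]] := h2 e e0; exists K, <[w]>%VS.
split; first exact: line_G1.
by move=> k n; rewrite asum_line.
Qed.

End FirstAngularValue.

(** * Linear rotations of a plane *)

Section PlaneRotation.
Context {R : realType}.

Lemma cos_atan_div (X q : R) : 0 < X ->
  cos (atan (q / X)) = X / Num.sqrt (X ^+ 2 + q ^+ 2).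
Proof.
move=> X0; rewrite cos_atan.
have -> : 1 + (q / X) ^+ 2 = (X ^+ 2 + q ^+ 2) / X ^+ 2 by field; rewrite gt_eqF.
rewrite sqrtrM ?addr_ge0 ?sqr_ge0 // sqrtrV ?sqr_ge0 // sqrtr_sqr gtr0_norm //.
by rewrite invfM invrK mulrC.
Qed.

Lemma sin_atan_div (X q : R) : 0 < X ->
  sin (atan (q / X)) = q / Num.sqrt (X ^+ 2 + q ^+ 2).
Proof.
move=> X0; have c := cos_atan_div q X0.
have r0 : 0 < X ^+ 2 + q ^+ 2 by rewrite ltr_wpDr ?sqr_ge0 // exprn_gt0.
have h := atanK (q / X); rewrite /tan c in h.
have s0 : Num.sqrt (X ^+ 2 + q ^+ 2) != 0 by rewrite gt_eqF // sqrtr_gt0.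
have -> : sin (atan (q / X)) = sin (atan (q / X)) /
   (X / Num.sqrt (X ^+ 2 + q ^+ 2)) * (X / Num.sqrt (X ^+ 2 + q ^+ 2)).
  by rewrite divfK // mulf_neq0 ?invr_eq0 // gt_eqF.
by rewrite h; field; rewrite s0 gt_eqF.
Qed.

Lemma acos_norm_cos_le (x : R) : 0 <= x <= pi ->
  acos `|cos x| <= x /\ acos `|cos x| <= pi - x.
Proof.
move=> /andP[x0 xp]; have pi0 := pi_gt0 R.
have e1 : acos (cos x) = x by rewrite cosK // in_itv /= x0.
have e2 : acos (- cos x) = pi - x.
  by rewrite acosN ?e1 // cos_geN1 cos_le1.
have [h|h] := leP 0 (cos x).
  rewrite ger0_norm // e1; split=> //.
  have : x <= pi / 2.
    rewrite leNgt; apply/negP => hx; have : cos x < cos (pi / 2).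
      by rewrite ltr_cos // in_itv /=; apply/andP; split; lra.
    by rewrite cos_pihalf ltNge h.
  lra.
rewrite ltr0_norm // e2; split=> //.
have : pi / 2 <= x.
  rewrite leNgt; apply/negP => hx; have : 0 <= cos x.
    by apply: cos_ge0_pihalf; apply/andP; split; lra.
  by rewrite leNgt h.
lra.
Qed.

Lemma sin_gt0_itv (x : R) : - pi < x < 2 * pi -> 0 < sin x -> 0 < x < pi.
Proof.
move=> /andP[x1 x2] sx; apply/andP; split; rewrite ltNge; apply/negP => h.
  have : 0 <= sin (- x) by apply: sin_ge0_pi; apply/andP; split; lra.
  rewrite sinN; lra.
have : 0 <= sin (x - pi) by apply: sin_ge0_pi; apply/andP; split; lra.
rewrite sinB cospi sinpi; lra.
Qed.

(** The Gram determinant of two vectors. *)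
Definition gram m (x y : 'cV[R]_m) : R := inner x x * inner y y - inner x y ^+ 2.

Lemma gram_eq0 m (x y : 'cV[R]_m) : gram x y = 0 ->
  inner x x *: y = inner x y *: x.
Proof.
move=> g0; apply/eqP; rewrite -subr_eq0 -inner_eq0 innerBl !innerBr !innerZl !innerZr.
rewrite (innerC y x); apply/eqP; transitivity (inner x x * gram x y).
  by rewrite /gram; ring.
by rewrite g0 mulr0.
Qed.

(** Let [P] be the positive definite matrix [G + sqrt (det G)], where [G] is the
    Gram matrix of [x] and [y]; up to a scalar it is the positive part of the
    polar decomposition of the map sending the standard basis to [x, y]. Then
    [polar_arg D x y], for [D = sqrt (det G)], is the oriented angle from the
    first basis vector to its image under [P], which is less than a right angle. *)
Definition polar_arg m (D : R) (x y : 'cV[R]_m) : R :=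
  atan (inner x y / (inner x x + D)).

Lemma polar_arg_itv m D (x y : 'cV[R]_m) : - (pi / 2) < polar_arg D x y < pi / 2.
Proof. by rewrite atan_gtNpi2 atan_ltpi2. Qed.

(** One step of the linear rotation by [phi] in the frame [x, y] turns [x] by the
    oriented angle [alpha], which is [phi] plus the increment of [polar_arg].
    The orthogonal part of the polar decomposition does not affect angles, and
    [alpha] lies between [0] and [pi] since [sin alpha] is a positive multiple
    of [D * sin phi]. *)
Lemma plane_step m (x y : 'cV[R]_m) (phi D : R) :
  0 < phi < pi -> 0 < D -> D ^+ 2 = gram x y ->
  let x' := cos phi *: x + sin phi *: y in
  let y' := cos phi *: y - sin phi *: x in
  let alpha := phi + polar_arg D x' y' - polar_arg D x y in
  [/\ gram x' y' = gram x y, 0 < alpha < pi,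
      vangle x x' = acos `|cos alpha|,
      (0 <= cos alpha) = (0 <= inner x x') & (cos alpha <= 0) = (inner x x' <= 0)].
Proof.
move=> phi0 D0 DG x' y' alpha.
set c := cos phi; set s := sin phi.
have cs : c ^+ 2 + s ^+ 2 = 1 by exact: cos2Dsin2.
have s0 : 0 < s by apply: sin_gt0_pi.
pose p := inner x x; pose q := inner x y; pose t := inner y y.
have G0 : p * t - q ^+ 2 - D ^+ 2 = 0 by rewrite DG /gram subrr.
pose p' := c ^+ 2 * p + 2 * c * s * q + s ^+ 2 * t.
pose q' := (c ^+ 2 - s ^+ 2) * q + c * s * (t - p).
pose t' := s ^+ 2 * p - 2 * c * s * q + c ^+ 2 * t.
have ep : inner x' x' = p'.
  rewrite /x' !innerDl !innerDr !innerZl !innerZr (innerC y x) -/p -/q -/t -/c -/s /p'; ring.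
have eq_ : inner x' y' = q'.
  rewrite /x' /y' !innerDl !innerBr !innerZl !innerZr (innerC y x) -/p -/q -/t -/c -/s /q'; ring.
have et : inner y' y' = t'.
  rewrite /y' !innerBl !innerBr !innerZl !innerZr (innerC y x) -/p -/q -/t -/c -/s /t'; ring.
have exx' : inner x x' = c * p + s * q.
  by rewrite /x' innerDr !innerZr -/p -/q -/c -/s.
have gram' : p' * t' - q' ^+ 2 = p * t - q ^+ 2.
  have -> : p' * t' - q' ^+ 2 = (c ^+ 2 + s ^+ 2) ^+ 2 * (p * t - q ^+ 2).
    by rewrite /p' /t' /q'; ring.
  by rewrite cs expr1n mul1r.
have sum' : p' + t' = p + t.
  have -> : p' + t' = (c ^+ 2 + s ^+ 2) * (p + t) by rewrite /p' /t'; ring.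
  by rewrite cs mul1r.
have pt0 : 0 < p * t.
  have -> : p * t = D ^+ 2 + q ^+ 2 by move: G0; lra.
  by rewrite ltr_wpDr ?sqr_ge0 // exprn_gt0.
have p0 : 0 < p.
  rewrite lt_neqAle inner_ge0 andbT eq_sym; apply/eqP => h.
  by move: pt0; rewrite h mul0r ltxx.
have pt0' : 0 < p' * t'.
  have -> : p' * t' = D ^+ 2 + q' ^+ 2 by move: G0 gram'; lra.
  by rewrite ltr_wpDr ?sqr_ge0 // exprn_gt0.
have p'0 : 0 < p'.
  rewrite lt_neqAle -ep inner_ge0 andbT eq_sym; apply/eqP => h.
  by move: pt0'; rewrite -ep h mul0r ltxx.
have t0 : 0 <= t by exact: inner_ge0.
pose T := p + t + 2 * D.
have T0 : 0 < T by rewrite /T; lra.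
have X0 : 0 < p + D by lra.
have X'0 : 0 < p' + D by lra.
have rho : (p + D) ^+ 2 + q ^+ 2 = p * T.
  have -> : (p + D) ^+ 2 + q ^+ 2 = p * T - (p * t - q ^+ 2 - D ^+ 2) by rewrite /T; ring.
  by rewrite G0 subr0.
have rho' : (p' + D) ^+ 2 + q' ^+ 2 = p' * T.
  have -> : (p' + D) ^+ 2 + q' ^+ 2 =
     p' * (p' + t' + 2 * D) - (p' * t' - q' ^+ 2 - D ^+ 2) by ring.
  by rewrite gram' G0 subr0 sum'.
pose psi := polar_arg D x y; pose psi' := polar_arg D x' y'.
have cpsi : cos psi = (p + D) / Num.sqrt (p * T) by rewrite /psi /polar_arg cos_atan_div // rho.
have spsi : sin psi = q / Num.sqrt (p * T) by rewrite /psi /polar_arg sin_atan_div // rho.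
have cpsi' : cos psi' = (p' + D) / Num.sqrt (p' * T).
  by rewrite /psi' /polar_arg ep eq_ cos_atan_div // rho'.
have spsi' : sin psi' = q' / Num.sqrt (p' * T).
  by rewrite /psi' /polar_arg ep eq_ sin_atan_div // rho'.
pose N := T * (Num.sqrt p * Num.sqrt p').
have N0 : 0 < N by rewrite !mulr_gt0 ?sqrtr_gt0.
have eN : (Num.sqrt (p * T))^-1 * (Num.sqrt (p' * T))^-1 = N^-1.
  rewrite -invfM; congr (_^-1); rewrite !sqrtrM ?(ltW p0) ?(ltW p'0) // mulrACA.
  by rewrite -expr2 sqr_sqrtr ?(ltW T0) // /N mulrC.
(* [c^2 + s^2 = 1] and [p t - q^2 = D^2] reduce the numerator *)
have cosa : cos alpha = (c * p + s * q) / (Num.sqrt p * Num.sqrt p').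
  rewrite /alpha -/psi -/psi' cosB cosD sinD cpsi spsi cpsi' spsi' -/c -/s.
  have -> : (c * ((p' + D) / Num.sqrt (p' * T)) - s * (q' / Num.sqrt (p' * T))) *
     ((p + D) / Num.sqrt (p * T)) + (s * ((p' + D) / Num.sqrt (p' * T)) +
     c * (q' / Num.sqrt (p' * T))) * (q / Num.sqrt (p * T)) =
    (c * ((p + D) * (p' + D) + q * q') - s * (q' * (p + D) - (p' + D) * q)) *
    ((Num.sqrt (p * T))^-1 * (Num.sqrt (p' * T))^-1) by ring.
  have -> : c * ((p + D) * (p' + D) + q * q') - s * (q' * (p + D) - (p' + D) * q) =
    T * (c * p + s * q) + (c ^+ 2 + s ^+ 2 - 1) *
      (c * (p ^+ 2 + q ^+ 2) + s * q * (p + t) + D * (c * p + s * q))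
      - c * (p * t - q ^+ 2 - D ^+ 2) by rewrite /T /p' /q'; ring.
  rewrite eN cs G0 subrr mul0r mulr0 subr0 addr0 /N.
  by field; rewrite !gt_eqF ?sqrtr_gt0.
have sina : 0 < sin alpha.
  rewrite /alpha -/psi -/psi' sinB cosD sinD cpsi spsi cpsi' spsi' -/c -/s.
  have -> : (s * ((p' + D) / Num.sqrt (p' * T)) + c * (q' / Num.sqrt (p' * T))) *
     ((p + D) / Num.sqrt (p * T)) - (c * ((p' + D) / Num.sqrt (p' * T)) -
     s * (q' / Num.sqrt (p' * T))) * (q / Num.sqrt (p * T)) =
    (s * ((p + D) * (p' + D) + q * q') + c * (q' * (p + D) - (p' + D) * q)) *
    ((Num.sqrt (p * T))^-1 * (Num.sqrt (p' * T))^-1) by ring.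
  have -> : s * ((p + D) * (p' + D) + q * q') + c * (q' * (p + D) - (p' + D) * q) =
    T * D * s + (c ^+ 2 + s ^+ 2 - 1) *
      (s * D ^+ 2 + s * (p * t - q ^+ 2 - D ^+ 2) + D * (c * q + s * t))
      + s * (p * t - q ^+ 2 - D ^+ 2) by rewrite /T /p' /q'; ring.
  rewrite eN cs G0 subrr mul0r mulr0 !addr0.
  by rewrite mulr_gt0 ?invr_gt0 // !mulr_gt0.
have sq0 : 0 < Num.sqrt p * Num.sqrt p' by rewrite mulr_gt0 ?sqrtr_gt0.
split.
- by rewrite {1}/gram ep eq_ et gram'.
- apply: sin_gt0_itv => //; have /andP[a1 a2] := polar_arg_itv D x y.
  have /andP[b1 b2] := polar_arg_itv D x' y'; case/andP: phi0 => f1 f2.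
  rewrite /alpha; apply/andP; split; lra.
- rewrite /vangle exx' cosa normf_div (gtr0_norm sq0).
  by rewrite /enorm ep.
- by rewrite cosa exx' pmulr_lge0 // invr_gt0.
- by rewrite cosa exx' pmulr_lle0 // invr_gt0.
Qed.

(** Angle sums along an elliptic orbit: the increments of [polar_arg] telescope,
    so that the oriented angles add up to [n * phi] within [pi]. The angle of the
    lines is the oriented angle [alpha] or [pi - alpha], according to the sign of
    the inner product of successive iterates. *)
Lemma orbit_sum_rotation m (B : 'M[R]_m) (w : 'cV[R]_m) (phi : R) : w != 0 ->
  0 < phi < pi ->
  B *m (B *m w) = (2 * cos phi) *: (B *m w) - w ->
  [/\ forall n, orbit_sum B n w <= n%:R * Num.min phi (pi - phi) + pi,
      (forall j, 0 <= inner (B ^+ j *m w) (B ^+ j.+1 *m w)) ->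
        forall n, n%:R * phi - pi <= orbit_sum B n w &
      (forall j, inner (B ^+ j *m w) (B ^+ j.+1 *m w) <= 0) ->
        forall n, n%:R * (pi - phi) - pi <= orbit_sum B n w].
Proof.
move=> w0 phi0 hB; have sphi : 0 < sin phi by apply: sin_gt0_pi.
pose x j := B ^+ j *m w.
(* the second vector of the frame: [B x = cos phi x + sin phi y] *)
pose y j := (sin phi)^-1 *: (B *m x j - cos phi *: x j).
have xB j : x j.+1 = B *m x j by exact: expmxSl.
have xS j : x j.+1 = cos phi *: x j + sin phi *: y j.
  by rewrite xB /y scalerA mulfV ?gt_eqF // scale1r addrCA subrr addr0.
have BB j : B *m (B *m x j) = (2 * cos phi) *: (B *m x j) - x j.
  have cB (v : 'cV[R]_m) : B *m (B ^+ j *m v) = B ^+ j *m (B *m v).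
    by rewrite -expmxSl exprSr -[_ * B]/(_ *m B) mulmxA.
  by rewrite /x !cB hB mulmxBr -scalemxAr.
have yS j : y j.+1 = cos phi *: y j - sin phi *: x j.
  have -> : y j.+1 = (sin phi)^-1 *: (cos phi *: (B *m x j) - x j).
    rewrite /y xB BB; congr (_ *: _).
    rewrite addrAC -scalerBl; congr (_ *: _ - _); ring.
  have -> : B *m x j = cos phi *: x j + sin phi *: y j by rewrite -xS xB.
  have sc : sin phi ^+ 2 = 1 - cos phi ^+ 2 by exact: sin2cos2.
  apply: (scalerI (lt0r_neq0 sphi)); rewrite scalerA mulfV ?gt_eqF // scale1r.
  move: (x j) (y j) => u v; apply/matrixP => i k; rewrite !mxE; ring: sc.
have [D D0 DG] : exists2 D, 0 < D & D ^+ 2 = gram (x 0%N) (y 0%N).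
  exists (Num.sqrt (gram (x 0%N) (y 0%N))); last first.
    by rewrite sqr_sqrtr // subr_ge0 cauchy_schwarz_sqr.
  rewrite sqrtr_gt0 lt_neqAle subr_ge0 cauchy_schwarz_sqr andbT eq_sym.
  apply/eqP => g0; have x00 : x 0%N = w by rewrite /x expr0 mul1mx.
  have p0 : 0 < inner w w by rewrite inner_gt0.
  set p := inner w w in p0; pose q := inner w (y 0%N).
  have z0 : p *: y 0%N = q *: w by have := gram_eq0 g0; rewrite x00.
  pose k := q / p.
  have yk : y 0%N = k *: w.
    apply: (scalerI (lt0r_neq0 p0)); rewrite [RHS]scalerA /k mulrCA mulfV ?gt_eqF // mulr1.
    exact: z0.
  (* [y] parallel to [x] would give a real root [mu] of [X^2 - 2 cos phi X + 1] *)
  pose mu := cos phi + sin phi * k.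
  have Bw : B *m w = mu *: w.
    by have := xS 0%N; rewrite yk x00 /x expr1 scalerA -scalerDl.
  have := hB; rewrite !Bw -scalemxAr Bw !scalerA => /eqP.
  rewrite -[X in _ - X]scale1r -scalerBl -subr_eq0 -scalerBl scaler_eq0 (negbTE w0) orbF.
  have -> : mu * mu - (2 * cos phi * mu - 1) = (mu - cos phi) ^+ 2 + sin phi ^+ 2.
    by rewrite sin2cos2; ring.
  by rewrite gt_eqF // ltr_wpDl ?sqr_ge0 // exprn_gt0.
pose psi j := polar_arg D (x j) (y j).
have gj j : D ^+ 2 = gram (x j) (y j).
  elim: j => // j IH; have [g _ _ _ _] := plane_step phi0 D0 IH.
  by rewrite xS yS g.
have step j : exists alpha, [/\ alpha = phi + psi j.+1 - psi j, 0 < alpha < pi,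
    vangle (x j) (x j.+1) = acos `|cos alpha|,
    (0 <= cos alpha) = (0 <= inner (x j) (x j.+1)) &
    (cos alpha <= 0) = (inner (x j) (x j.+1) <= 0)].
  have [_ h1 h2 h3 h4] := plane_step phi0 D0 (gj j).
  by exists (phi + psi j.+1 - psi j); rewrite /psi xS yS.
have psi_sum n : \sum_(j < n) (psi j.+1 - psi j) = psi n - psi 0%N.
  elim: n => [|n IH]; first by rewrite big_ord0 subrr.
  by rewrite big_ord_recr /= IH addrC addrA subrK.
have psi_itv n : - pi < psi n - psi 0%N < pi.
  have /andP[a1 a2] := polar_arg_itv D (x n) (y n).
  have /andP[b1 b2] := polar_arg_itv D (x 0%N) (y 0%N).
  rewrite /psi; apply/andP; split; lra.
have const n (c : R) : \sum_(j < n) c = n%:R * c.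
  by rewrite sumr_const card_ord mulr_natl.
have alpha_sum n : \sum_(j < n) (phi + (psi j.+1 - psi j)) = n%:R * phi + (psi n - psi 0%N).
  by rewrite big_split /= psi_sum const.
have beta_sum n : \sum_(j < n) (pi - (phi + (psi j.+1 - psi j)))
    = n%:R * (pi - phi) - (psi n - psi 0%N).
  by rewrite sumrB const alpha_sum; ring.
split.
- move=> n; have /andP[p1 p2] := psi_itv n.
  have h1 : orbit_sum B n w <= n%:R * phi + pi.
    apply: (@le_trans _ _ (\sum_(j < n) (phi + (psi j.+1 - psi j)))); last first.
      rewrite alpha_sum; lra.
    apply: ler_sum => j _; have [alpha [ea /andP[a0 ap] -> _ _]] := step j.
    rewrite addrA -ea; apply: (acos_norm_cos_le _).1.
    by rewrite !ltW.
  have h2 : orbit_sum B n w <= n%:R * (pi - phi) + pi.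
    apply: (@le_trans _ _ (\sum_(j < n) (pi - (phi + (psi j.+1 - psi j))))); last first.
      rewrite beta_sum; lra.
    apply: ler_sum => j _; have [alpha [ea /andP[a0 ap] -> _ _]] := step j.
    rewrite addrA -ea; apply: (acos_norm_cos_le _).2.
    by rewrite !ltW.
  by rewrite /Num.min; case: ifP.
- move=> hpos n; have /andP[p1 p2] := psi_itv n.
  apply: (@le_trans _ _ (\sum_(j < n) (phi + (psi j.+1 - psi j)))).
    rewrite alpha_sum; lra.
  apply: ler_sum => j _; have [alpha [ea /andP[a0 ap] -> hc _]] := step j.
  have c0 : 0 <= cos alpha by rewrite hc hpos.
  by rewrite addrA -ea ger0_norm // cosK // in_itv /= !ltW.
- move=> hneg n; have /andP[p1 p2] := psi_itv n.
  apply: (@le_trans _ _ (\sum_(j < n) (pi - (phi + (psi j.+1 - psi j))))).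
    rewrite beta_sum; lra.
  apply: ler_sum => j _; have [alpha [ea /andP[a0 ap] -> _ hc]] := step j.
  have c0 : cos alpha <= 0 by rewrite hc hneg.
  by rewrite addrA -ea ler0_norm // acosN ?cosK ?in_itv /= ?cos_geN1 ?cos_le1 // !ltW.
Qed.
End PlaneRotation.

(** * Invariant blocks *)

Section Blocks.
Context {R : realType}.
Local Notation C := R[i].

Lemma eigenvalue_unit (F : fieldType) m (M : 'M[F]_m) z :
  eigenvalue M z = (M - z%:M \notin unitmx).
Proof. by rewrite -row_free_unit -kermx_eq0. Qed.

Lemma eigenvalue_colP (F : fieldType) m (M : 'M[F]_m) z :
  reflect (exists2 x : 'cV[F]_m, M *m x = z *: x & x != 0) (eigenvalue M z).
Proof.
have -> : eigenvalue M z = eigenvalue M^T z.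
  by rewrite !eigenvalue_unit -unitmx_tr linearB /= tr_scalar_mx.
apply: (iffP eigenvalueP) => [[v hv v0]|[x hx x0]].
  exists v^T; last by rewrite trmx_eq0.
  by rewrite -[M]trmxK -trmx_mul hv linearZ.
by exists x^T; [rewrite -trmx_mul hx linearZ | rewrite trmx_eq0].
Qed.

(** An isometric embedding intertwining [A] and [B]. *)
Definition intertwines m n (A : 'M[R]_m) (Q : 'M[R]_(m, n)) (B : 'M[R]_n) : Prop :=
  Q^T *m Q = 1%:M /\ A *m Q = Q *m B.

Section Intertwiner.
Variables (m n : nat) (A : 'M[R]_m) (Q : 'M[R]_(m, n)) (B : 'M[R]_n).
Hypothesis AQB : intertwines A Q B.

Lemma intertwines_inj (x : 'cV[R]_n) : Q *m x = 0 -> x = 0.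
Proof. by move=> h; rewrite -(mul1mx x) -AQB.1 -mulmxA h mulmx0. Qed.

Lemma intertwines_exp j (x : 'cV[R]_n) : A ^+ j *m (Q *m x) = Q *m (B ^+ j *m x).
Proof.
elim: j => [|j IH]; first by rewrite !expr0 !mul1mx.
by rewrite !expmxSl IH !mulmxA AQB.2.
Qed.

Lemma intertwines_inner (x y : 'cV[R]_n) : inner (Q *m x) (Q *m y) = inner x y.
Proof. by rewrite /inner trmx_mul -mulmxA (mulmxA Q^T) AQB.1 mul1mx. Qed.

Lemma intertwines_orbit_sum k (x : 'cV[R]_n) :
  orbit_sum A k (Q *m x) = orbit_sum B k x.
Proof.
apply: eq_bigr => j _.
by rewrite !intertwines_exp /vangle /enorm !intertwines_inner.
Qed.

Lemma intertwines_unit : A \in unitmx -> B \in unitmx.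
Proof.
move=> Au; suff : (Q^T *m invmx A *m Q) *m B = 1%:M by case/mulmx1_unit.
by rewrite -mulmxA -AQB.2 -!mulmxA (mulmxA (invmx A)) mulVmx // mul1mx AQB.1.
Qed.

Lemma intertwines_prod (s : seq C) (x : 'cV[R]_n) :
  \prod_(z <- s) (toC A - z%:M) *m toCv (Q *m x) =
  map_mx (real_complex R) Q *m (\prod_(z <- s) (toC B - z%:M) *m toCv x).
Proof.
rewrite toCv_mulmx; set QC := map_mx _ Q; rewrite !mulmxA; congr (_ *m _).
have hQ : toC A *m QC = QC *m toC B by rewrite -!map_mxM AQB.2.
elim: s => [|z s IH]; first by rewrite !big_nil mul1mx mulmx1.
rewrite !big_cons -[_ * _ in LHS]/(_ *m _) -mulmxA IH mulmxA.
rewrite mulmxBl hQ mul_scalar_mx -[_ * _ in RHS]/(_ *m _) [RHS]mulmxA mulmxBr.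
by rewrite -mul_mx_scalar.
Qed.

End Intertwiner.

Section Decomposition.
Variables (m : nat) (A : 'M[R]_m) (k : nat) (dim : 'I_k -> nat)
  (Q : forall i, 'M[R]_(m, dim i)) (B : forall i, 'M[R]_(dim i)).
Hypothesis dec : modulus_decomposition A Q B.

Lemma decomposition_intertwines i : intertwines A (Q i) (B i).
Proof. by case: dec => h _ _ h' _; split; [case: (h i) | exact: h']. Qed.

Lemma decomposition_dim_gt0 i : (0 < dim i)%N.
Proof. by case: dec => h _ _ _ _; case: (h i). Qed.

Lemma decomposition_span (w : 'cV[R]_m) :
  exists x : forall i, 'cV[R]_(dim i), w = \sum_i Q i *m x i.
Proof.
case: dec => _ _ full _ _; have : w \in (\sum_i mxrange (Q i))%VS by rewrite full memvf.
case/memv_sumP => v hv ->.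
have h i : exists x : 'cV[R]_(dim i), v i = Q i *m x.
  by have /memv_imgP[x _ ->] := hv i isT; exists x; rewrite lfunE.
exists (fun i => projT1 (cid (h i))).
by apply: eq_bigr => i _; case: (cid (h i)).
Qed.

Lemma decomposition_free (x : forall i, 'cV[R]_(dim i)) :
  \sum_i Q i *m x i = 0 -> forall i, x i = 0.
Proof.
case: dec => _ /directv_sum_independent dir _ _ _ h i.
apply: (intertwines_inj (decomposition_intertwines i)).
apply: (dir (fun i => Q i *m x i)) => // j _.
by rewrite -[_ *m _](lfunE (mulmx (Q j))) memv_img ?memvf.
Qed.

Lemma decomposition_free_complex (x : forall i, 'cV[C]_(dim i)) :
  \sum_i map_mx (real_complex R) (Q i) *m x i = 0 -> forall i, x i = 0.
Proof.
move=> h i; pose re i := map_mx (@complex.Re R) (x i).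
pose im i := map_mx (@complex.Im R) (x i).
have hre : \sum_i Q i *m re i = 0.
  apply/matrixP => a b; have e := congr1 (fun M : 'M[C]_(m, 1) => complex.Re (M a b)) h.
  rewrite /= summxE Re_sum mxE /= in e; rewrite summxE [RHS]mxE -[RHS]e.
  apply: eq_bigr => j _.
  rewrite !mxE Re_sum; apply: eq_bigr => c _; rewrite !mxE.
  by case: (x j c b) => u v /=; rewrite mul0r subr0.
have him : \sum_i Q i *m im i = 0.
  apply/matrixP => a b; have e := congr1 (fun M : 'M[C]_(m, 1) => complex.Im (M a b)) h.
  rewrite /= summxE Im_sum mxE /= in e; rewrite summxE [RHS]mxE -[RHS]e.
  apply: eq_bigr => j _.
  rewrite !mxE Im_sum; apply: eq_bigr => c _; rewrite !mxE.
  by case: (x j c b) => u v /=; rewrite mul0r addr0.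
apply/matrixP => a b; apply/eqP; rewrite eq_complex mxE /=.
have /matrixP/(_ a b) := decomposition_free hre i; rewrite !mxE => ->.
have /matrixP/(_ a b) := decomposition_free him i; rewrite !mxE => ->.
by rewrite !eqxx.
Qed.

(** A vector killed by factors [A - z] of one modulus lies in a single block: its
    component in any other block is killed by an invertible matrix. *)
Lemma decomposition_block (s : seq C) (r : R) (w : 'cV[R]_m) :
  (forall z, z \in s -> cmod z = r) -> w != 0 ->
  \prod_(z <- s) (toC A - z%:M) *m toCv w = 0 ->
  exists i (x : 'cV[R]_(dim i)), x != 0 /\ w = Q i *m x.
Proof.
move=> sr w0 hw; have [x wE] := decomposition_span w.
have hx i : \prod_(z <- s) (toC (B i) - z%:M) *m toCv (x i) = 0.
  move: i; apply: decomposition_free_complex; rewrite -[RHS]hw wE.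
  have -> : toCv (\sum_i Q i *m x i) = \sum_i toCv (Q i *m x i).
    by rewrite /toCv raddf_sum.
  rewrite mulmx_sumr; apply: eq_bigr => i _.
  by rewrite (intertwines_prod (decomposition_intertwines i)).
case: dec => _ _ _ _ [rho rho_inj hrho].
have x0 i : rho i != r -> x i = 0.
  move=> ri; have u : \prod_(z <- s) (toC (B i) - z%:M) \in unitmx.
    rewrite big_seq; elim/big_ind : _ => [|a b ua ub|z zs]; first exact: unitmx1.
      by rewrite unitmx_mul ua.
    rewrite -[_ \in _]negbK -eigenvalue_unit; apply/negP => ez.
    by move/eqP: ri; apply; rewrite -(sr z zs) (hrho i z).
  by apply/eqP; rewrite -toCv_eq0 -(mul1mx (toCv _)) -(mulVmx u) -mulmxA hx mulmx0.
have [i0 /eqP ri0|none] := pickP (fun i => rho i == r).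
  exists i0, (x i0); suff e : w = Q i0 *m x i0.
    by split=> //; apply: contraNneq w0 => h; rewrite e h mulmx0.
  rewrite wE (bigD1 i0) //= big1 ?addr0 // => i ii0.
  by rewrite x0 ?mulmx0 // -ri0 (inj_eq rho_inj).
case/eqP: w0; rewrite wE big1 // => i _.
by rewrite x0 ?mulmx0 // none.
Qed.

End Decomposition.

Lemma le_of_linear (a b K : R) : (forall j : nat, j%:R * a <= j%:R * b + K) -> a <= b.
Proof.
move=> h; rewrite leNgt; apply/negP => ab; have ab0 : 0 < a - b by rewrite subr_gt0.
have [N /(_ N (leqnn N)) hN] := natmul_large (K + 1) ab0.
have := h N; lra.
Qed.

Lemma slope_ge m (A : 'M[R]_m) t (w : 'cV[R]_m) c K : is_slope A t -> w != 0 ->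
  (forall j, j%:R * c - K <= orbit_sum A j w) -> c <= t.
Proof.
move=> [h1 _] w0 h; apply/ler_addgt0Pr => e e0; have [K' hK'] := h1 e e0.
apply: (@le_of_linear _ _ (K + K')) => j; have := h j; have := hK' w w0 j; lra.
Qed.

Lemma slope_ge0 m (A : 'M[R]_m) t : is_slope A t -> 0 <= t.
Proof.
move=> ht; have [K [s [r [w [_ _ w0 _ _]]]]] := ht.2 1 ltr01.
apply: (slope_ge (K := 0) ht w0) => j; rewrite mulr0 subr0.
by case/andP: (orbit_sum_itv A j w).
Qed.

(** An upper bound for the slope only needs to be checked on the sums of the
    eigenspaces of one modulus. *)
Lemma slope_le m (A : 'M[R]_m) t c : is_slope A t ->
  (forall (s : seq C) (r : R) (w : 'cV[R]_m), uniq s ->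
     (forall z, z \in s -> eigenvalue (toC A) z /\ cmod z = r) -> w != 0 ->
     \prod_(z <- s) (toC A - z%:M) *m toCv w = 0 ->
     exists K, forall j, orbit_sum A j w <= j%:R * c + K) -> t <= c.
Proof.
move=> ht h; apply/ler_addgt0Pr => e e0.
have [K [s [r [w [us hs w0 hw hj]]]]] := ht.2 e e0.
have [K' hK'] := h s r w us hs w0 hw.
suff : t - e <= c by lra.
apply: (@le_of_linear _ _ (K + K')) => j; have := hj 0%N j; have := hK' j.
rewrite expr0 mul1mx; lra.
Qed.

End Blocks.

(** * Arguments of eigenvalues *)

Section Arguments.
Context {R : realType}.
Local Notation C := R[i].

Lemma Re_div_cmod_itv (l : C) : -1 <= complex.Re l / cmod l <= 1.
Proof.
have [->|l0] := eqVneq l 0; first by rewrite mul0r; apply/andP; split; lra.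
rewrite -ler_norml normf_div (ger0_norm (cmod_ge0 l)) ler_pdivrMr ?cmod_gt0 //.
by rewrite mul1r cmod_Re.
Qed.

Lemma norm_carg (l : C) : `|carg l| = acos (complex.Re l / cmod l).
Proof.
have h := acos_ge0 (Re_div_cmod_itv l).
by rewrite /carg; case: ifP => _; rewrite ?normrN ger0_norm.
Qed.

Lemma line_argE (l : C) : line_arg l =
  Num.min (acos (complex.Re l / cmod l)) (pi - acos (complex.Re l / cmod l)).
Proof. by rewrite /line_arg norm_carg. Qed.

Lemma line_arg_ge0 (l : C) : 0 <= line_arg l.
Proof.
rewrite line_argE le_min acos_ge0 ?Re_div_cmod_itv //= subr_ge0.
exact: acos_lepi (Re_div_cmod_itv l).
Qed.

Lemma line_arg_le_max m (A : 'M[R]_m) (l : C) : spectrum A l ->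
  line_arg l <= max_line_arg A.
Proof.
move=> h; apply: ub_le_sup; last by exists l.
exists pi => _ [z _ <-]; rewrite line_argE ge_min; apply/orP; left.
exact: acos_lepi (Re_div_cmod_itv z).
Qed.

Lemma eigenvalue_real m (A : 'M[R]_m) (x : R) :
  eigenvalue (toC A) (real_complex R x) = eigenvalue A x.
Proof.
by rewrite !eigenvalue_root_char /toC -map_char_poly fmorph_root.
Qed.

Lemma orbit_sum_scale m (A : 'M[R]_m) (c : R) n (w : 'cV[R]_m) : c != 0 ->
  orbit_sum (c *: A) n w = orbit_sum A n w.
Proof.
move=> c0; have e j : (c *: A) ^+ j *m w = c ^+ j *: (A ^+ j *m w).
  elim: j => [|j IH]; first by rewrite !expr0 scale1r.
  by rewrite !expmxSl IH -scalemxAl -scalemxAr scalerA exprS.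
by apply: eq_bigr => j _; rewrite !e vangleZ ?expf_neq0.
Qed.

Lemma orbit_sum_eigen m (A : 'M[R]_m) (x : R) n (w : 'cV[R]_m) : x != 0 ->
  w != 0 -> A *m w = x *: w -> orbit_sum A n w = 0.
Proof.
move=> x0 w0 hw; have e j : A ^+ j *m w = x ^+ j *: w.
  elim: j => [|j IH]; first by rewrite expr0 mul1mx scale1r.
  by rewrite expmxSl IH -scalemxAr hw scalerA exprSr.
rewrite /orbit_sum big1 // => j _; rewrite !e vangleZ ?expf_neq0 //.
rewrite /vangle -expr2 enorm_sqr ger0_norm ?inner_ge0 // divff ?acos1 //.
by rewrite inner_eq0.
Qed.

(** Eigenvectors of equal norm for [y] and [- y] have perpendicular sum and
    difference, so their sum is turned by a right angle at each step. *)
Lemma slope_opposite m (A : 'M[R]_m) t : is_slope A t ->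
  opposite_real_eigenvalues A -> t = pi / 2.
Proof.
move=> ht [x [y [/andP[x0 y0] xy hx hy]]].
have {xy} xE : x = - y by move: xy; rewrite ltr0_norm // gtr0_norm // => <-; rewrite opprK.
have ev z : spectrum A (real_complex R z) ->
    exists2 v : 'cV[R]_m, A *m v = z *: v & enorm v = 1.
  rewrite /spectrum /= eigenvalue_real => /eigenvalue_colP[v hv v0].
  exists ((enorm v)^-1 *: v); last exact: enorm_normalize.
  by rewrite -!scalemxAr hv scalerA mulrC -scalerA.
have [u hu nu] := ev _ hy; have [v hv nv] := ev _ hx.
have w0 : u + v != 0.
  apply/eqP => /eqP; rewrite addr_eq0 => /eqP uv.
  have : (y - x) *: u = 0.
    by rewrite scalerBl -hu {2}uv scalerN -hv -mulmxN -uv subrr.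
  move/eqP; rewrite scaler_eq0 -[u == 0]negbK -enorm_gt0 nu ltr01 orbF subr_eq0.
  by rewrite gt_eqF // (lt_trans x0).
have eu j : A ^+ j *m u = y ^+ j *: u.
  elim: j => [|j IH]; first by rewrite expr0 mul1mx scale1r.
  by rewrite expmxSl IH -scalemxAr hu scalerA exprSr.
have ev' j : A ^+ j *m v = x ^+ j *: v.
  elim: j => [|j IH]; first by rewrite expr0 mul1mx scale1r.
  by rewrite expmxSl IH -scalemxAr hv scalerA exprSr.
have nu2 : inner u u = 1 by rewrite -enorm_sqr nu expr1n.
have nv2 : inner v v = 1 by rewrite -enorm_sqr nv expr1n.
have S n : orbit_sum A n (u + v) = n%:R * (pi / 2).
  rewrite mulr_natl -[X in _ *+ X]card_ord -sumr_const; apply: eq_bigr => j _.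
  rewrite /vangle !mulmxDr !eu !ev'.
  rewrite !innerDl !innerDr !innerZl !innerZr nu2 nv2 (innerC v u).
  have -> : y ^+ j * (y ^+ j.+1 * 1) + y ^+ j * (x ^+ j.+1 * inner u v)
    + (x ^+ j * (y ^+ j.+1 * inner u v) + x ^+ j * (x ^+ j.+1 * 1)) = 0.
    rewrite !exprS xE exprNn.
    have := sqrr_sign R j; rewrite expr2; move: ((-1) ^+ j) => sg e.
    ring: e.
  by rewrite normr0 mul0r acos0.
apply/eqP; rewrite eq_le; apply/andP; split.
  apply: (slope_le ht) => s r w _ _ _ _; exists 0 => j.
  by rewrite addr0; case/andP: (orbit_sum_itv A j w).
by apply: (slope_ge (K := 0) ht w0) => j; rewrite S subr0.
Qed.

Lemma conjc_sum_prod (l : C) : l + conjc l = real_complex R (2 * complex.Re l) /\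
  l * conjc l = real_complex R (cmod l ^+ 2).
Proof.
rewrite cmod_sqr; case: l => a b /=; split; apply/eqP; rewrite eq_complex /=.
  by apply/andP; split; apply/eqP; ring.
by apply/andP; split; apply/eqP; ring.
Qed.

Lemma real_quadratic m (A : 'M[R]_m) (l : C) (w : 'cV[R]_m) :
  (toC A - (conjc l)%:M) *m ((toC A - l%:M) *m toCv w) = 0 ->
  A *m (A *m w) = (2 * complex.Re l) *: (A *m w) - (cmod l ^+ 2) *: w.
Proof.
have [e1 e2] := conjc_sum_prod l.
rewrite !mulmxBl !mul_scalar_mx mulmxBr scalerBr -scalemxAr scalerA.
rewrite opprB addrCA -addrA [conjc l * l]mulrC e2 => h.
apply: (@map_mx_inj _ _ (real_complex R)).
rewrite map_mxB !map_mxZ /= -e1 !map_mxM /= -/(toC A) -/(toCv w).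
apply/eqP; rewrite -subr_eq0 -[X in _ == X]h; apply/eqP.
rewrite scalerDl; move: (toC A *m (toC A *m toCv w)) (toC A *m toCv w) (toCv w) => a b c.
by apply/matrixP => i j; rewrite !mxE; ring.
Qed.

Lemma scaled_rotation m (A : 'M[R]_m) (l : C) (w : 'cV[R]_m) : l != 0 ->
  A *m (A *m w) = (2 * complex.Re l) *: (A *m w) - (cmod l ^+ 2) *: w ->
  let B := (cmod l)^-1 *: A in
  B *m (B *m w) = (2 * cos (acos (complex.Re l / cmod l))) *: (B *m w) - w.
Proof.
move=> l0 h B; have c0 : cmod l != 0 by rewrite cmod_eq0.
rewrite acosK ?in_itv /= ?Re_div_cmod_itv // /B -!scalemxAl -!scalemxAr h.
rewrite !scalerBr !scalerA; congr (_ *: _ - _); first by field.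
by rewrite -[RHS]scale1r; congr (_ *: _); field.
Qed.

Lemma acos_nonreal (l : C) : complex.Im l != 0 ->
  0 < acos (complex.Re l / cmod l) < pi.
Proof.
move=> b0; have l0 : l != 0 by apply: contraNneq b0 => ->.
have c0 : 0 < cmod l by rewrite cmod_gt0.
have : `|complex.Re l| < cmod l.
  rewrite -(@ltr_pXn2r _ 2) ?nnegrE ?cmod_ge0 // real_normK ?num_real // cmod_sqr.
  by rewrite ltrDl exprn_even_gt0.
rewrite ltr_norml => /andP[h1 h2].
have /andP[g1 g2] := Re_div_cmod_itv l.
apply/andP; split.
  by apply: acos_gt0; rewrite g1 ltr_pdivrMr // mul1r.
by apply: acos_ltpi; rewrite g2 andbT ltr_pdivlMr // mulN1r.
Qed.

(** Without opposite real eigenvalues, a vector of the eigenspaces of one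
    modulus is a real eigenvector, whose line is fixed, or lies in the plane of
    a conjugate pair, on which a multiple of [A] is a linear rotation. *)
Lemma slope_le_max_line_arg m (A : 'M[R]_m) t : A \in unitmx -> is_slope A t ->
  nonreal_simple_isolated A -> ~ opposite_real_eigenvalues A ->
  t <= max_line_arg A.
Proof.
move=> Au ht iso nop; apply: (slope_le ht) => s r w us hs w0 hw.
have [/hasP[l ls /= bl]|/hasPn real] := boolP (has (fun z => complex.Im z != 0) s).
  have [el rl] := hs l ls; have l0 : l != 0 by apply: contraNneq bl => ->.
  have sub z : z \in s -> z \in [:: l; conjc l].
    move=> zs; have [ez rz] := hs z zs; rewrite !inE; apply/orP.
    have [->|zl] := eqVneq z l; [by left|right].
    apply/negPn/negP => zl'; have [_ /(_ z ez)] := iso l el bl.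
    by move=> /(_ (elimN eqP zl) (elimN eqP zl')); rewrite rz rl; apply.
  have lc : l != conjc l.
    apply: contraNneq bl => /(congr1 (@complex.Im R)); case: (l) => a b /= h.
    by apply/eqP; lra.
  have quad : (toC A - (conjc l)%:M) *m ((toC A - l%:M) *m toCv w) = 0.
    case: m A w Au ht iso nop hs w0 hw el sub {rl} => [|m] A w Au ht iso nop hs w0 hw el sub.
      by rewrite flatmx0.
    have dvd : (\prod_(z <- s) ('X - z%:P) %| ('X - (conjc l)%:P) * ('X - l%:P))%R.
      apply: uniq_roots_dvdp; last by rewrite uniq_rootsE.
      apply/allP => z /sub; rewrite !inE rootM !root_XsubC.
      by case/orP => /eqP->; rewrite eqxx ?orbT.
    case/dvdpP: dvd => q /(congr1 (fun p => horner_mx (toC A) p *m toCv w)).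
    rewrite !rmorphM /= rmorph_prod /= !horner_mx_XsubC -!mulmxA => ->.
    under eq_bigr do rewrite horner_mx_XsubC.
    by rewrite hw mulmx0.
  have := scaled_rotation l0 (real_quadratic quad).
  set B := _ *: A => hB.
  have [up _ _] := orbit_sum_rotation w0 (acos_nonreal bl) hB.
  exists pi => j; have := up j; rewrite orbit_sum_scale ?invr_eq0 ?cmod_eq0 // -line_argE => h.
  apply: le_trans h _; rewrite lerD2r ler_wpM2l //.
  exact: line_arg_le_max.
exists 0 => j; rewrite addr0.
case: s us hs hw real => [|z s'] us hs hw real.
  by move: hw; rewrite big_nil mul1mx => /eqP; rewrite toCv_eq0 (negbTE w0).
have [ez rz] := hs z (mem_head _ _).
have realE z' : z' \in z :: s' -> z' = real_complex R (complex.Re z').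
  move=> /real; rewrite negbK; case: z' => a b /= /eqP->; by [].
have z0 : complex.Re z != 0.
  apply: contraTneq ez => h; rewrite (realE z (mem_head _ _)) h eigenvalue_real.
  by rewrite eigenvalue_unit negbK raddf0 subr0.
have s'0 : s' = [::].
  case: s' us hs real realE {hw} => // z' s'' /= us hs real realE; exfalso.
  have [ez' rz'] : eigenvalue (toC A) z' /\ cmod z' = r.
    by apply: hs; rewrite !inE eqxx orbT.
  have zz' : z != z' by move: us; rewrite inE negb_or => /andP[/andP[]].
  have hz := realE z (mem_head _ _).
  have hz' : z' = real_complex R (complex.Re z') by apply: realE; rewrite !inE eqxx orbT.
  move: ez ez' rz rz' zz' z0; rewrite hz hz'; move: (complex.Re z) (complex.Re z') => a b.
  rewrite !cmod_real => ea eb ra rb ab /= a0.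
  have abn : `|a| = `|b| by rewrite ra.
  have abE : b = - a.
    move/eqP: abn; rewrite eqr_norm2 => /orP[/eqP e|/eqP ->]; last by rewrite opprK.
    by rewrite e eqxx in ab.
  apply: nop; have [a1|a1|a1] := ltgtP a 0; last by rewrite a1 eqxx in a0.
    by exists a, b; split; [rewrite a1 abE oppr_gt0 | exact: abn | exact: ea | exact: eb].
  exists b, a; split; [by rewrite a1 andbT abE oppr_lt0 | | exact: eb | exact: ea].
  exact: esym abn.
have Aw : A *m w = complex.Re z *: w.
  apply: (@map_mx_inj _ _ (real_complex R)); apply/eqP; rewrite -subr_eq0; apply/eqP.
  move: hw; rewrite s'0 big_seq1 mulmxBl mul_scalar_mx {1}(realE z (mem_head _ _)).
  by rewrite map_mxM map_mxZ.
rewrite (orbit_sum_eigen j z0 w0 Aw) mulr_ge0 //.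
exact: le_trans (line_arg_ge0 z) (line_arg_le_max ez).
Qed.

End Arguments.

(** * Skewness *)

Section Skewness.
Context {R : realType}.
Local Notation C := R[i].

Lemma spectral_norm_bound m n (M : 'M[R]_(m, n)) (x : 'cV[R]_n) :
  enorm (M *m x) <= spectral_norm M * enorm x.
Proof.
have [->|x0] := eqVneq x 0.
  have n0 k : enorm (0 : 'cV[R]_k) = 0 by rewrite -(scale0r 0) enormZ normr0 mul0r.
  by rewrite mulmx0 !n0 mulr0.
have nx : 0 < enorm x by rewrite enorm_gt0.
have [K K0 hK] := enorm_mulmx M.
have : enorm (M *m ((enorm x)^-1 *: x)) <= spectral_norm M.
  apply: ub_le_sup; last first.
    by exists ((enorm x)^-1 *: x) => //=; rewrite enorm_normalize.
  exists K => _ [y /= y1 <-]; apply: le_trans (hK y) _.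
  by rewrite ger_pMr.
rewrite -scalemxAr enormZ gtr0_norm ?invr_gt0 // => h.
by rewrite -ler_pdivrMr // mulrC.
Qed.

(** A real inequality behind the skewness criterion: [4 (p t - q^2)(p^2 + q^2)]
    is at most [(p (p + t))^2], by the arithmetic-geometric mean inequality. *)
Lemma skew_sign (c s p q t : R) : c ^+ 2 + s ^+ 2 = 1 -> 0 < p -> 0 <= t ->
  s ^+ 2 * (p + t) ^+ 2 <= 4 * (p * t - q ^+ 2) -> 0 <= c -> 0 <= c * p + s * q.
Proof.
move=> cs p0 t0 h c0; rewrite leNgt; apply/negP => neg.
have u0 : 0 <= c * p by rewrite mulr_ge0 // ltW.
have h1 : (c * p) ^+ 2 < (s * q) ^+ 2.
  rewrite -[X in _ < X]sqrrN ltr_pXn2r ?nnegrE //; lra.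
have h2 : p ^+ 2 < s ^+ 2 * (p ^+ 2 + q ^+ 2).
  have : c ^+ 2 = 1 - s ^+ 2 by move: cs; lra.
  by move: h1; rewrite !exprMn => + e; rewrite e; lra.
have pt : 0 < (p + t) ^+ 2 by rewrite exprn_gt0 // ltr_wpDr.
have pq : 0 < p ^+ 2 + q ^+ 2 by rewrite ltr_wpDr ?sqr_ge0 // exprn_gt0.
have h3 : p ^+ 2 * (p + t) ^+ 2 < s ^+ 2 * (p ^+ 2 + q ^+ 2) * (p + t) ^+ 2.
  by rewrite ltr_pM2r.
have h4 : s ^+ 2 * (p + t) ^+ 2 * (p ^+ 2 + q ^+ 2) <=
    4 * (p * t - q ^+ 2) * (p ^+ 2 + q ^+ 2) by rewrite ler_pM2r.
have h5 : 0 <= (p * t - q ^+ 2 - (p ^+ 2 + q ^+ 2)) ^+ 2 by exact: sqr_ge0.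
have h6 : 4 * (p * t - q ^+ 2) * (p ^+ 2 + q ^+ 2) =
   p ^+ 2 * (p + t) ^+ 2 - (p * t - q ^+ 2 - (p ^+ 2 + q ^+ 2)) ^+ 2 by ring.
lra.
Qed.

(** In the plane of a conjugate pair with modulus [r] and argument [phi], the sign
    of [inner x (B x)] is that of [cos phi] once [B - B^T] has norm at most [2 r].
    Testing [B - B^T] on [x] and on the part [z] of [y] orthogonal to [x] gives
    the area inequality required by [skew_sign]. *)
Lemma skew_inner_sign m (B : 'M[R]_m) (r phi : R) (x : 'cV[R]_m) : 0 < r ->
  0 < phi < pi -> spectral_norm (B - B^T) <= 2 * r ->
  B *m (B *m x) = (2 * (r * cos phi)) *: (B *m x) - (r ^+ 2) *: x ->
  (0 <= cos phi -> 0 <= inner x (B *m x)) /\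
  (cos phi <= 0 -> inner x (B *m x) <= 0).
Proof.
move=> r0 phi0 nK hB.
have [->|x0] := eqVneq x 0.
  by rewrite mulmx0 -(scale0r (0 : 'cV[R]_m)) innerZl mul0r.
set c := cos phi in hB *; set s := sin phi.
have s0 : 0 < s by apply: sin_gt0_pi.
have cs : c ^+ 2 + s ^+ 2 = 1 by exact: cos2Dsin2.
pose y := (r * s)^-1 *: (B *m x - (r * c) *: x).
have rs0 : r * s != 0 by rewrite mulf_neq0 // gt_eqF.
have Bx : B *m x = (r * c) *: x + (r * s) *: y.
  by rewrite /y [X in _ + X]scalerA mulfV // scale1r addrCA subrr addr0.
have By : B *m y = (r * c) *: y - (r * s) *: x.
  apply: (scalerI rs0).
  have -> : (r * s) *: (B *m y) = B *m (B *m x) - (r * c) *: (B *m x).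
    have e : (r * s) *: y = B *m x - (r * c) *: x by rewrite Bx addrAC subrr add0r.
    by rewrite scalemxAr e mulmxBr -scalemxAr.
  rewrite hB Bx; move: (y) => u.
  have e : s * s = 1 - c * c by move: cs; rewrite !expr2; lra.
  by apply/matrixP => i j; rewrite !mxE; ring: e.
move: y By Bx => y By Bx.
pose p := inner x x; pose q := inner x y; pose t := inner y y.
have p0 : 0 < p by rewrite inner_gt0.
have t0 : 0 <= t by exact: inner_ge0.
pose K := B - B^T.
have adj (u v : 'cV[R]_m) : inner u (B^T *m v) = inner (B *m u) v.
  by rewrite /inner trmx_mul mulmxA.
have Kxx : inner x (K *m x) = 0.
  by rewrite mulmxBl innerBr adj innerC subrr.
have Kxy : inner x (K *m y) = - (r * s * (p + t)).
  rewrite mulmxBl innerBr adj By Bx innerBr innerDl !innerZr !innerZl -/p -/q -/t; ring.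
pose z := y - (q / p) *: x.
have Kxz : inner x (K *m z) = - (r * s * (p + t)).
  by rewrite mulmxBr -scalemxAr innerBr innerZr Kxx mulr0 subr0 Kxy.
have zz : inner z z = t - q ^+ 2 / p.
  rewrite /z !innerBl !innerBr !innerZl !innerZr (innerC y x) -/p -/q -/t.
  by field; rewrite gt_eqF.
have bound : (r * s * (p + t)) ^+ 2 <= (2 * r) ^+ 2 * (p * t - q ^+ 2).
  have -> : (2 * r) ^+ 2 * (p * t - q ^+ 2) = p * ((2 * r) ^+ 2 * inner z z).
    by rewrite zz; field; rewrite gt_eqF.
  have := cauchy_schwarz_sqr x (K *m z); rewrite Kxz sqrrN => h.
  apply: le_trans h _; rewrite -/p ler_pM2l // -!enorm_sqr -exprMn.
  rewrite ler_pXn2r ?nnegrE ?mulr_ge0 ?enorm_ge0 ?(ltW r0) //.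
  apply: le_trans (spectral_norm_bound K z) _.
  by apply: ler_wpM2r; [exact: enorm_ge0 | exact: nK].
have key : s ^+ 2 * (p + t) ^+ 2 <= 4 * (p * t - q ^+ 2).
  have r20 : 0 < r ^+ 2 by rewrite exprn_gt0.
  rewrite -(ler_pM2l r20).
  have -> : r ^+ 2 * (s ^+ 2 * (p + t) ^+ 2) = (r * s * (p + t)) ^+ 2 by ring.
  by apply: le_trans bound _; rewrite le_eqVlt; apply/orP; left; apply/eqP; ring.
have -> : inner x (B *m x) = r * (c * p + s * q).
  by rewrite Bx innerDr !innerZr -/p -/q; ring.
rewrite pmulr_rge0 // pmulr_rle0 //; split=> hc; first exact: skew_sign key hc.
have cs' : (- c) ^+ 2 + (- s) ^+ 2 = 1 by rewrite !sqrrN.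
have key' : (- s) ^+ 2 * (p + t) ^+ 2 <= 4 * (p * t - q ^+ 2) by rewrite sqrrN.
have nc : 0 <= - c by rewrite oppr_ge0.
have := skew_sign cs' p0 t0 key' nc; lra.
Qed.

(** A nonzero real vector in the plane of a conjugate pair: the real or the
    imaginary part of an eigenvector. *)
Lemma pair_vector m (B : 'M[R]_m) (l : C) : eigenvalue (toC B) l ->
  exists2 w : 'cV[R]_m, w != 0 &
    B *m (B *m w) = (2 * complex.Re l) *: (B *m w) - (cmod l ^+ 2) *: w.
Proof.
move=> /eigenvalue_colP[v hv v0].
pose M := B *m B - (2 * complex.Re l) *: B + (cmod l ^+ 2)%:M.
have MC : map_mx (real_complex R) M *m v = 0.
  have [e1 e2] := conjc_sum_prod l.
  rewrite /M map_mxD map_mxB map_mxM map_mxZ map_scalar_mx /= -e1 -e2 -/(toC B).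
  rewrite mulmxDl mulmxBl -mulmxA hv -scalemxAl -scalemxAr hv mul_scalar_mx !scalerA.
  by rewrite -scalerBl -scalerDl; apply/eqP; rewrite scaler_eq0; apply/orP; left; apply/eqP; ring.
have quad (w : 'cV[R]_m) : M *m w = 0 ->
    B *m (B *m w) = (2 * complex.Re l) *: (B *m w) - (cmod l ^+ 2) *: w.
  rewrite /M mulmxDl mulmxBl -mulmxA -scalemxAl mul_scalar_mx => /eqP.
  by rewrite -[X in _ + X]opprK subr_eq0 subr_eq => /eqP->; rewrite addrC.
clearbody M.
have Mre : M *m map_mx (@complex.Re R) v = 0.
  apply/matrixP => i j; have e := congr1 (fun N : 'cV[C]_m => complex.Re (N i j)) MC.
  rewrite /= !mxE Re_sum /= in e; rewrite !mxE -[RHS]e.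
  apply: eq_bigr => k _; rewrite !mxE.
  by case: (v k j) => a b /=; rewrite mul0r subr0.
have Mim : M *m map_mx (@complex.Im R) v = 0.
  apply/matrixP => i j; have e := congr1 (fun N : 'cV[C]_m => complex.Im (N i j)) MC.
  rewrite /= !mxE Im_sum /= in e; rewrite !mxE -[RHS]e.
  apply: eq_bigr => k _; rewrite !mxE.
  by case: (v k j) => a b /=; rewrite mul0r addr0.
have [re0|re0] := eqVneq (map_mx (@complex.Re R) v) 0; last first.
  by exists (map_mx (@complex.Re R) v) => //; exact: quad.
exists (map_mx (@complex.Im R) v); last exact: quad.
apply: contraNneq v0 => im0; apply/eqP/matrixP => i j; apply/eqP.
rewrite eq_complex mxE /=.
have /matrixP/(_ i j) := re0; have /matrixP/(_ i j) := im0.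
by rewrite !mxE => -> ->; rewrite !eqxx.
Qed.

(** With skewness at most one, the angle sums in the plane of a conjugate pair
    grow exactly like the multiples of [line_arg]. *)
Lemma skew_orbit_sum m (B : 'M[R]_m) (l : C) : eigenvalue (toC B) l ->
  complex.Im l != 0 -> (forall z, spectrum B z -> cmod z = cmod l) ->
  skewness B <= 1 ->
  exists2 w : 'cV[R]_m, w != 0 &
    forall n, n%:R * line_arg l - pi <= orbit_sum B n w.
Proof.
move=> el bl hmod skew; have [w w0 hw] := pair_vector el; exists w => // n.
have l0 : l != 0 by apply: contraNneq bl => ->.
have r0 : 0 < cmod l by rewrite cmod_gt0.
have rho : spectral_radius B = cmod l.
  apply/eqP; rewrite eq_le; apply/andP; split.
    by apply: ge_sup; [exists (cmod l); exists l | move=> _ [z /hmod ez <-]; rewrite ez].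
  apply: ub_le_sup; last by exists l.
  by exists (cmod l) => _ [z /hmod ez <-]; rewrite ez.
have nK : spectral_norm (B - B^T) <= 2 * cmod l.
  by move: skew; rewrite /skewness rho mulrC ler_pdivrMr ?mul1r // mulr_gt0.
set phi := acos (complex.Re l / cmod l).
have phi0 : 0 < phi < pi by exact: acos_nonreal.
have cphi : cos phi = complex.Re l / cmod l by rewrite acosK // in_itv /= Re_div_cmod_itv.
have hBj j : B *m (B *m (B ^+ j *m w)) =
   (2 * (cmod l * cos phi)) *: (B *m (B ^+ j *m w)) - (cmod l ^+ 2) *: (B ^+ j *m w).
  have -> : cmod l * cos phi = complex.Re l by rewrite cphi mulrC divfK // gt_eqF.
  have cB (v : 'cV[R]_m) : B *m (B ^+ j *m v) = B ^+ j *m (B *m v).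
    by rewrite -expmxSl exprSr -[_ * B]/(_ *m B) mulmxA.
  by rewrite !cB hw mulmxBr -!scalemxAr.
have sgn j := skew_inner_sign r0 phi0 nK (hBj j).
have c0 : (cmod l)^-1 != 0 by rewrite invr_eq0 cmod_eq0.
have := scaled_rotation l0 hw; set B1 := _ *: B => hB1.
have eB1 j : B1 ^+ j *m w = (cmod l)^-1 ^+ j *: (B ^+ j *m w).
  elim: j => [|j IH]; first by rewrite !expr0 scale1r.
  by rewrite !expmxSl IH -scalemxAl -scalemxAr scalerA exprS.
have [_ pos neg] := orbit_sum_rotation w0 phi0 hB1.
have inn j : inner (B1 ^+ j *m w) (B1 ^+ j.+1 *m w) =
   (cmod l)^-1 ^+ j * (cmod l)^-1 ^+ j.+1 * inner (B ^+ j *m w) (B *m (B ^+ j *m w)).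
  by rewrite !eB1 innerZl innerZr mulrA expmxSl.
have f0 j : 0 < (cmod l)^-1 ^+ j * (cmod l)^-1 ^+ j.+1.
  by rewrite mulr_gt0 // exprn_gt0 // invr_gt0.
rewrite -(orbit_sum_scale B n w c0) -/B1 line_argE -/phi.
have pi0 := pi_gt0 R.
have [hc|hc] := leP 0 (cos phi).
  have h j : 0 <= inner (B1 ^+ j *m w) (B1 ^+ j.+1 *m w).
    by rewrite inn pmulr_rge0 //; exact: (sgn j).1.
  by apply: le_trans (pos h n); rewrite lerD2r ler_wpM2l // ge_min lexx.
have h j : inner (B1 ^+ j *m w) (B1 ^+ j.+1 *m w) <= 0.
  by rewrite inn pmulr_rle0 //; exact: (sgn j).2 (ltW hc).
by apply: le_trans (neg h n); rewrite lerD2r ler_wpM2l // ge_min lexx orbT.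
Qed.

End Skewness.

(** * The theorem *)

Theorem theorem5p6 (R : realType) (d : nat) (hd : (0 < d)%N) (A : 'M[R]_d)
    (Ainv : A \in unitmx) (Aspec : nonreal_simple_isolated A) :
  exists theta : R,
    [/\ is_first_angular_value A theta,
        forall (k : nat) (dim : 'I_k -> nat)
          (Q : forall i, 'M[R]_(d, dim i)) (B : forall i, 'M[R]_(dim i)),
          modulus_decomposition A Q B ->
          exists2 t : 'I_k -> R,
            forall i, is_first_angular_value (B i) (t i) &
            theta = \big[Num.max/0]_(i < k) t i,
        opposite_real_eigenvalues A -> theta = pi / 2 &
        ~ opposite_real_eigenvalues A ->
          [/\ theta <= max_line_arg A,
              max_line_arg A = 0 -> theta = max_line_arg A &
              forall (k : nat) (dim : 'I_k -> nat)
                (Q : forall i, 'M[R]_(d, dim i)) (B : forall i, 'M[R]_(dim i)),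
                modulus_decomposition A Q B ->
                forall (i0 : 'I_k) (l : R[i]),
                  spectrum (B i0) l -> line_arg l = max_line_arg A ->
                  complex.Im l != 0 -> skewness (B i0) <= 1 ->
                  theta = line_arg l]].
Proof.
have [theta ht] := slope_exists hd Ainv; exists theta; split.
- exact/angval_first/is_slope_angval.
- move=> k dim Q B dec; have iAB := decomposition_intertwines dec.
  have /choice[t tB] i : exists t, is_slope (B i) t.
    by apply: slope_exists (decomposition_dim_gt0 dec i) (intertwines_unit (iAB i) Ainv).
  exists t => [i|].
    by apply/angval_first/is_slope_angval => //; exact: intertwines_unit (iAB i) Ainv.
  apply/eqP; rewrite eq_le; apply/andP; split.
    (* a vector of one modulus lies in one block, where [t i] bounds its sums *)
    apply/ler_addgt0Pr => e e0; apply: (slope_le ht) => s r w _ hs w0 hw.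
    have [i [x [x0 wE]]] := decomposition_block dec (fun z zs => (hs z zs).2) w0 hw.
    have [K hK] := (tB i).1 e e0; exists K => j.
    rewrite wE (intertwines_orbit_sum (iAB i)).
    apply: le_trans (hK x x0 j) _; rewrite lerD2r ler_wpM2l // lerD2r.
    exact: le_bigmax.
  apply: bigmax_le => [|i _]; first exact: slope_ge0 ht.
  apply/ler_addgt0Pr => e e0; have [K hK] := ht.1 e e0.
  apply: (slope_le (tB i)) => s r x _ _ x0 _; exists K => j.
  rewrite -(intertwines_orbit_sum (iAB i)); apply: hK.
  by apply: contraNneq x0 => /(intertwines_inj (iAB i)) ->.
- exact: slope_opposite.
move=> nop; have upper := slope_le_max_line_arg Ainv ht Aspec nop; split=> //.
  move=> max0; apply/eqP; rewrite eq_le upper max0; exact: slope_ge0 ht.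
move=> k dim Q B dec i0 l sl lmax iml skew.
have iAB := decomposition_intertwines dec i0.
apply/eqP; rewrite eq_le; apply/andP; split; first by rewrite lmax.
have hmod z : spectrum (B i0) z -> cmod z = cmod l.
  by case: dec => _ _ _ _ [r _ hr] sz; rewrite (hr i0 z sz) (hr i0 l sl).
have [x x0 hx] := skew_orbit_sum sl iml hmod skew.
apply: (slope_ge (w := Q i0 *m x) (K := pi) ht).
  by apply: contraNneq x0 => /(intertwines_inj iAB) ->.
by move=> j; rewrite (intertwines_orbit_sum iAB).
Qed.
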